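(* Every almost $\iota$-complex is locally equivalent to a standard complex.
   Context: $\mathbb F$ is the field with two elements and $\mathbb F[U]$ is graded with $\deg U=-2$. Chain complexes over $\mathbb F[U]$ have $U$-equivariant differential $\partial$ of degree $-1$. For $\mathbb F[U]$-module maps, ''$f\in\operatorname{im}U$'' means that the image of $f$ is contained in $U\cdot(\text{target})$. Two grading-preserving $\mathbb F[U]$-module homomorphisms $f,g\colon C_1\to C_2$ between free, finitely generated, $\mathbb Z$-graded chain complexes over $\mathbb F[U]$ are homotopic mod $U$, written $f\simeq g \bmod U$, if there is an $\mathbb F[U]$-module homomorphism $H\colon C_1\to C_2$ raising grading by one with $f+g+H\partial+\partial H\in\operatorname{im}U$. An almost $\iota$-complex $\mathcal C=(C,\overline\iota)$ consists of a free, finitely generated, $\mathbb Z$-graded chain complex $C$ over $\mathbb F[U]$ with $U^{-1}H_*(C)\cong\mathbb F[U,U^{-1}]$ supported in even gradings, and a grading-preserving $\mathbb F[U]$-module homomorphism $\overline\iota\colon C\to C$ with $\overline\iota\partial+\partial\overline\iota\in\operatorname{im}U$ and $\overline\iota^2\simeq\mathrm{id}\bmod U$; by convention gradings are normalized so that the maximal grading of a $U$-nontorsion homogeneous element of $H_*(C)$ is $0$. Write $\omega=1+\overline\iota$. An almost $\iota$-morphism $(C_1,\overline\iota_1)\to(C_2,\overline\iota_2)$ is a grading-preserving, $U$-equivariant chain map $f$ with $f\overline\iota_1\simeq\overline\iota_2 f\bmod U$; it is a local map if it induces an isomorphism on $U^{-1}H_*$. Two almost $\iota$-complexes are locally equivalent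 if there are local maps between them in both directions. Standard complexes: let $n\geq0$ and let $(a_i,b_i)=(a_1,b_2,a_3,b_4,\dots,a_{2n-1},b_{2n})$ with each $a_i\in\{-1,+1\}$ and each $b_i\in\mathbb Z\setminus\{0\}$. The standard complex $\mathcal C(a_i,b_i)$ is freely generated over $\mathbb F[U]$ by $T_0,\dots,T_{2n}$, with: for each odd $i$, $\omega T_{i-1}=T_i$ if $a_i=-1$ and $\omega T_i=T_{i-1}$ if $a_i=+1$; for each even $i\geq2$, $\partial T_{i-1}=U^{|b_i|}T_i$ if $b_i<0$ and $\partial T_i=U^{|b_i|}T_{i-1}$ if $b_i>0$; all other values of $\omega$ and $\partial$ on generators are zero. The grading is determined by $\operatorname{gr}(T_0)=0$, $\deg\omega=0$, $\deg\partial=-1$. *)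

(* Defs.v *)
From HB Require Import structures.
From mathcomp Require Import all_boot all_order all_algebra.
From mathcomp Require Import ring_quotient zify.
From mathcomp Require Import boolp.

Set Implicit Arguments.
Unset Strict Implicit.
Unset Printing Implicit Defensive.

Import Order.TTheory GRing.Theory Num.Theory.
Local Open Scope ring_scope.
Local Open Scope quotient_scope.

(* U is written 'X. *)
Notation FU := {poly 'F_2}.

Definition submod_zmod (R : nzRingType) (V : lmodType R) (S : submodClosed V) :
    zmodClosed V :=
  HB.pack (GRing.SubmodClosed.sort S)
    (GRing.isZmodClosed.Build V (GRing.SubmodClosed.sort S)
       (GRing.submod_closedB (submodClosedP S))).

Section QuotientModule.
Variables (R : nzRingType) (V : lmodType R) (S : submodClosed V).

Definition quotmod := Quotient.quot (submod_zmod S).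
HB.instance Definition _ := GRing.Zmodule.on quotmod.

Definition quotmod_class (v : V) : quotmod := \pi_(Quotient.quot (submod_zmod S)) v.

Lemma quotmod_classP v w : (quotmod_class v = quotmod_class w) <-> v - w \in S.
Proof.
by split=> [/eqP|h]; last apply/eqP;
  rewrite -[_ == _](Quotient.idealrBE (submod_zmod S)).
Qed.

Lemma quotmod_classK (h : quotmod) : quotmod_class (repr h) = h.
Proof. exact: reprK. Qed.

Lemma quotmod_classD v w :
  quotmod_class (v + w) = quotmod_class v + quotmod_class w.
Proof. exact: raddfD. Qed.

Definition quotmod_scale (c : R) (h : quotmod) := quotmod_class (c *: repr h).

Lemma quotmod_classZ c v : quotmod_scale c (quotmod_class v) = quotmod_class (c *: v).
Proof.
apply/quotmod_classP; rewrite -scalerBr rpredZ //.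
by apply/quotmod_classP; rewrite quotmod_classK.
Qed.

Fact quotmod_scaleA a b h :
  quotmod_scale a (quotmod_scale b h) = quotmod_scale (a * b) h.
Proof. by rewrite -[h]quotmod_classK !quotmod_classZ scalerA. Qed.

Fact quotmod_scale1 : left_id 1 quotmod_scale.
Proof. by move=> h; rewrite -[h]quotmod_classK quotmod_classZ scale1r. Qed.

Fact quotmod_scaleDr : right_distributive quotmod_scale +%R.
Proof.
move=> a h k; rewrite -[h]quotmod_classK -[k]quotmod_classK.
by rewrite -quotmod_classD !quotmod_classZ -quotmod_classD scalerDr.
Qed.

Fact quotmod_scaleDl h : {morph quotmod_scale^~ h : a b / a + b}.
Proof.
move=> a b; rewrite -[h]quotmod_classK !quotmod_classZ.
by rewrite -quotmod_classD scalerDl.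
Qed.

HB.instance Definition _ := GRing.Zmodule_isLmodule.Build R quotmod
  quotmod_scaleA quotmod_scale1 quotmod_scaleDr quotmod_scaleDl.

Fact quotmod_class_linear : linear quotmod_class.
Proof. by move=> c v w; rewrite quotmod_classD -quotmod_classZ. Qed.

HB.instance Definition _ :=
  GRing.isLinear.Build R V quotmod _ quotmod_class quotmod_class_linear.

End QuotientModule.

Section Localization.
Variable M : lmodType FU.
Implicit Types p q : M * nat.

Definition loc_rel p q : bool :=
  `[< exists j, 'X^(j + q.2) *: p.1 = 'X^(j + p.2) *: q.1 >].

Fact loc_rel_equiv : equiv_class_of loc_rel.
Proof.
split=> [p|p q|q p r].
- by apply/asboolP; exists 0.
- by apply/asboolP/asboolP => -[j e]; exists j.
- move=> /asboolP[j e1] /asboolP[k e2]; apply/asboolP.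
  exists (j + k + q.2)%N.
  have -> : (j + k + q.2 + r.2 = (k + r.2) + (j + q.2))%N by lia.
  rewrite exprD -scalerA e1 scalerA mulrC -scalerA e2 scalerA -exprD.
  by congr ('X^_ *: _); lia.
Qed.

Canonical loc_equiv := EquivRelPack loc_rel_equiv.

Definition loc := {eq_quot loc_equiv}.
HB.instance Definition _ := Choice.on loc.
HB.instance Definition _ : EqQuotient (M * nat)%type loc_equiv loc :=
  EqQuotient.on loc.

(* loc_frac m k is the fraction m / U^k. *)
Definition loc_frac (m : M) (k : nat) : loc := \pi_loc (m, k).

Lemma loc_fracP m k n l : loc_frac m k = loc_frac n l <->
  exists j, 'X^(j + l) *: m = 'X^(j + k) *: n.
Proof.
rewrite /loc_frac; split=> [/eqP|e].
  by rewrite eqmodE => /asboolP.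
by apply/eqP; rewrite eqmodE; apply/asboolP.
Qed.

Lemma loc_frac_repr (x : loc) : loc_frac (repr x).1 (repr x).2 = x.
Proof. by rewrite /loc_frac -surjective_pairing reprK. Qed.

Lemma loc_frac_ind (P : loc -> Prop) : (forall m k, P (loc_frac m k)) -> forall x, P x.
Proof. by move=> H x; rewrite -[x]loc_frac_repr. Qed.

Lemma loc_fracX j m k : loc_frac ('X^j *: m) (j + k) = loc_frac m k.
Proof. by apply/loc_fracP; exists 0%N; rewrite scalerA -exprD !add0n addnC. Qed.

Definition loc_zero : loc := loc_frac 0 0.
Definition loc_opp (x : loc) : loc := loc_frac (- (repr x).1) (repr x).2.
Definition loc_add (x y : loc) : loc :=
  loc_frac ('X^((repr y).2) *: (repr x).1 + 'X^((repr x).2) *: (repr y).1)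
           ((repr x).2 + (repr y).2).
Definition loc_scale (c : FU) (x : loc) : loc :=
  loc_frac (c *: (repr x).1) (repr x).2.

Let scaleXC (c : FU) i (m : M) : 'X^i *: (c *: m) = c *: ('X^i *: m).
Proof. by rewrite !scalerA mulrC. Qed.

Lemma loc_oppE m k : loc_opp (loc_frac m k) = loc_frac (- m) k.
Proof.
have /loc_fracP[j e] := loc_frac_repr (loc_frac m k).
by apply/loc_fracP; exists j; rewrite !scalerN e.
Qed.

Lemma loc_scaleE c m k : loc_scale c (loc_frac m k) = loc_frac (c *: m) k.
Proof.
have /loc_fracP[j e] := loc_frac_repr (loc_frac m k).
by apply/loc_fracP; exists j; rewrite !scaleXC e.
Qed.

Lemma loc_addE m k n l :
  loc_add (loc_frac m k) (loc_frac n l) =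
  loc_frac ('X^l *: m + 'X^k *: n) (k + l).
Proof.
rewrite /loc_add.
have /loc_fracP[] := loc_frac_repr (loc_frac m k).
have /loc_fracP[] := loc_frac_repr (loc_frac n l).
case: (repr _) => n' l'; case: (repr _) => m' k' /= i ei j ej.
apply/loc_fracP; exists (i + j)%N; rewrite !scalerDr !scalerA -!exprD.
congr (_ + _).
- have -> : (i + j + (k + l) + l' = (i + l + l') + (j + k))%N by lia.
  have -> : (i + j + (k' + l') + l = (i + l + l') + (j + k'))%N by lia.
  by rewrite exprD -scalerA ej scalerA -exprD.
- have -> : (i + j + (k + l) + k' = (j + k + k') + (i + l))%N by lia.
  have -> : (i + j + (k' + l') + k = (j + k + k') + (i + l'))%N by lia.
  by rewrite exprD -scalerA ei scalerA -exprD.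
Qed.

Fact loc_addA : associative loc_add.
Proof.
elim/loc_frac_ind=> m k; elim/loc_frac_ind=> n l; elim/loc_frac_ind=> o r.
rewrite !loc_addE !scalerDr !scalerA -!exprD -!addrA !addnA.
by rewrite [(r + l)%N]addnC [(r + k)%N]addnC.
Qed.

Fact loc_addC : commutative loc_add.
Proof.
by elim/loc_frac_ind=> m k; elim/loc_frac_ind=> n l;
  rewrite !loc_addE addrC addnC.
Qed.

Fact loc_add0 : left_id loc_zero loc_add.
Proof. by elim/loc_frac_ind=> m k; rewrite loc_addE scaler0 add0r scale1r. Qed.

Fact loc_addN : left_inverse loc_zero loc_opp loc_add.
Proof.
elim/loc_frac_ind=> m k; rewrite loc_oppE loc_addE scalerN addNr.
by apply/loc_fracP; exists 0%N; rewrite !scaler0.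
Qed.

HB.instance Definition _ :=
  GRing.isZmodule.Build loc loc_addA loc_addC loc_add0 loc_addN.

Lemma loc_fracD m k n l :
  loc_frac m k + loc_frac n l = loc_frac ('X^l *: m + 'X^k *: n) (k + l).
Proof. exact: loc_addE. Qed.

Fact loc_scaleA a b x : loc_scale a (loc_scale b x) = loc_scale (a * b) x.
Proof. by elim/loc_frac_ind: x => m k; rewrite !loc_scaleE scalerA. Qed.

Fact loc_scale1 : left_id 1 loc_scale.
Proof. by elim/loc_frac_ind=> m k; rewrite loc_scaleE scale1r. Qed.

Fact loc_scaleDr : right_distributive loc_scale +%R.
Proof.
move=> a; elim/loc_frac_ind=> m k; elim/loc_frac_ind=> n l.
by rewrite loc_fracD !loc_scaleE loc_fracD scalerDr !scaleXC.
Qed.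

Fact loc_scaleDl x : {morph loc_scale^~ x : a b / a + b}.
Proof.
move=> a b; elim/loc_frac_ind: x => m k; rewrite !loc_scaleE loc_fracD.
by rewrite -scalerDr -scalerDl loc_fracX.
Qed.

HB.instance Definition _ := GRing.Zmodule_isLmodule.Build FU loc
  loc_scaleA loc_scale1 loc_scaleDr loc_scaleDl.

Lemma loc_fracZ c m k : c *: loc_frac m k = loc_frac (c *: m) k.
Proof. exact: loc_scaleE. Qed.

Lemma loc_frac_eq0 m k : loc_frac m k = 0 <-> exists j, 'X^j *: m = 0.
Proof.
split=> [/loc_fracP[j]|[j e]].
  by rewrite scaler0 addn0 => e; exists j.
by apply/loc_fracP; exists j; rewrite scaler0 addn0.
Qed.

End Localization.

Section LocalizationMap.
Variables (M N : lmodType FU) (f : {linear M -> N}).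

Definition loc_map (x : loc M) : loc N := loc_frac (f (repr x).1) (repr x).2.

Lemma loc_mapE m k : loc_map (loc_frac m k) = loc_frac (f m) k.
Proof.
have /loc_fracP[j e] := loc_frac_repr (loc_frac m k).
by apply/loc_fracP; exists j; rewrite -!linearZ e.
Qed.

Fact loc_map_linear : linear loc_map.
Proof.
move=> c; elim/loc_frac_ind=> m k; elim/loc_frac_ind=> n l.
rewrite loc_fracZ loc_fracD !loc_mapE loc_fracZ loc_fracD.
by rewrite linearD !linearZ/= linearZ.
Qed.

HB.instance Definition _ :=
  GRing.isLinear.Build FU (loc M) (loc N) _ loc_map loc_map_linear.

End LocalizationMap.

(* A finitely generated free graded F[U]-module, given by the degrees of a
   homogeneous basis; its elements are the row vectors of coordinates. *)
Record graded_free := GradedFree {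
  grank : nat;
  gdeg : 'I_grank -> int
}.

Definition gcarrier (M : graded_free) : lmodType FU := 'rV[FU]_(grank M).
Coercion gcarrier : graded_free >-> GRing.Lmodule.type.

(* deg U = -2: the monomial U^k e_i has degree gdeg i - 2k. *)
Definition homogeneous (M : graded_free) (d : int) (x : M) : Prop :=
  forall (i : 'I_(grank M)) (k : nat),
    ((x : 'rV[FU]_(grank M)) 0 i)`_k != 0 -> d = gdeg i - 2 * k%:Z.

Definition of_degree (M N : graded_free) (e : int) (f : M -> N) : Prop :=
  forall d x, homogeneous d x -> homogeneous (d + e) (f x).

Definition in_imU (M N : graded_free) (f : M -> N) : Prop :=
  forall x, exists y, f x = 'X *: y.

Record complex := Complex {
  cmod :> graded_free;
  diff : {linear cmod -> cmod};
  diff_degree : of_degree (-1) diff;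
  diff_diff : forall x, diff (diff x) = 0
}.

Definition homotopic_modU (C D : complex) (f g : C -> D) : Prop :=
  exists H : {linear C -> D}, of_degree 1 H /\
    in_imU (fun x => f x + g x + H (diff C x) + diff D (H x)).

Section Homology.
Variable C : complex.

Definition is_cycle : {pred C} := fun x => diff C x == 0.

Fact is_cycle_submod : submod_closed is_cycle.
Proof.
split=> [|c x y]; rewrite !unfold_in ?linear0 // => /eqP hx /eqP hy.
by rewrite linearP hx hy scaler0 addr0.
Qed.
HB.instance Definition _ :=
  GRing.isSubmodClosed.Build FU C is_cycle is_cycle_submod.

Definition cycle := {x : C | is_cycle x}.
HB.instance Definition _ := Choice.on cycle.
HB.instance Definition _ := [isSub of cycle for sval].
HB.instance Definition _ := [SubChoice_isSubLmodule of cycle by <:].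

Definition is_boundary : {pred cycle} :=
  fun z => `[< exists y, diff C y = \val z >].

Fact is_boundary_submod : submod_closed is_boundary.
Proof.
split=> [|c z w].
  by apply/asboolP; exists 0; rewrite !linear0.
move=> /asboolP[x hx] /asboolP[y hy]; apply/asboolP.
by exists (c *: x + y); rewrite !linearP hx hy.
Qed.
HB.instance Definition _ :=
  GRing.isSubmodClosed.Build FU cycle is_boundary is_boundary_submod.

Definition homology : lmodType FU := quotmod is_boundary.

Definition homology_class : {linear cycle -> homology} :=
  @quotmod_class _ _ is_boundary.

Definition homology_homogeneous (d : int) (h : homology) : Prop :=
  exists2 z : cycle, h = homology_class z & homogeneous d (\val z).

Definition U_nontorsion (h : homology) : Prop := forall k, 'X^k *: h != 0.

(* h / U^k has degree deg h + 2k. *)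
Definition loc_homology_homogeneous (d : int) (x : loc homology) : Prop :=
  exists h k, x = loc_frac h k /\ homology_homogeneous (d - 2 * k%:Z) h.

End Homology.

Record chain_map (C D : complex) := ChainMap {
  chain_fun :> {linear C -> D};
  chain_degree : of_degree 0 chain_fun;
  chain_comm : forall x, chain_fun (diff C x) = diff D (chain_fun x)
}.

Section HomologyMap.
Variables (C D : complex) (f : chain_map C D).

Fact cycle_map_subproof (z : cycle C) : is_cycle (f (\val z)).
Proof.
by rewrite /is_cycle -chain_comm (eqP (valP z)) linear0.
Qed.

Definition cycle_map (z : cycle C) : cycle D := Sub (f (\val z)) (cycle_map_subproof z).

Definition homology_map (h : homology C) : homology D :=
  homology_class D (cycle_map (repr (h : quotmod (@is_boundary C)))).

Lemma homology_mapE z :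
  homology_map (homology_class C z) = homology_class D (cycle_map z).
Proof.
apply/quotmod_classP/asboolP.
have /quotmod_classP/asboolP[y hy] := quotmod_classK (homology_class C z).
by exists (f y); rewrite -chain_comm hy !linearB.
Qed.

Fact homology_map_linear : linear homology_map.
Proof.
move=> c h k.
rewrite -[h](quotmod_classK (S := @is_boundary C)).
rewrite -[k](quotmod_classK (S := @is_boundary C)).
rewrite -[quotmod_class _ _]/(homology_class C _) -linearP !homology_mapE.
rewrite -linearP; congr (homology_class D _); apply: val_inj.
by rewrite /= !linearP.
Qed.

HB.instance Definition _ := GRing.isLinear.Build FU (homology C) (homology D) _
  homology_map homology_map_linear.

End HomologyMap.

(* F[U, U^-1] is U^-1 F[U].  A linear map between localizations is
   automatically F[U, U^-1]-linear, since U acts invertibly on both sides. *)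
Record almost_iota_complex := AlmostIotaComplex {
  aic_complex :> complex;
  iota : {linear aic_complex -> aic_complex};
  iota_degree : of_degree 0 iota;
  iota_comm : in_imU (fun x =>
    iota (diff aic_complex x) + diff aic_complex (iota x));
  iota_iota : homotopic_modU (fun x => iota (iota x)) (fun x => x);
  loc_homology_iso :
    exists phi : {linear loc (homology aic_complex) -> loc FU^o}, bijective phi;
  loc_homology_even : forall d (x : loc (homology aic_complex)),
    loc_homology_homogeneous d x -> x != 0 -> (2 %| d)%Z;
  nontorsion_0 : exists2 h : homology aic_complex,
    homology_homogeneous 0 h & U_nontorsion h;
  nontorsion_le0 : forall d (h : homology aic_complex),
    homology_homogeneous d h -> U_nontorsion h -> d <= 0
}.

Record almost_iota_morphism (C D : almost_iota_complex) := AlmostIotaMorphism {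
  aim_map :> chain_map C D;
  aim_iota : homotopic_modU (fun x => aim_map (iota C x))
                            (fun x => iota D (aim_map x))
}.

Definition is_local (C D : almost_iota_complex) (f : almost_iota_morphism C D) :=
  bijective (loc_map (homology_map f)).

Definition locally_equivalent (C D : almost_iota_complex) : Prop :=
  (exists f : almost_iota_morphism C D, is_local f) /\
  (exists g : almost_iota_morphism D C, is_local g).

Section StandardComplex.
(* a k and b k stand for a_{2k+1} and b_{2k+2}; a k is meant to be 1 or -1. *)
Variables (n : nat) (a b : 'I_n -> int).
Hypothesis b_neq0 : forall k, b k != 0.

Definition stdT (i : nat) : 'I_(n.*2.+1) := inord i.

(* deg T_{2k+1} = deg T_{2k} and deg T_{2k+2} = deg T_{2k+1} + sgn b - 2 b for
   b = b_{2k+2}, as forced by deg omega = 0 and deg diff = -1. *)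
Definition std_module : graded_free := GradedFree
  (fun i : 'I_(n.*2.+1) =>
     \sum_(k < n | (k.*2.+1 < i)%N) (Num.sg (b k) - 2 * b k)).

(* Matrices act on row vectors from the right: delta_mx i j sends T_i to T_j. *)
Definition std_diff_mx : 'M[FU]_(n.*2.+1) := \sum_(k < n)
  'X^`|b k|%N *: (if b k < 0 then delta_mx (stdT k.*2.+1) (stdT k.*2.+2)
                  else delta_mx (stdT k.*2.+2) (stdT k.*2.+1)).

Definition std_omega_mx : 'M[FU]_(n.*2.+1) := \sum_(k < n)
  (if a k == -1 then delta_mx (stdT k.*2) (stdT k.*2.+1)
   else delta_mx (stdT k.*2.+1) (stdT k.*2)).

Definition std_diff : {linear std_module -> std_module} := mulmxr std_diff_mx.

Definition std_iota : {linear std_module -> std_module} :=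
  mulmxr (1%:M + std_omega_mx).

Let dsrc (k : 'I_n) := if b k < 0 then k.*2.+1 else k.*2.+2.
Let dtgt (k : 'I_n) := if b k < 0 then k.*2.+2 else k.*2.+1.
Let wsrc (k : 'I_n) := if a k == -1 then k.*2 else k.*2.+1.
Let wtgt (k : 'I_n) := if a k == -1 then k.*2.+1 else k.*2.

Let diff_mxE : std_diff_mx =
  \sum_(k < n) 'X^`|b k|%N *: delta_mx (stdT (dsrc k)) (stdT (dtgt k)).
Proof. by apply: eq_bigr => k _; rewrite /dsrc /dtgt; case: ifP. Qed.

Let omega_mxE : std_omega_mx =
  \sum_(k < n) 1 *: delta_mx (stdT (wsrc k)) (stdT (wtgt k)).
Proof. by apply: eq_bigr => k _; rewrite scale1r /wsrc /wtgt; case: ifP. Qed.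

Let stdT_val i : (i <= n.*2)%N -> stdT i = i :> nat.
Proof. by move=> h; rewrite inordK. Qed.

Let stdT_eq i j : (i <= n.*2)%N -> (j <= n.*2)%N -> (stdT i == stdT j) = (i == j).
Proof. by move=> hi hj; rewrite -val_eqE /= !inordK. Qed.

Let dsrc_le k : (dsrc k <= n.*2)%N.
Proof. by rewrite /dsrc; have := ltn_ord k; case: ifP => _; lia. Qed.
Let dtgt_le k : (dtgt k <= n.*2)%N.
Proof. by rewrite /dtgt; have := ltn_ord k; case: ifP => _; lia. Qed.
Let wsrc_le k : (wsrc k <= n.*2)%N.
Proof. by rewrite /wsrc; have := ltn_ord k; case: ifP => _; lia. Qed.
Let wtgt_le k : (wtgt k <= n.*2)%N.
Proof. by rewrite /wtgt; have := ltn_ord k; case: ifP => _; lia. Qed.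

Let mul_delta (p q r s : 'I_n -> nat) (c e : 'I_n -> FU) :
  (forall k, (q k <= n.*2)%N) -> (forall k, (r k <= n.*2)%N) ->
  (\sum_k c k *: delta_mx (stdT (p k)) (stdT (q k))) *m
  (\sum_l e l *: delta_mx (stdT (r l)) (stdT (s l))) =
  \sum_k \sum_(l | q k == r l)
     (c k * e l) *: (delta_mx (stdT (p k)) (stdT (s l)) : 'M_(n.*2.+1)).
Proof.
move=> hq hr; rewrite mulmx_suml; apply: eq_bigr => k _.
rewrite mulmx_sumr [RHS]big_mkcond; apply: eq_bigr => l _.
rewrite -scalemxAl -scalemxAr scalerA mul_delta_mx_cond stdT_eq //.
by case: eqP => _; rewrite ?mulr1n // mulr0n scaler0.
Qed.

Let diff_mx_sq : std_diff_mx *m std_diff_mx = 0.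
Proof.
rewrite diff_mxE mul_delta //; apply: big1 => k _; apply: big1 => l /eqP h.
exfalso; move: h; rewrite /dsrc /dtgt.
have [->|] := eqVneq k l; first by case: ifP => _; lia.
by rewrite -val_eqE /=; case: ifP; case: ifP; lia.
Qed.

Let omega_mx_sq : std_omega_mx *m std_omega_mx = 0.
Proof.
rewrite omega_mxE mul_delta //; apply: big1 => k _; apply: big1 => l /eqP h.
exfalso; move: h; rewrite /wsrc /wtgt.
have [->|] := eqVneq k l; first by case: ifP => _; lia.
by rewrite -val_eqE /=; case: ifP; case: ifP; lia.
Qed.

Let bexp := (\sum_(k < n) `|b k|)%N.

Let bexp_ge k : (`|b k| <= bexp)%N.
Proof. by rewrite /bexp (bigD1 k) //= leq_addr. Qed.

Let rev_mx : 'M[FU]_(n.*2.+1) :=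
  \sum_(k < n) 'X^(bexp - `|b k|) *: delta_mx (stdT (dtgt k)) (stdT (dsrc k)).

Let dsrc_inj k l : (dsrc k == dsrc l) = (l == k).
Proof.
apply/eqP/eqP => [|-> //]; rewrite /dsrc => h; apply: val_inj => /=.
by move: h; case: ifP; case: ifP; lia.
Qed.

Let dtgt_inj k l : (dtgt k == dtgt l) = (l == k).
Proof.
apply/eqP/eqP => [|-> //]; rewrite /dtgt => h; apply: val_inj => /=.
by move: h; case: ifP; case: ifP; lia.
Qed.

Let diff_rev : std_diff_mx *m rev_mx =
  \sum_k 'X^bexp *: delta_mx (stdT (dsrc k)) (stdT (dsrc k)).
Proof.
rewrite diff_mxE mul_delta //; apply: eq_bigr => k _.
rewrite (eq_bigl (pred1 k)) ?big_pred1_eq => [|l]; last exact: dtgt_inj.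
by rewrite -exprD subnKC.
Qed.

Let rev_diff : rev_mx *m std_diff_mx =
  \sum_k 'X^bexp *: delta_mx (stdT (dtgt k)) (stdT (dtgt k)).
Proof.
rewrite diff_mxE mul_delta //; apply: eq_bigr => k _.
rewrite (eq_bigl (pred1 k)) ?big_pred1_eq => [|l]; last exact: dsrc_inj.
by rewrite -exprD subnK.
Qed.

Let sum_pairs (V : zmodType) (G : nat -> V) m :
  \sum_(i < m.*2.+1) G i = G 0%N + \sum_(k < m) (G k.*2.+1 + G k.*2.+2).
Proof.
elim: m => [|m IH]; first by rewrite big_ord_recl !big_ord0.
by rewrite doubleS 2!big_ord_recr IH [in RHS]big_ord_recr /= !addrA.
Qed.

Let one_mxE : 'X^bexp *: (1%:M : 'M[FU]_(n.*2.+1)) =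
  'X^bexp *: delta_mx ord0 ord0 + std_diff_mx *m rev_mx + rev_mx *m std_diff_mx.
Proof.
rewrite diff_rev rev_diff mx1_sum_delta.
have -> : \sum_i delta_mx i i = \sum_(i < n.*2.+1)
    delta_mx (stdT i) (stdT i) :> 'M[FU]_(n.*2.+1).
  by apply: eq_bigr => i _; rewrite /stdT inord_val.
rewrite (sum_pairs (fun j => delta_mx (stdT j) (stdT j))) scalerDr -addrA; congr (_ + _).
  by congr (_ *: delta_mx _ _); apply: val_inj; rewrite /= stdT_val.
rewrite -big_split scaler_sumr; apply: eq_bigr => k _ /=.
by rewrite scalerDr /dsrc /dtgt; case: ifP => _ //; rewrite addrC.
Qed.

Let gdeg_odd (k : 'I_n) : gdeg (stdT k.*2.+1 : 'I_(grank std_module)) = gdeg (stdT k.*2 : 'I_(grank std_module)).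
Proof.
rewrite /=; apply: eq_bigl => l; rewrite !inordK //; have := ltn_ord k; lia.
Qed.

Let gdeg_even (k : 'I_n) : gdeg (stdT k.*2.+2 : 'I_(grank std_module)) =
  gdeg (stdT k.*2.+1 : 'I_(grank std_module)) + (Num.sg (b k) - 2 * b k).
Proof.
rewrite /= (bigD1 k) /=; last by rewrite inordK; have := ltn_ord k; lia.
rewrite addrC; congr (_ + _); apply: eq_bigl => l.
rewrite !inordK; try by have := ltn_ord k; lia.
by rewrite -val_eqE /=; lia.
Qed.

Let gdeg_diff k : gdeg (stdT (dtgt k) : 'I_(grank std_module)) =
  gdeg (stdT (dsrc k) : 'I_(grank std_module)) + 2 * `|b k|%N%:Z - 1.
Proof.
rewrite /dtgt /dsrc; have := b_neq0 k; case: ifP => hb hb0; rewrite gdeg_even.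
  by rewrite ltr0_sg //; lia.
by rewrite gtr0_sg; lia.
Qed.

Let gdeg_omega k : gdeg (stdT (wtgt k) : 'I_(grank std_module)) =
  gdeg (stdT (wsrc k) : 'I_(grank std_module)).
Proof. by rewrite /wtgt /wsrc; case: ifP => _; rewrite gdeg_odd. Qed.

Let delta_homogeneous (p q : 'I_n -> nat) (c : 'I_n -> nat) (e : int) :
  (forall k, gdeg (stdT (q k) : 'I_(grank std_module)) =
     gdeg (stdT (p k) : 'I_(grank std_module)) + 2 * (c k)%:Z + e) ->
  @of_degree std_module std_module e
    (mulmxr (\sum_k 'X^(c k) *: delta_mx (stdT (p k)) (stdT (q k)))).
Proof.
move=> hdeg d x hx i m.
rewrite /= mulmx_sumr summxE coef_sum => hm.
case: (pickP (fun k =>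
   ((x *m ('X^(c k) *: delta_mx (stdT (p k)) (stdT (q k)))) 0 i)`_m != 0)).
- move=> k; rewrite -scalemxAr mxE mxE (bigD1 (stdT (p k))) //= big1; last first.
    by move=> j hj; rewrite mxE (negbTE hj) mulr0.
  rewrite addr0 mxE eqxx /=; have [->|_] := eqVneq i; last first.
    by rewrite mulr0 mulr0 coef0 eqxx.
  rewrite mulr1 coefXnM; case: ltnP => [|hcm]; first by rewrite eqxx.
  by move=> /hx ->; have := hdeg k; rewrite /=; lia.
- move=> h; case/eqP: hm; apply: big1 => k _.
  by have /negbFE/eqP := h k.
Qed.

Fact std_diff_degree : of_degree (-1) std_diff.
Proof.
rewrite /std_diff diff_mxE; apply: delta_homogeneous => k.
exact: gdeg_diff.
Qed.

Fact std_diff_diff x : std_diff (std_diff x) = 0.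
Proof. by rewrite /= -mulmxA diff_mx_sq mulmx0. Qed.

Definition std_chain_complex : complex := Complex std_diff_degree std_diff_diff.

Let homogeneousD d (x y : std_module) :
  homogeneous d x -> homogeneous d y -> homogeneous d (x + y).
Proof.
move=> hx hy i k; rewrite mxE coefD.
have [->|/hx //] := eqVneq ((x : 'rV[FU]_(grank std_module)) 0 i)`_k 0.
by rewrite add0r => /hy.
Qed.

Fact std_iota_degree :
  @of_degree std_chain_complex std_chain_complex 0 std_iota.
Proof.
move=> d x hx; rewrite /= mulmxDr mulmx1; apply: homogeneousD.
  by rewrite addr0.
rewrite omega_mxE; under eq_bigr => k _ do rewrite -[1](expr0 'X).
apply: (@delta_homogeneous _ _ (fun=> 0%N)) hx => k.
by rewrite gdeg_omega mulr0 !addr0.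
Qed.

Let FU_char2 (x : std_module) : x + x = 0.
Proof.
apply/matrixP => i j; rewrite !mxE; apply/polyP => k; rewrite coefD coef0.
by case: (_`_k) => [[|[|m]] hm] //; apply: val_inj.
Qed.

Let diffX : exists D' : 'M[FU]_(n.*2.+1), std_diff_mx = 'X *: D'.
Proof.
exists (\sum_(k < n) 'X^(`|b k|.-1) *: delta_mx (stdT (dsrc k)) (stdT (dtgt k))).
rewrite diff_mxE scaler_sumr; apply: eq_bigr => k _.
rewrite scalerA -exprS prednK // absz_gt0; exact: b_neq0.
Qed.

Fact std_iota_comm : @in_imU std_chain_complex std_chain_complex
  (fun x => std_iota (std_diff x) + std_diff (std_iota x)).
Proof.
move=> x; have [D' hD] := diffX.
exists ((x *m D') *m (1%:M + std_omega_mx) + x *m (1%:M + std_omega_mx) *m D').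
rewrite /= hD -!scalemxAr -!scalemxAl.
exact: (esym (scalerDr _ _ _)).
Qed.

Fact std_iota_iota : @homotopic_modU std_chain_complex std_chain_complex
  (fun x => std_iota (std_iota x)) (fun x => x).
Proof.
exists \0%R; split=> [d x _ i k|x]; first by rewrite mxE coef0 eqxx.
exists 0; rewrite scaler0 /= mul0mx !addr0 -mulmxA.
have -> : (1%:M + std_omega_mx) *m (1%:M + std_omega_mx) =
    1%:M + (std_omega_mx + std_omega_mx).
  by rewrite mulmxDl !mulmxDr omega_mx_sq !mul1mx !mulmx1 addr0 -addrA.
rewrite !mulmxDr mulmx1 addrAC.
by rewrite -[RHS](addr0 0); congr (_ + _); exact: FU_char2.
Qed.

Let coord0 (x : std_module) : FU := (x : 'rV_(n.*2.+1)) 0 ord0.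

Let coord0_linear : linear (coord0 : std_module -> FU^o).
Proof. by move=> c x y; rewrite /coord0 !mxE. Qed.

Let coord0_diff x : coord0 (std_diff x) = 0.
Proof.
rewrite /coord0 /= diff_mxE mulmx_sumr summxE; apply: big1 => k _.
rewrite -scalemxAr mxE mxE big1 ?mulr0 // => i _; rewrite mxE.
suff -> : (ord0 == stdT (dtgt k)) = false by rewrite andbF mulr0.
by rewrite -val_eqE /= stdT_val // /dtgt; case: ifP.
Qed.

Local Notation cls := (homology_class std_chain_complex).

Let rep (h : homology std_chain_complex) : cycle std_chain_complex :=
  repr (h : quotmod (@is_boundary std_chain_complex)).

Let repK h : cls (rep h) = h.
Proof. exact: quotmod_classK. Qed.

Definition std_coord (h : homology std_chain_complex) : FU^o :=
  coord0 (\val (rep h)).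

Let std_coordE z : std_coord (cls z) = coord0 (\val z).
Proof.
have /quotmod_classP/asboolP[y /(congr1 coord0)] := repK (cls z).
rewrite coord0_diff /coord0 /= !mxE => /esym/eqP.
by rewrite subr_eq0 => /eqP.
Qed.

Fact std_coord_linear : linear std_coord.
Proof.
move=> c h k; rewrite -[h]repK -[k]repK -linearP !std_coordE.
by rewrite /= coord0_linear.
Qed.

HB.instance Definition _ :=
  GRing.isLinear.Build FU
    (homology std_chain_complex) FU^o _ std_coord std_coord_linear.

Let e0 : std_module := delta_mx 0 ord0.

Let e0_cycle : is_cycle (e0 : std_chain_complex).
Proof.
rewrite /is_cycle /= /e0 diff_mxE mulmx_sumr; apply/eqP; apply: big1 => k _.
rewrite -scalemxAr mul_delta_mx_cond.
suff -> : (ord0 == stdT (dsrc k)) = false by rewrite mulr0n scaler0.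
by rewrite -val_eqE /= stdT_val // /dsrc; case: ifP.
Qed.

Let z0 : cycle std_chain_complex := Sub e0 e0_cycle.

Let coord0_z0 : coord0 (\val z0) = 1.
Proof. by rewrite /coord0 /= !mxE !eqxx. Qed.

Definition std_gen (c : FU^o) : homology std_chain_complex := c *: cls z0.

Fact std_gen_linear : linear std_gen.
Proof. by move=> c x y; rewrite /std_gen scalerDl scalerA. Qed.

HB.instance Definition _ :=
  GRing.isLinear.Build FU FU^o
    (homology std_chain_complex) _ std_gen std_gen_linear.

Let std_genK c : std_coord (std_gen c) = c.
Proof.
rewrite /std_gen linearZ /= std_coordE coord0_z0; exact: mulr1.
Qed.

Let cycle_torsion z : coord0 (\val z) = 0 -> 'X^bexp *: cls z = 0.
Proof.
move=> hz; rewrite -linearZ -(linear0 cls); apply/quotmod_classP/asboolP.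
pose x : 'rV[FU]_(n.*2.+1) := \val z.
have hzd : x *m std_diff_mx = 0 by exact/eqP/(valP z).
have hx0 : x *m delta_mx ord0 ord0 = 0 :> 'rV[FU]_(n.*2.+1).
  apply/matrixP => i j; rewrite mxE big1 ?mxE // => l _; rewrite mxE.
  have [->|] := eqVneq l; last by rewrite mulr0.
  by rewrite (ord1 i) [X in X * _](hz : _ = _) mul0r.
exists (x *m rev_mx); rewrite subr0.
have := congr1 (mulmx x) one_mxE.
rewrite -scalemxAr mulmx1 !mulmxDr mulmxA hzd mul0mx addr0 -scalemxAr.
rewrite hx0 scaler0 add0r mulmxA => /esym.
by rewrite linearZ.
Qed.

Let std_coordK h : 'X^bexp *: std_gen (std_coord h) = 'X^bexp *: h.
Proof.
rewrite -[h]repK std_coordE.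
apply/eqP; rewrite -subr_eq0 -scalerBr /std_gen -linearZ -linearB; apply/eqP.
by apply: cycle_torsion; rewrite /= /coord0 !mxE !eqxx mulr1 subrr.
Qed.

Fact std_loc_homology_iso :
  exists phi : {linear loc (homology std_chain_complex) -> loc FU^o},
    bijective phi.
Proof.
exists (loc_map std_coord); exists (loc_map std_gen) => /=.
- elim/loc_frac_ind=> h k; rewrite (loc_mapE std_coord) (loc_mapE std_gen); apply/loc_fracP.
  by exists bexp; rewrite addnC exprD -!scalerA std_coordK.
- by elim/loc_frac_ind=> c k; rewrite (loc_mapE std_gen) (loc_mapE std_coord) /= std_genK.
Qed.

Let gdeg0 : gdeg (ord0 : 'I_(grank std_module)) = 0.
Proof. by rewrite /= big_pred0. Qed.

Let hom_nontorsion d h : homology_homogeneous d h -> std_coord h != 0 ->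
  exists k : nat, d = - (2 * k%:Z).
Proof.
case=> z -> hz; rewrite std_coordE => hz0.
exists (size (coord0 (\val z))).-1.
rewrite -[RHS]add0r -gdeg0; apply: hz.
by move: hz0; rewrite -lead_coef_eq0.
Qed.

Fact std_loc_homology_even d (x : loc (homology std_chain_complex)) :
  loc_homology_homogeneous d x -> x != 0 -> (2 %| d)%Z.
Proof.
case=> h [k [-> hh]] hx.
have /(hom_nontorsion hh)[j hj] : std_coord h != 0.
  apply: contraNneq hx => h0; apply/eqP/loc_frac_eq0; exists bexp.
  by rewrite -std_coordK h0 linear0 scaler0.
have -> : d = (k%:Z - j%:Z) * 2 by lia.
exact: dvdz_mull.
Qed.

Fact std_nontorsion_0 : exists2 h : homology std_chain_complex,
  homology_homogeneous 0 h & U_nontorsion h.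
Proof.
exists (cls z0).
  exists z0 => // i k; rewrite /= mxE eqxx /=.
  have [->|_] := eqVneq i; last by rewrite coef0 eqxx.
  rewrite coef1; case: k => [_|k]; last by rewrite eqxx.
  by rewrite mulr0 subr0; exact: esym gdeg0.
move=> k; apply: contra_neq (_ : std_coord ('X^k *: cls z0) != 0) => [->|].
  by rewrite linear0.
by rewrite linearZ /= std_coordE coord0_z0 [_ *: _]mulr1 monic_neq0 ?monicXn.
Qed.

Fact std_nontorsion_le0 d (h : homology std_chain_complex) :
  homology_homogeneous d h -> U_nontorsion h -> d <= 0.
Proof.
move=> hh hn; have /(hom_nontorsion hh)[j ->] : std_coord h != 0; last by lia.
apply: contraNneq (hn bexp) => h0.
by rewrite -std_coordK h0 linear0 scaler0.
Qed.

Definition standard_complex : almost_iota_complex :=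
  AlmostIotaComplex std_iota_degree std_iota_comm std_iota_iota
    std_loc_homology_iso std_loc_homology_even
    std_nontorsion_0 std_nontorsion_le0.

End StandardComplex.

(* Main.v *)
(* Bring the differential into graded Smith form; modulo U, the complex becomes an
   F_2-vector space V with two structures: omega, which squares to zero on the
   homology of V, and the relations "diff v = U^b w".  A standard complex is a
   word alternating between steps of the two kinds.  Starting with Z <= K, where
   K is spanned by the cycles and Z by the torsion cycles (so K / Z is the tower,
   of dimension one), a word w transports Z and K to subspaces Z_w <= K_w.

   As long as Z_w <> K_w, either w can be prolonged, or K_w contains a vector t
   with omega t = 0 that does not lie in Z_w + im omega.  For two different words
   w, w' of the same parity, K_w <= Z_w' or K_w' <= Z_w; hence the words with
   Z_w <> K_w are finitely many, and no word leads from the tower back to the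
   tower, because such a word would have to equal its own reversal.  So some word
   w ends with a vector t as above.  Walking back from t gives a local map from
   the standard complex of w to C.  Walking back from a functional that kills
   Z_w + im omega but not t gives, by transposition, a local map from C to that
   complex. *)
Require Import Defs.
From mathcomp Require Import all_boot all_order all_algebra.
From mathcomp Require Import zify boolp.

Set Implicit Arguments.
Unset Strict Implicit.
Unset Printing Implicit Defensive.

Import Order.TTheory GRing.Theory Num.Theory.
Local Open Scope ring_scope.

(** The method is that of linear relations, as for string modules: letters of one kind are linearly
    ordered, and the values of a smaller letter lie in the indeterminacy of a larger one. Only one
    word is followed, so no normal form for omega is needed. The obstacle is that [iota] commutes
    with the differential only modulo U, and squares to the identity only modulo U and up to
    homotopy. Hence omega is used as a relation on the homology of C/U. The complex is not reduced
    beforehand: entries 1 of the differential stay as edges of length 0, and every letter absorbs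
    boundaries mod U. Passing to C/U loses nothing, because the standard differential pairs T_1 with
    T_2, T_3 with T_4 and so on; each of its steps lifts to F[U] independently, while omega is only
    constrained modulo U. Both local maps belong to the same word because the functional and the
    vector at its end pair to 1 and the pairing is constant along parallel walks, so both walks
    arrive with tower coordinate 1. *)

Local Notation redU := (map_mx (coefp 0)).

(** * Graded matrices and the graded Smith form *)

Lemma F2_neq0 (c : 'F_2) : c != 0 -> c = 1.
Proof. by case: c => [[|[|m]] hm] // _; apply: val_inj. Qed.

Lemma FUmx_double m n (A : 'M[FU]_(m, n)) : A + A = 0.
Proof.
apply/matrixP => i j; rewrite !mxE; apply/polyP => k; rewrite coefD coef0.
by case: (_`_k) => [[|[|c]] hc] //; apply: val_inj.
Qed.

Lemma sum_neq0 (V : nmodType) (I : finType) (F : I -> V) :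
  \sum_i F i != 0 -> exists i, F i != 0.
Proof.
move=> h; apply/existsP; apply: contraNT h => h.
apply/eqP; apply: big1 => i _; apply/eqP/negPn/negP => hi.
by case/existsP: h; exists i.
Qed.

Section GradedMatrices.

Definition graded_mx m n (g : 'I_m -> int) (g' : 'I_n -> int) (e : int)
    (A : 'M[FU]_(m, n)) : Prop :=
  forall i j k, (A i j)`_k != 0 -> g' j - 2 * k%:Z = g i + e.

Lemma graded_mxD m n (g : 'I_m -> int) (g' : 'I_n -> int) e A B :
  graded_mx g g' e A -> graded_mx g g' e B -> graded_mx g g' e (A + B).
Proof.
move=> hA hB i j k; rewrite mxE coefD.
have [->|/hA //] := eqVneq (A i j)`_k 0.
by rewrite add0r => /hB.
Qed.

Lemma graded_mx1 n (g : 'I_n -> int) : graded_mx g g 0 1%:M.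
Proof.
move=> i j k; rewrite mxE; have [->|_] := eqVneq i j; last by rewrite coef0 eqxx.
by rewrite coef1; case: k => [_|k]; [lia|rewrite eqxx].
Qed.

Lemma graded_mxM m n p (g : 'I_m -> int) (g' : 'I_n -> int) (g'' : 'I_p -> int)
    e e' e'' A B :
  graded_mx g g' e A -> graded_mx g' g'' e' B -> e'' = e + e' ->
  graded_mx g g'' e'' (A *m B).
Proof.
move=> hA hB -> i j k; rewrite mxE coef_sum => hk.
have [l] := sum_neq0 hk; rewrite coefM => hl.
have [q] := sum_neq0 hl; rewrite mulf_eq0 negb_or => /andP[hq1 hq2].
move: (hA _ _ _ hq1) (hB _ _ _ hq2); have := ltn_ord q; lia.
Qed.

(** Dual basis vectors have negated degrees, so the dual of a map of degree e again has degree e; a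
    transposed differential keeps degree -1. *)
Lemma graded_mx_tr m n (g : 'I_m -> int) (g' : 'I_n -> int) e A :
  graded_mx g g' e A ->
  graded_mx (fun j => - g' j) (fun i => - g i) e A^T.
Proof. by move=> hA i j k; rewrite mxE => /hA; lia. Qed.

Lemma homogeneous_graded (M : graded_free) d (x : M) :
  homogeneous d x <-> graded_mx (fun _ : 'I_1 => d) (@gdeg M) 0 x.
Proof.
split=> h; last by move=> i k /h; lia.
by move=> i j k; rewrite (ord1 i) => /h; lia.
Qed.

Lemma mulmxr_of_degree (M N : graded_free) e (A : 'M[FU]_(grank M, grank N)) :
  graded_mx (@gdeg M) (@gdeg N) e A ->
  @of_degree M N e (mulmxr A).
Proof.
move=> hA d x /homogeneous_graded hx i k hk.
have := graded_mxM hx hA (esym (add0r e)) hk; lia.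
Qed.

Lemma of_degree_graded (M N : graded_free) e (f : {linear M -> N}) :
  of_degree e f ->
  graded_mx (@gdeg M) (@gdeg N) e (lin1_mx (f : {linear 'rV_(grank M) -> 'rV_(grank N)})).
Proof.
move=> hf i j k; rewrite mxE => hk.
apply/esym; apply: (hf (gdeg i) (delta_mx 0 i)) hk => l q.
rewrite mxE eqxx /=; have [->|_] := eqVneq l i; last by rewrite coef0 eqxx.
by rewrite coef1; case: q => [_|q]; [lia|rewrite eqxx].
Qed.

(** The degrees of the two basis vectors leave a single possible exponent, and 1 is the only nonzero
    coefficient. *)
Lemma graded_mx_monomial m n (g : 'I_m -> int) (g' : 'I_n -> int) e A i j :
  graded_mx g g' e A -> A i j != 0 -> A i j = 'X^((size (A i j)).-1).
Proof.
move=> hA h0; apply/polyP => k; rewrite coefXn.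
have hl : (A i j)`_(size (A i j)).-1 != 0 by rewrite -lead_coefE lead_coef_eq0.
case: eqP => [->|hk]; first exact: F2_neq0.
apply/eqP/negPn/negP => /hA h; apply: hk; move: (hA _ _ _ hl); lia.
Qed.

End GradedMatrices.

Section SmithForm.
Variables (r : nat) (g : 'I_r -> int).

(** The Smith form without ordering the basis, which keeps the degree function [g] fixed
    throughout. *)
Definition matching (N : 'M[FU]_r) : Prop := forall i j, N i j != 0 ->
  (forall j', N i j' != 0 -> j' = j) /\ (forall i', N i' j != 0 -> i' = i).

(** Invariant of the elimination: the basis vectors in S span a direct summand already in matched
    form. *)
Definition split_off (S : {set 'I_r}) (N : 'M[FU]_r) : Prop :=
  forall i j, (i \in S) || (j \in S) -> N i j != 0 ->
  [/\ i \in S, j \in S, forall j', N i j' != 0 -> j' = j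
    & forall i', N i' j != 0 -> i' = i].

(** In characteristic 2 a transvection is its own inverse, so each basis change below comes with its
    inverse. *)
Lemma rank1_involution (c : 'cV[FU]_r) (u : 'rV[FU]_r) :
  u *m c = 0 -> (1%:M + c *m u) *m (1%:M + c *m u) = 1%:M.
Proof.
move=> h; rewrite mulmxDl !mulmxDr !mul1mx mulmx1.
by rewrite mulmxA -(mulmxA c) h mulmx0 mul0mx addr0 -addrA FUmx_double addr0.
Qed.

Lemma drop_polyK k (p : FU) : (forall m, (m < k)%N -> p`_m = 0) ->
  'X^k * drop_poly k p = p.
Proof.
move=> h; apply/polyP => m; rewrite coefXnM; case: ltnP => hm; first by rewrite h.
by rewrite coef_drop_poly subnK.
Qed.

Lemma scaleXn_eq0 m n k (A : 'M[FU]_(m, n)) : 'X^k *: A = 0 -> A = 0.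
Proof.
move=> h; apply/matrixP => i j; move/matrixP/(_ i j): h; rewrite !mxE => /eqP.
by rewrite mulf_eq0 expf_eq0 polyX_eq0 andbF /= => /eqP.
Qed.

(** The last two hypotheses say that U^k divides row i and column j. [E1] replaces e_j by U^-k times
    the differential of e_i, which turns row i into U^k e_j; [E2] then adds multiples of e_i to the
    other basis vectors to clear column j. Row j and column i vanish by themselves, because the
    differential squares to zero and U^k is not a zero divisor. *)
Lemma pivot (S : {set 'I_r}) (N : 'M[FU]_r) i j k :
  graded_mx g g (-1) N -> N *m N = 0 -> split_off S N ->
  i \notin S -> j \notin S -> N i j = 'X^k ->
  (forall l m, (m < k)%N -> (N i l)`_m = 0) ->
  (forall l m, (m < k)%N -> (N l j)`_m = 0) ->
  exists P Q : 'M[FU]_r, [/\ graded_mx g g 0 P, graded_mx g g 0 Q,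
    P *m Q = 1%:M, Q *m P = 1%:M & split_off (j |: (i |: S)) (P *m N *m Q)].
Proof.
move=> hN N2 hS iS jS Nij hrow hcol.
have gij : g j - 2 * k%:Z = g i - 1 by apply: hN; rewrite Nij coefXn eqxx oner_neq0.
have neq_ij : i != j by apply/eqP => h; move: gij; rewrite h; lia.
pose dl (l : 'I_r) : 'rV[FU]_r := delta_mx 0 l.
pose dc (l : 'I_r) : 'cV[FU]_r := delta_mx l 0.
have dlM (A : 'M[FU]_r) l m : (dl l *m A) 0 m = A l m by rewrite -rowE mxE.
have dcM (A : 'M[FU]_r) l m : (A *m dc m) l 0 = A l m by rewrite -colE mxE.
have dldc l : dl l *m dc l = 1%:M.
  by rewrite mul_delta_mx; apply/matrixP => a b; rewrite !ord1 !mxE !eqxx.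
have dldc0 l m : l != m -> dl l *m dc m = 0 by move=> h; rewrite mul_delta_mx_0.
pose u : 'rV[FU]_r := \row_l (if l == j then 0 else drop_poly k (N i l)).
have uE l : u *m dc l = (u 0 l)%:M.
  by rewrite -colE; apply/matrixP => a b; rewrite !ord1 !mxE eqxx.
have uj : u *m dc j = 0 by rewrite uE mxE eqxx raddf0.
have rowi : dl i *m N = 'X^k *: (dl j + u).
  apply/matrixP => a l; rewrite (ord1 a) dlM !mxE /=.
  have [->|hl] := eqVneq l j; first by rewrite addr0 mulr1.
  by rewrite add0r drop_polyK // => m; apply: hrow.
pose E1 : 'M[FU]_r := 1%:M + dc j *m u.
have E11 : E1 *m E1 = 1%:M by apply: rank1_involution.
have dlE1 l : l != j -> dl l *m E1 = dl l.
  by move=> h; rewrite mulmxDr mulmx1 mulmxA dldc0 // mul0mx addr0.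
have [N1 N1E] : exists N1, N1 = E1 *m N *m E1 by exists (E1 *m N *m E1).
have N1sq : N1 *m N1 = 0.
  by rewrite N1E !mulmxA -(mulmxA (E1 *m N)) E11 mulmx1 -(mulmxA E1) N2 mulmx0 mul0mx.
have row1i : dl i *m N1 = 'X^k *: dl j.
  rewrite N1E !mulmxA dlE1 // rowi -scalemxAl; congr (_ *: _).
  rewrite mulmxDr mulmx1 mulmxDl !mulmxA dldc uj mul1mx mul0mx addr0.
  by rewrite -addrA FUmx_double addr0.
have row1j : dl j *m N1 = 0.
  by apply: (@scaleXn_eq0 _ _ k); rewrite scalemxAl -row1i -mulmxA N1sq mulmx0.
(* The new basis vector e_j + u is a cycle, so u and e_j have the same differential; this leaves the
   columns in S unchanged. *)
have rho0 : (dl j + u) *m N = 0.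
  by apply: (@scaleXn_eq0 _ _ k); rewrite scalemxAl -rowi -mulmxA N2 mulmx0.
have col1j l m : (m < k)%N -> (N1 l j)`_m = 0.
  move=> hm; rewrite -dcM N1E -!mulmxA.
  have -> : E1 *m dc j = dc j by rewrite mulmxDl mul1mx -mulmxA uj mulmx0 addr0.
  rewrite mxE coef_sum big1 // => q _; rewrite dcM coefM big1 // => p _.
  by rewrite hcol ?mulr0 //; have := ltn_ord p; lia.
pose w : 'cV[FU]_r := \col_l (if l == i then 0 else drop_poly k (N1 l j)).
have wE l : dl l *m w = (w l 0)%:M.
  by rewrite -rowE; apply/matrixP => a b; rewrite !ord1 !mxE eqxx.
have wi : dl i *m w = 0 by rewrite wE mxE eqxx raddf0.
have N1jj : N1 j j = 0 by rewrite -dlM row1j mxE.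
have N1ij : N1 i j = 'X^k by rewrite -dlM row1i !mxE !eqxx mulr1.
have colj : N1 *m dc j = 'X^k *: (dc i + w).
  apply/matrixP => l a; rewrite (ord1 a) dcM !mxE /= andbT.
  have [->|hl] := eqVneq l i; first by rewrite addr0 mulr1 N1ij.
  by rewrite add0r drop_polyK // => m; apply: col1j.
have wj : dl j *m w = 0.
  by rewrite wE mxE eq_sym (negbTE neq_ij) N1jj linear0 raddf0.
pose E2 : 'M[FU]_r := 1%:M + w *m dl i.
have E22 : E2 *m E2 = 1%:M by apply: rank1_involution.
have dlE2 l : dl l *m w = 0 -> dl l *m E2 = dl l.
  by move=> h; rewrite mulmxDr mulmx1 mulmxA h mul0mx addr0.
pose M := E2 *m N1 *m E2.
have Msq : M *m M = 0.
  by rewrite /M !mulmxA -(mulmxA (E2 *m N1)) E22 mulmx1 -(mulmxA E2) N1sq mulmx0 mul0mx.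
have rowMi : dl i *m M = 'X^k *: dl j.
  by rewrite /M !mulmxA dlE2 // row1i -scalemxAl dlE2.
have rowMj : dl j *m M = 0.
  by rewrite /M !mulmxA dlE2 // row1j mul0mx.
have colMj : M *m dc j = 'X^k *: dc i.
  rewrite /M -!mulmxA.
  have -> : E2 *m dc j = dc j by rewrite mulmxDl mul1mx -mulmxA dldc0 // mulmx0 addr0.
  rewrite colj -scalemxAr; congr (_ *: _).
  rewrite mulmxDl mul1mx mulmxDr -!mulmxA dldc wi mulmx1 mulmx0 addr0.
  by rewrite -addrA FUmx_double addr0.
have colMi : M *m dc i = 0.
  by apply: (@scaleXn_eq0 _ _ k); rewrite scalemxAr -colMj mulmxA Msq mul0mx.
have NS1 l s : s \in S -> l \notin S -> N l s = 0 /\ N s l = 0.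
  move=> hs hl; split; apply/eqP/negPn/negP => h.
    by have [] := hS l s _ h; rewrite ?hs ?orbT // (negbTE hl).
  by have [] := hS s l _ h; rewrite ?hs // (negbTE hl).
have inS_neq s l : s \in S -> l \notin S -> s != l.
  by move=> hs hl; apply: contraNneq hl => <-.
have us s : s \in S -> u *m dc s = 0.
  move=> hs; rewrite uE mxE (NS1 i s hs iS).1 linear0 if_same.
  by rewrite raddf0.
have row1s s : s \in S -> dl s *m N1 = dl s *m N.
  move=> hs; rewrite N1E !mulmxA dlE1 ?inS_neq // mulmxDr mulmx1 !mulmxA.
  suff -> : dl s *m N *m dc j = 0 by rewrite mul0mx addr0.
  by apply/matrixP => a b; rewrite !ord1 -mulmxA -rowE mxE dcM (NS1 j s hs jS).2 mxE.
have col1s s : s \in S -> N1 *m dc s = N *m dc s.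
  move=> hs; rewrite N1E -!mulmxA.
  have -> : E1 *m dc s = dc s by rewrite mulmxDl mul1mx -mulmxA us // mulmx0 addr0.
  rewrite mulmxDl mul1mx -!mulmxA.
  suff -> : u *m (N *m dc s) = 0 by rewrite mulmx0 addr0.
  have /(congr1 (fun A => A *m dc s)) := rho0.
  rewrite mulmxDl mul0mx mulmxDl -!mulmxA.
  suff -> : dl j *m (N *m dc s) = 0 by rewrite add0r.
  by apply/matrixP => a b; rewrite !ord1 -rowE mxE dcM (NS1 j s hs jS).1 mxE.
have ws s : s \in S -> dl s *m w = 0.
  move=> hs; rewrite wE mxE -dlM row1s // dlM (NS1 j s hs jS).2 linear0 if_same.
  by rewrite raddf0.
have gam0 : N1 *m (dc i + w) = 0.
  by apply: (@scaleXn_eq0 _ _ k); rewrite scalemxAr -colj mulmxA N1sq mul0mx.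
have rowMs s m : s \in S -> M s m = N s m.
  move=> hs; rewrite -[LHS]dlM -[RHS]dlM /M !mulmxA.
  rewrite (dlE2 s) ?ws // row1s // mulmxDr mulmx1 mulmxA.
  suff -> : dl s *m N *m w = 0 by rewrite mul0mx addr0.
  have /(congr1 (fun A => dl s *m A)) := gam0.
  rewrite mulmx0 mulmxA row1s // mulmxDr.
  suff -> : dl s *m N *m dc i = 0 by rewrite add0r.
  by apply/matrixP => a b; rewrite !ord1 -mulmxA -rowE mxE dcM (NS1 i s hs iS).2 mxE.
have colMs s m : s \in S -> M m s = N m s.
  move=> hs; rewrite -[LHS]dcM -[RHS]dcM /M -!mulmxA.
  have -> : E2 *m dc s = dc s.
    by rewrite mulmxDl mul1mx -mulmxA dldc0 ?mulmx0 ?addr0 // eq_sym inS_neq.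
  rewrite col1s // mulmxDl mul1mx -mulmxA.
  suff -> : dl i *m (N *m dc s) = 0 by rewrite mulmx0 addr0.
  by apply/matrixP => a b; rewrite !ord1 -rowE mxE dcM (NS1 i s hs iS).1 mxE.
have gE1 : graded_mx g g 0 E1.
  apply: graded_mxD; first exact: graded_mx1.
  move=> a b m; rewrite mxE big_ord1 !mxE ?eqxx ?andbT /=.
  have [->|_] := eqVneq a j; last by rewrite mul0r coef0 eqxx.
  rewrite mul1r; case: ifP => [|_]; first by rewrite coef0 eqxx.
  by rewrite coef_drop_poly => /hN; lia.
have gN1 : graded_mx g g (-1) N1.
  by rewrite N1E; apply: (graded_mxM (graded_mxM gE1 hN erefl) gE1); lia.
have gE2 : graded_mx g g 0 E2.
  apply: graded_mxD; first exact: graded_mx1.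
  move=> a b m; rewrite mxE big_ord1 !mxE ?eqxx /=.
  have [->|_] := eqVneq b i; last by rewrite mulr0 coef0 eqxx.
  rewrite mulr1; case: ifP => [|_]; first by rewrite coef0 eqxx.
  by rewrite coef_drop_poly => /gN1; lia.
exists (E2 *m E1), (E1 *m E2).
have gE12 : graded_mx g g 0 (E1 *m E2) by apply: (graded_mxM gE1 gE2); lia.
split.
- by apply: (graded_mxM gE2 gE1); lia.
- exact: gE12.
- by rewrite mulmxA -(mulmxA E2) E11 mulmx1.
- by rewrite mulmxA -(mulmxA E1) E22 mulmx1.
have -> : E2 *m E1 *m N *m (E1 *m E2) = M by rewrite /M N1E !mulmxA.
have Mi m : M i m = if m == j then 'X^k else 0.
  by rewrite -dlM rowMi !mxE eqxx /=; case: eqP => _; rewrite ?mulr1 ?mulr0.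
have Mj m : M j m = 0 by rewrite -dlM rowMj mxE.
have Mcj m : M m j = if m == i then 'X^k else 0.
  by rewrite -dcM colMj !mxE eqxx andbT; case: eqP => _; rewrite ?mulr1 ?mulr0.
have Mci m : M m i = 0 by rewrite -dcM colMi mxE.
move=> a b hab hM.
have [aj|aj] := eqVneq a j; first by move: hM; rewrite aj Mj eqxx.
have [bi|bi] := eqVneq b i; first by move: hM; rewrite bi Mci eqxx.
have [ai|ai] := eqVneq a i.
  move: hM; rewrite ai Mi; case: (eqVneq b j) => [-> _|]; last by rewrite eqxx.
  rewrite !inE !eqxx orbT; split=> // [m|m].
    by rewrite Mi; have [|_] := eqVneq m j; last rewrite eqxx.
  by rewrite Mcj; have [|_] := eqVneq m i; last rewrite eqxx.
have [bj|bj] := eqVneq b j.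
  by move: hM; rewrite bj Mcj (negbTE ai) /= eqxx.
move: hab; rewrite !inE (negbTE aj) (negbTE ai) (negbTE bi) (negbTE bj) /= => hab.
have hN0 : N a b != 0.
  by case/orP: hab => h; [rewrite -(rowMs a b h)|rewrite -(colMs b a h)].
have [aS bS h1 h2] := hS a b hab hN0.
rewrite aS bS; split=> // m.
  by rewrite rowMs // => /h1.
by rewrite colMs // => /h2.
Qed.

Lemma smith_split s (S : {set 'I_r}) (N : 'M[FU]_r) :
  (#|~: S| <= s)%N -> graded_mx g g (-1) N -> N *m N = 0 -> split_off S N ->
  exists P Q : 'M[FU]_r, [/\ graded_mx g g 0 P, graded_mx g g 0 Q,
    P *m Q = 1%:M, Q *m P = 1%:M & matching (P *m N *m Q)].
Proof.
elim: s S N => [|s IH] S N hs hN N2 hS;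
  have [[p0 hp0]|h0] := pselect (exists p : 'I_r * 'I_r,
    [&& p.1 \notin S, p.2 \notin S & N p.1 p.2 != 0]); last 1 first.
- exists 1%:M, 1%:M; rewrite !mulmx1 mul1mx; split=> //; try exact: graded_mx1.
  move=> i j hij.
  have [h|/norP[h1 h2]] := boolP ((i \in S) || (j \in S)); first by have [] := hS i j h hij.
  by case: h0; exists (i, j); rewrite h1 h2 hij.
- case/and3P: hp0 => h _ _; move: hs; rewrite leqn0 cards_eq0 => /eqP hs.
  by move: h; rewrite -in_setC hs inE.
- exists 1%:M, 1%:M; rewrite !mulmx1 mul1mx; split=> //; try exact: graded_mx1.
  move=> i j hij.
  have [h|/norP[h1 h2]] := boolP ((i \in S) || (j \in S)); first by have [] := hS i j h hij.
  by case: h0; exists (i, j); rewrite h1 h2 hij.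
(* A remaining entry of least exponent divides its whole row and column, since the entries joining S
   to its complement vanish. *)
case: (@arg_minnP _ p0 (fun p => [&& p.1 \notin S, p.2 \notin S & N p.1 p.2 != 0])
  (fun p => (size (N p.1 p.2)).-1) hp0) => -[i j] /= /and3P[iS jS hij] hmin.
have small a b m : a \notin S -> b \notin S -> (m < (size (N i j)).-1)%N -> (N a b)`_m = 0.
  move=> ha hb hm; have [->|hab] := eqVneq (N a b) 0; first by rewrite coef0.
  have := hmin (a, b); rewrite /= ha hb hab => /(_ isT) hle.
  rewrite (graded_mx_monomial hN hab) coefXn; case: eqP => // h.
  by move: (leq_trans hm hle); rewrite h ltnn.
have zero a b : (a \in S) != (b \in S) -> N a b = 0.
  move=> hab; apply/eqP/negPn/negP => h; have := hS a b _ h.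
  by move: hab; case: (a \in S); case: (b \in S) => //= _ /(_ isT)[].
have [l m hm|l m hm|P [Q [gP gQ PQ QP hPQ]]] :=
  pivot hN N2 hS iS jS (graded_mx_monomial hN hij).
- have [lS|lS] := boolP (l \in S); last exact: small.
  by rewrite zero ?coef0 // (negbTE iS) lS.
- have [lS|lS] := boolP (l \in S); last exact: small.
  by rewrite zero ?coef0 // (negbTE jS) lS.
have [| | |P' [Q' [gP' gQ' PQ' QP' hPQ']]] := IH _ (P *m N *m Q) _ _ _ hPQ.
- rewrite -ltnS; apply: leq_trans hs; apply: proper_card; apply/properP; split.
    by rewrite setCS; apply/subsetP => x hx; rewrite !inE hx !orbT.
  by exists i; rewrite ?inE ?eqxx ?orbT.
- by apply: (graded_mxM (graded_mxM gP hN erefl) gQ); lia.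
- by rewrite !mulmxA -(mulmxA (P *m N)) QP mulmx1 -(mulmxA P) N2 mulmx0 mul0mx.
exists (P' *m P), (Q *m Q'); split.
- by apply: (graded_mxM gP' gP); lia.
- by apply: (graded_mxM gQ gQ'); lia.
- by rewrite mulmxA -(mulmxA P') PQ mulmx1.
- by rewrite mulmxA -(mulmxA Q) QP' mulmx1.
- by move: hPQ'; rewrite !mulmxA.
Qed.

Lemma graded_smith_form (D : 'M[FU]_r) :
  graded_mx g g (-1) D -> D *m D = 0 ->
  exists P Q : 'M[FU]_r, [/\ graded_mx g g 0 P, graded_mx g g 0 Q,
    P *m Q = 1%:M, Q *m P = 1%:M & matching (P *m D *m Q)].
Proof.
move=> hD D2; apply: (@smith_split _ set0) (leqnn _) hD D2 _ => i j.
by rewrite !inE.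
Qed.

End SmithForm.

(** * Words of steps *)

(** No scalars occur: over F_2, where this is applied, additive subgroups are subspaces. *)
Definition sub_closed (V : zmodType) (A : V -> Prop) : Prop :=
  A 0 /\ forall x y, A x -> A y -> A (x - y).

Lemma sub_closedN (V : zmodType) (A : V -> Prop) x : sub_closed A -> A x -> A (- x).
Proof. by case=> h0 hB hx; rewrite -sub0r; apply: hB. Qed.

Lemma sub_closedD (V : zmodType) (A : V -> Prop) x y :
  sub_closed A -> A x -> A y -> A (x + y).
Proof.
by move=> hA hx hy; rewrite -[y]opprK; apply: hA.2 => //; apply: sub_closedN.
Qed.

Definition linear_rel (V : zmodType) (R : V -> V -> Prop) : Prop :=
  R 0 0 /\ forall x y x' y', R x y -> R x' y' -> R (x - x') (y - y').

(* A letter is a step from T_i to T_{i+1}: (true, a) is an omega-step with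
   a = a_{i+1}, and (false, b) is a differential step with b = b_{i+1}.  Words
   list the last step first. *)
Definition letter := (bool * int)%type.
Definition letter0 : letter := (true, 0).
Definition opp_letter (l : letter) : letter := (l.1, - l.2).
Definition ok_letter (l : letter) : bool := if l.1 then (`|l.2| == 1)%N else l.2 != 0.

(** The letter at index i is step number [size w - i]; so the first step taken is an omega-step and
    the kinds alternate. *)
Definition valid_word (w : seq letter) : Prop := forall i, (i < size w)%N ->
  ok_letter (nth letter0 w i) /\ (nth letter0 w i).1 = odd (size w - i).

Lemma valid_cons l w : valid_word (l :: w) <->
  [/\ ok_letter l, l.1 = ~~ odd (size w) & valid_word w].
Proof.
split=> [h|[h1 h2 h3] [|i] hi].
- split; [by have [] := h 0%N isT|by have [_] := h 0%N isT; rewrite subn0|].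
  by move=> i hi; have := h i.+1 hi.
- by split; rewrite //= subn0.
- exact: h3.
Qed.

Lemma valid_drop w k : valid_word w -> valid_word (drop k w).
Proof.
move=> h i; rewrite size_drop nth_drop => hi.
have := h (k + i)%N; rewrite subnDA; apply; lia.
Qed.

Lemma opp_letterK : involutive opp_letter.
Proof. by case=> t z; rewrite /opp_letter /= opprK. Qed.

(** Walking backwards reverses every arrow, hence the sign changes. *)
Definition rev_word (w : seq letter) := rev (map opp_letter w).

Lemma rev_wordK : involutive rev_word.
Proof.
by move=> w; rewrite /rev_word map_rev revK mapK //; apply: opp_letterK.
Qed.

Lemma size_rev_word w : size (rev_word w) = size w.
Proof. by rewrite size_rev size_map. Qed.

Lemma nth_rev_word w i : (i < size w)%N ->
  nth letter0 (rev_word w) i = opp_letter (nth letter0 w (size w - i.+1)).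
Proof.
move=> hi; by rewrite nth_rev size_map ?(nth_map letter0) ?size_map //; lia.
Qed.

Lemma valid_rev w : odd (size w) -> valid_word w -> valid_word (rev_word w).
Proof.
move=> hodd h i; rewrite size_rev_word => hi; rewrite nth_rev_word //.
have [|h1 h2] := h (size w - i.+1)%N; first lia.
split; first by move: h1; rewrite /ok_letter /=; case: ifP => _; lia.
by rewrite /= h2; move: hi hodd; lia.
Qed.

(** The middle letter would be its own opposite, but no admissible letter has parameter 0. *)
Lemma rev_word_neq w : odd (size w) -> valid_word w -> rev_word w <> w.
Proof.
move=> hodd h /(congr1 (fun s => nth letter0 s (size w)./2)).
rewrite nth_rev_word; last by lia.
have -> : (size w - (size w)./2.+1 = (size w)./2)%N by lia.
have [|] := h (size w)./2; first by lia.
by case: (nth _ _ _) => t z; rewrite /ok_letter /= => hz _ [] ; move: hz; case: t; lia.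
Qed.

(** * Images under words, their comparison, and finiteness *)

Section Chains.
Variables (V : zmodType) (rel : letter -> V -> V -> Prop).
Hypothesis rel_lin : forall l, linear_rel (rel l).
Hypothesis rel_opp : forall l x y, rel (opp_letter l) x y <-> rel l y x.

Fixpoint chain (w : seq letter) (x y : V) : Prop :=
  if w is l :: w' then exists z, chain w' x z /\ rel l z y else x = y.

Definition img (X : V -> Prop) w y := exists x, X x /\ chain w x y.

Lemma chain_cat w1 w2 x y :
  chain (w1 ++ w2) x y <-> exists z, chain w2 x z /\ chain w1 z y.
Proof.
elim: w1 y => [|l w1 IH] y /=; first by split=> [h|[z [h <-]]] //; exists y.
split=> [[z [/IH[z' [h1 h2]] h3]]|[z' [h1 [z [h2 h3]]]]].
  by exists z'; split=> //; exists z.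
by exists z; split=> //; apply/IH; exists z'.
Qed.

Lemma chain_rev w x y : chain w x y -> chain (rev_word w) y x.
Proof.
elim: w y => [|l w IH] y /=; first by move=> ->.
case=> z [/IH h hl]; rewrite /rev_word /= rev_cons -cats1; apply/chain_cat.
by exists z; split=> //=; exists y; split=> //; apply/rel_opp.
Qed.

Lemma chain_lin w : linear_rel (chain w).
Proof.
elim: w => [|l w [h0 hB]] /=; first by split=> // x y x' y' -> ->.
split=> [|x y x' y' [z [h1 h2]] [z' [h1' h2']]].
  by exists 0; split=> //; have [] := rel_lin l.
by exists (z - z'); split; [apply: hB|apply: (rel_lin l).2].
Qed.

Lemma img_sub (X : V -> Prop) w : sub_closed X -> sub_closed (img X w).
Proof.
case=> X0 XB; have [c0 cB] := chain_lin w; split=> [|y y' [x [h1 h2]] [x' [h1' h2']]].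
  by exists 0.
by exists (x - x'); split; [apply: XB|apply: cB].
Qed.

Lemma img_cons (X : V -> Prop) l w y :
  img X (l :: w) y <-> exists z, img X w z /\ rel l z y.
Proof.
split=> [[x [h1 [z [h2 h3]]]]|[z [[x [h1 h2]] h3]]].
  by exists z; split=> //; exists x.
by exists x; split=> //; exists z.
Qed.

Lemma img_mono (X Y : V -> Prop) w : (forall x, X x -> Y x) ->
  forall y, img X w y -> img Y w y.
Proof. by move=> h y [x [h1 h2]]; exists x; split=> //; apply: h. Qed.

Lemma chain_nth w x y : chain w x y -> exists t : nat -> V,
  [/\ t 0%N = x, t (size w) = y & forall i, (i < size w)%N ->
    rel (nth letter0 w (size w - i.+1)) (t i) (t i.+1)].
Proof.
elim: w y => [|l w IH] y /=; first by move=> ->; exists (fun=> y).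
case=> z [/IH[t [t0 tz ht]] hl].
exists (fun i => if (i <= size w)%N then t i else y); split=> //; first by rewrite ltnn.
move=> i hi; have /orP[/eqP ->|{}hi] /= : (i == size w) || (i < size w)%N.
  by rewrite -leq_eqVlt.
  by rewrite leqnn ltnn subnn tz.
rewrite (ltnW hi) hi subSn //=; exact: ht.
Qed.

Variables (Z K : V -> Prop).
Hypothesis Z_sub : sub_closed Z.

(** All values of the smaller of two letters lie in the indeterminacy of the larger one. [coarse0]
    places the empty word in this order: a differential letter lies either below the pair Z, K or
    above it. *)
Hypothesis coarse : forall l l', ok_letter l -> ok_letter l' -> l.1 = l'.1 -> l <> l' ->
  (forall x y, rel l x y -> rel l' 0 y) \/ (forall x y, rel l' x y -> rel l 0 y).
Hypothesis coarse0 : forall l, ok_letter l -> l.1 = false ->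
  (forall x y, rel l x y -> Z y) \/ (forall y, K y -> rel l 0 y).

Let Z0 w : img Z w 0.
Proof. by have [] := img_sub w Z_sub. Qed.

(* Two different words with the same last type of step are separated by the
   letters closest to their ends at which they differ. *)
Lemma words_comparable w w' : valid_word w -> valid_word w' ->
  odd (size w) = odd (size w') -> w <> w' ->
  (forall y, img K w y -> img Z w' y) \/ (forall y, img K w' y -> img Z w y).
Proof.
elim: w w' => [|l w IH] [|l' w'] //=.
- move=> _ /valid_cons[ol tl _] hs _.
  have [|h|h] := coarse0 ol; first by rewrite tl -hs.
    by right=> y /img_cons[z [_ /h hy]]; exists y.
  left=> y [x [/h hx <-]]; apply/img_cons; exists 0; split=> //; exact: Z0.
- move=> /valid_cons[ol tl _] _ hs _.
  have [|h|h] := coarse0 ol; first by rewrite tl hs.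
    by left=> y /img_cons[z [_ /h hy]]; exists y.
  right=> y [x [/h hx <-]]; apply/img_cons; exists 0; split=> //; exact: Z0.
move=> /valid_cons[ol tl vw] /valid_cons[ol' tl' vw'] /negb_inj hs hne.
have [e|hl] := EM (l = l').
  subst l'; have [|h|h] := IH w' vw vw' hs; first by move=> e; apply: hne; rewrite e.
    by left=> y /img_cons[z [/h hz hzy]]; apply/img_cons; exists z.
  by right=> y /img_cons[z [/h hz hzy]]; apply/img_cons; exists z.
have [|h|h] := coarse ol ol' _ hl; first by rewrite tl tl' hs.
  by left=> y /img_cons[z [_ /h hy]]; apply/img_cons; exists 0; split=> //; exact: Z0.
by right=> y /img_cons[z [_ /h hy]]; apply/img_cons; exists 0; split=> //; exact: Z0.
Qed.

Definition live w := exists y, img K w y /\ ~ img Z w y.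

Lemma live_drop k w : live w -> live (drop k w).
Proof.
case=> y [[x [hx]]]; rewrite -{1}(cat_take_drop k w) => /chain_cat[z [h1 h2]] hn.
exists z; split; first by exists x.
case=> x' [hx' h1']; apply: hn; exists x'; split=> //.
by rewrite -(cat_take_drop k w); apply/chain_cat; exists z.
Qed.

(* The word is compared with its own reversal. *)
Lemma no_second_tower w : valid_word w -> odd (size w) ->
  (forall x y, K x -> ~ Z x -> K y -> ~ Z y -> Z (x - y)) ->
  forall t, img K w t -> K t -> exists z, Z z /\ img Z w (t - z).
Proof.
move=> vw ow hKZ t hwt hKt; case: (hwt) => t0 [hKt0 hc].
have [hZ|hZ] := EM (Z t); first by exists t; rewrite subrr.
have [hZ0|hZ0] := EM (Z t0).
  by exists 0; rewrite subr0; split; [apply Z_sub.1|exists t0].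
have := words_comparable vw (valid_rev ow vw).
rewrite size_rev_word => /(_ erefl (fun e => rev_word_neq ow vw (esym e)))[h|h].
  (* Here z reaches t along the reversed word, so w leads from t to z. Subtracting this from the
     chain from t0 to t gives a chain from t0 - t, which lies in Z, to t - z. *)
  case: (h _ hwt) => z [hz hzt]; exists z; split=> //.
  exists (t0 - t); split; first exact: hKZ.
  apply: (chain_lin w).2 => //; rewrite -(rev_wordK w); exact: chain_rev.
(* Here t0, reached backwards from t, lies in Z_w itself. *)
exists (t - t0); split; first exact: hKZ.
by rewrite subKr; apply: h; exists t; split=> //; apply: chain_rev.
Qed.

(** The first alternatives stop a word. As [rel (true, -1) s y] reads omega s = y, the vector t of
    [extend_even] is killed by omega and lies outside Z_w + im omega. The vector t of [extend_odd]
    would be a return to the tower, which [no_second_tower] excludes. *)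
Hypothesis extend_even : forall w, valid_word w -> ~~ odd (size w) -> live w ->
  (exists t, [/\ img K w t, rel (true, -1) t 0 &
     forall s y, rel (true, -1) s y -> ~ img Z w (t - y)]) \/
  exists l, [/\ ok_letter l, l.1 = true & live (l :: w)].
Hypothesis extend_odd : forall w, valid_word w -> odd (size w) -> live w ->
  (exists t, [/\ img K w t, K t & forall z, Z z -> ~ img Z w (t - z)]) \/
  exists l, [/\ ok_letter l, l.1 = false & live (l :: w)].
Hypothesis tower_line : forall x y, K x -> ~ Z x -> K y -> ~ Z y -> Z (x - y).
Hypothesis K_neq_Z : exists x, K x /\ ~ Z x.

(** Otherwise every live word could be prolonged. In one with 2|T| steps, the initial segments of
    even length supply |T| + 1 vectors of K_w outside Z_w, and comparability of words makes them
    pairwise distinct. *)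
Lemma live_word_ends (T : finType) (code : V -> T) : injective code ->
  exists w t, [/\ valid_word w, ~~ odd (size w), img K w t, rel (true, -1) t 0 &
    forall s y, rel (true, -1) s y -> ~ img Z w (t - y)].
Proof.
move=> code_inj; apply: contrapT => hno.
have long n : exists w, [/\ valid_word w, size w = n & live w].
  elim: n => [|n [w [vw sw lw]]].
    exists [::]; split=> //.
    have [x [hK hZ]] := K_neq_Z; exists x; split; first by exists x.
    by case=> x' [hx' e]; apply: hZ; rewrite -e.
  have [ow|ow] := boolP (odd (size w)).
    have [[t [h1 h2 h3]]|[l [h1 h2 h3]]] := extend_odd vw ow lw.
      by have [z [hz /(h3 z hz)]] := no_second_tower vw ow tower_line h1 h2.
    exists (l :: w); split=> //=; last by rewrite sw.
    by apply/valid_cons; split=> //; rewrite h2 ow.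
  have [[t [h1 h2 h3]]|[l [h1 h2 h3]]] := extend_even vw ow lw.
    by case: hno; exists w, t.
  exists (l :: w); split=> //=; last by rewrite sw.
  by apply/valid_cons; split=> //; rewrite h2 ow.
have [w [vw sw lw]] := long (#|T|.*2)%N.
have wit (k : 'I_#|T|.+1) : exists t, img K (drop k.*2 w) t /\ ~ img Z (drop k.*2 w) t.
  exact: live_drop lw.
have [t ht] := choice wit.
have t_inj : injective (code \o t).
  move=> k l /= /code_inj e; apply: val_inj; apply: contrapT => hkl.
  have hk : (k.*2 <= size w)%N by rewrite sw leq_double -ltnS.
  have hl : (l.*2 <= size w)%N by rewrite sw leq_double -ltnS.
  have [||h|h] := words_comparable (valid_drop (k := k.*2) vw) (valid_drop (k := l.*2) vw).
  - by rewrite !size_drop !oddB // !odd_double.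
  - move/(congr1 size); rewrite !size_drop sw => e2; apply: hkl; apply: double_inj => /=.
    by rewrite -(subKn (m := k.*2) (n := #|T|.*2)) -?sw // sw e2 subKn -?sw.
  - by apply: (ht l).2; rewrite -e; apply: h; apply: (ht k).1.
  - by apply: (ht k).2; rewrite e; apply: h; apply: (ht l).1.
by have := leq_card _ t_inj; rewrite card_ord ltnn.
Qed.

End Chains.

(** * The relations defined by the differential and by omega *)

(* edge i j k records the equation "diff e_i = U^k e_j". *)
Record edge_system (r : nat) (edge : 'I_r -> 'I_r -> nat -> bool) : Prop := EdgeSystem {
  edge_row : forall i j k j' k', edge i j k -> edge i j' k' -> j' = j /\ k' = k;
  edge_col : forall i j k i' k', edge i j k -> edge i' j k' -> i' = i /\ k' = k;
  edge_sq : forall i j k l m, edge i j k -> ~ edge j l m;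
  edge_bound : exists b, forall i j k, edge i j k -> (k < b)%N
}.

Lemma edge_system_tr r (edge : 'I_r -> 'I_r -> nat -> bool) :
  edge_system edge -> edge_system (fun j i => edge i j).
Proof.
case=> h1 h2 h3 [b h4]; split.
- by move=> j i k i' k' /h2 h /h.
- by move=> j i k j' k' /h1 h /h.
- by move=> j i k l m h /h3; apply; exact: h.
- by exists b => j i k /h4.
Qed.

Section EdgeRelations.
Variables (r : nat) (edge : 'I_r -> 'I_r -> nat -> bool) (W : 'M['F_2]_r).

(** The differential mod U. *)
Definition unit_edges : 'M['F_2]_r := \matrix_(i, j) (edge i j 0)%:R.
Local Notation N0 := unit_edges.

(** Equivalently, v has a lift to F[U] whose differential is divisible by U^b: at the source of a
    shorter edge the coefficient must be divisible by U. *)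
Definition divisible_diff b (v : 'rV['F_2]_r) : Prop :=
  forall i j k, edge i j k -> (k < b)%N -> v 0 i = 0.

(** A basis vector e_j may occur only if U^k e_j is a boundary for some k < b; for b = 1 these are
    the boundaries mod U. *)
Definition torsion_below b (w : 'rV['F_2]_r) : Prop :=
  forall j, w 0 j != 0 -> exists i k, edge i j k /\ (k < b)%N.

(* For basis coordinates v, w: "there are lifts of v and w with
   diff v = U^b w". *)
Definition diff_rel b (v w : 'rV['F_2]_r) : Prop :=
  [/\ divisible_diff b v, torsion_below b.+1 w &
     forall i j, edge i j b -> w 0 j = v 0 i].

(** The map induced by omega on the homology of C/U, as a relation between cycles; w is determined
    up to boundaries. *)
Definition omega_rel (v w : 'rV['F_2]_r) : Prop :=
  [/\ v *m N0 = 0, w *m N0 = 0 & exists u, w = v *m W + u *m N0].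

(* A letter with sign 0, which is not a legal letter, imposes no condition. *)
Definition letter_rel (l : letter) (v w : 'rV['F_2]_r) : Prop :=
  let f := if l.1 then omega_rel else diff_rel `|l.2| in
  (l.2 < 0 -> f v w) /\ (0 < l.2 -> f w v).

Definition cycles_mod (v : 'rV['F_2]_r) : Prop := forall i j k, edge i j k -> v 0 i = 0.
Definition torsion_mod (w : 'rV['F_2]_r) : Prop :=
  forall j, w 0 j != 0 -> exists i k, edge i j k.

Hypothesis E : edge_system edge.

Lemma mul_unit_edges (v : 'rV_r) i j : edge i j 0 -> (v *m N0) 0 j = v 0 i.
Proof.
move=> h; rewrite mxE (bigD1 i) //= big1 ?mxE ?h ?mulr1 ?addr0 // => l hl.
rewrite mxE; case: (boolP (edge l j 0)) => [h'|_]; last exact: mulr0.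
by move: hl; rewrite (edge_col E h h').1 eqxx.
Qed.

Lemma mul_unit_edges0 (v : 'rV_r) j : (forall i, ~~ edge i j 0) -> (v *m N0) 0 j = 0.
Proof.
by move=> h; rewrite mxE big1 // => l _; rewrite mxE (negbTE (h l)) mulr0.
Qed.

Lemma unit_edges_sq : N0 *m N0 = 0.
Proof.
apply/row_matrixP => i; rewrite row_mul row0; apply/rowP => j; rewrite [RHS]mxE.
have [[l hl]|h] := EM (exists l, edge l j 0); last first.
  by apply: mul_unit_edges0 => l; apply/negP => hl; apply: h; exists l.
rewrite (mul_unit_edges _ hl) !mxE.
by case: (boolP (edge i l 0)) => // /(edge_sq E) /(_ hl).
Qed.

(** [N0] is a partial permutation matrix, so N0^T N0 projects onto its image. N0^T later yields the
    homotopies. *)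
Lemma torsion_below1_proj w : torsion_below 1 w -> w *m N0^T *m N0 = w.
Proof.
move=> h; apply/rowP => j.
have [[i hi]|hn] := EM (exists l, edge l j 0); last first.
  rewrite mul_unit_edges0 => [|l]; last by apply/negP => hl; apply: hn; exists l.
  apply/esym/eqP/negPn/negP => /h[i [k [hik hk]]]; apply: hn; exists i.
  by move: hik; case: k hk.
rewrite (mul_unit_edges _ hi) mxE (bigD1 j) //= big1 ?mxE ?hi ?mulr1 ?addr0 // => l hl.
rewrite !mxE; case: (boolP (edge i l 0)) => [h'|_]; last exact: mulr0.
by move: hl; rewrite (edge_row E hi h').1 eqxx.
Qed.

Lemma torsion_below1P w : torsion_below 1 w <-> exists u, w = u *m N0.
Proof.
split=> [/torsion_below1_proj h|[u ->] j]; first by exists (w *m N0^T).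
have [[i hi] _|hn] := EM (exists l, edge l j 0); first by exists i, 0%N.
by rewrite mul_unit_edges0 ?eqxx // => l; apply/negP => hl; apply: hn; exists l.
Qed.

Lemma divisible_diff1P v : divisible_diff 1 v <-> v *m N0 = 0.
Proof.
split=> [h|h i j [|k] // hij _]; last by rewrite -(mul_unit_edges v hij) h mxE.
apply/rowP => j; rewrite [RHS]mxE.
have [[i hi]|hn] := EM (exists l, edge l j 0).
  by rewrite (mul_unit_edges _ hi); apply: h hi _.
by apply: mul_unit_edges0 => l; apply/negP => hl; apply: hn; exists l.
Qed.

Lemma torsion_below_sub b : sub_closed (torsion_below b).
Proof.
split=> [j|x y hx hy j]; rewrite !mxE ?eqxx // => h.
have [h0|/hx //] := eqVneq (x 0 j) 0; apply: hy.
by apply: contraNneq h => ->; rewrite h0 subrr.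
Qed.

Lemma torsion_mod_sub : sub_closed torsion_mod.
Proof.
split=> [j|x y hx hy j]; rewrite !mxE ?eqxx // => h.
have [h0|/hx //] := eqVneq (x 0 j) 0; apply: hy.
by apply: contraNneq h => ->; rewrite h0 subrr.
Qed.

Lemma divisible_diff_sub b : sub_closed (divisible_diff b).
Proof.
split=> [i j k _ _|x y hx hy i j k h1 h2]; first by rewrite mxE.
by rewrite !mxE (hx _ _ _ h1 h2) (hy _ _ _ h1 h2) subr0.
Qed.

Lemma cycles_mod_sub : sub_closed cycles_mod.
Proof.
split=> [i j k _|x y hx hy i j k h]; first by rewrite mxE.
by rewrite !mxE (hx _ _ _ h) (hy _ _ _ h) subr0.
Qed.

Lemma torsion_cycles w : torsion_mod w -> cycles_mod w.
Proof.
move=> h i j k hij; apply/eqP/negPn/negP => /h[l [m hl]].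
exact: (edge_sq E hl hij).
Qed.

Lemma torsion_belowW b w : torsion_below b w -> torsion_mod w.
Proof. by move=> h j /h[i [k [hk _]]]; exists i, k. Qed.

Lemma torsion_below_le b c w : (b <= c)%N -> torsion_below b w -> torsion_below c w.
Proof. by move=> hbc h j /h[i [k [hk hb]]]; exists i, k; split=> //; apply: leq_trans hbc. Qed.

Lemma cycles_divisible b w : cycles_mod w -> divisible_diff b w.
Proof. by move=> h i j k hk _; apply: h hk. Qed.

Lemma divisible_diff_le b c w : (b <= c)%N -> divisible_diff c w -> divisible_diff b w.
Proof. by move=> hbc h i j k hk hb; apply: (h i j k hk); apply: leq_trans hbc. Qed.

Lemma diff_rel_lin b : linear_rel (diff_rel b).
Proof.
split=> [|x y x' y' [h1 h2 h3] [h1' h2' h3']].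
  split; [exact: (divisible_diff_sub b).1|exact: (torsion_below_sub _).1|].
  by move=> i j _; rewrite !mxE.
split; [exact: (divisible_diff_sub b).2|exact: (torsion_below_sub _).2|].
by move=> i j h; rewrite !mxE (h3 _ _ h) (h3' _ _ h).
Qed.

Lemma omega_rel_lin : linear_rel omega_rel.
Proof.
split=> [|x y x' y' [h1 h2 [u h3]] [h1' h2' [u' h3']]].
  by split; rewrite ?mul0mx //; exists 0; rewrite !mul0mx addr0.
split; rewrite ?mulmxBl ?h1 ?h1' ?h2 ?h2' ?subr0 //.
by exists (u - u'); rewrite h3 h3' !mulmxBl opprD addrACA.
Qed.

Lemma letter_rel_lin l : linear_rel (letter_rel l).
Proof.
have hf : linear_rel (if l.1 then omega_rel else diff_rel `|l.2|).
  by case: l.1; [exact: omega_rel_lin|exact: diff_rel_lin].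
split=> [|x y x' y' [h1 h2] [h1' h2']]; first by split=> _; apply: hf.1.
by split=> h; apply: hf.2; first [exact: h1|exact: h1'|exact: h2|exact: h2'].

Qed.

Lemma letter_rel_opp l x y : letter_rel (opp_letter l) x y <-> letter_rel l y x.
Proof.
by rewrite /letter_rel /= oppr_lt0 oppr_gt0 abszN; split=> -[h1 h2]; split.
Qed.

(** From here to [diff_rel_0r] the four subspaces of the relation are computed: indeterminacy
    [torsion_below b], range [torsion_below b.+1], domain [divisible_diff b], kernel
    [divisible_diff b.+1]. Range and kernel for b are thus indeterminacy and domain for b + 1, so
    consecutive exponents leave no gap. *)
Lemma diff_rel0l b w : torsion_below b w -> diff_rel b 0 w.
Proof.
move=> h; split; [exact: (divisible_diff_sub b).1|exact: torsion_below_le h|].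
move=> i j hij; rewrite mxE; apply/eqP/negPn/negP => /h[i' [k [h1 h2]]].
by have [_ e] := edge_col E hij h1; move: h2; rewrite e ltnn.
Qed.

Lemma diff_rel0r b v : divisible_diff b.+1 v -> diff_rel b v 0.
Proof.
move=> h; split; [exact: divisible_diff_le h|exact: (torsion_below_sub _).1|].
by move=> i j hij; rewrite mxE (h i j b).
Qed.

Lemma diff_rel_ex_src b w : torsion_below b.+1 w -> exists v, diff_rel b v w.
Proof.
move=> h; exists (\row_i (if [pick j | edge i j b] is Some j then w 0 j else 0)).
split=> // [i j k hij hk|i j hij]; rewrite mxE; case: pickP => [j' hj'|h0] //.
- by have [_ e] := edge_row E hij hj'; move: hk; rewrite e ltnn.
- by rewrite (edge_row E hij hj').1.
- by move: (h0 j); rewrite hij.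
Qed.

Lemma diff_rel_ex_tgt b v : divisible_diff b v -> exists w, diff_rel b v w.
Proof.
move=> h; exists (\row_j (if [pick i | edge i j b] is Some i then v 0 i else 0)).
split=> // [j|i j hij]; rewrite mxE; case: pickP => [i' hi'|h0] //.
- by exists i', b.
- by rewrite (edge_col E hij hi').1.
- by move: (h0 i); rewrite hij.
Qed.

Lemma diff_rel_0l b w : diff_rel b 0 w -> torsion_below b w.
Proof.
case=> _ h1 h2 j hj; have [i [k [hk hb]]] := h1 j hj; exists i, k; split=> //.
move: hb; rewrite ltnS leq_eqVlt => /orP[/eqP e|//].
by move: hj; rewrite (h2 i j) ?mxE ?eqxx // -e.
Qed.

Lemma diff_rel_0r b v : diff_rel b v 0 -> divisible_diff b.+1 v.
Proof.
case=> h1 _ h2 i j k hk; rewrite ltnS leq_eqVlt => /orP[/eqP e|hb].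
  by rewrite -(h2 i j) ?mxE // -e.
exact: h1 hk hb.
Qed.

Lemma divisible_large : exists b, forall v, divisible_diff b v -> cycles_mod v.
Proof.
by have [b hb] := edge_bound E; exists b => v h i j k hk; apply: (h i j k hk); apply: hb hk.
Qed.

Lemma torsion_large : exists b, forall v, torsion_mod v -> torsion_below b v.
Proof.
have [b hb] := edge_bound E; exists b => v h j /h[i [k hk]].
by exists i, k; split=> //; apply: hb hk.
Qed.

(* The two identities say that W acts on the homology of N0 with square 0. *)
Hypothesis W_chain : N0 *m W = W *m N0.
Hypothesis W_sq : exists H, W *m W = H *m N0 + N0 *m H.

Lemma W_sq_cycle (v : 'rV_r) : v *m N0 = 0 -> exists u, v *m W *m W = u *m N0.
Proof.
have [H hH] := W_sq; move=> h; exists (v *m H).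
by rewrite -mulmxA hH mulmxDr !mulmxA h mul0mx addr0.
Qed.

Lemma omega_rel0l w : torsion_below 1 w -> omega_rel 0 w.
Proof.
move=> /torsion_below1P[u ->]; split; rewrite ?mul0mx //.
  by rewrite -mulmxA unit_edges_sq mulmx0.
by exists u; rewrite ?mul0mx add0r.
Qed.

Lemma omega_rel0r v : torsion_below 1 v -> omega_rel v 0.
Proof.
move=> /torsion_below1P[u ->]; split; rewrite ?mul0mx //.
  by rewrite -mulmxA unit_edges_sq mulmx0.
exists (- (u *m W)); rewrite -mulmxA W_chain mulmxA mulNmx.
exact/esym/subrr.
Qed.

Lemma omega_rel_0l w : omega_rel 0 w -> torsion_below 1 w.
Proof. by case=> _ _ [u ->]; apply/torsion_below1P; exists u; rewrite mul0mx add0r. Qed.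

Lemma omega_rel_ex v : v *m N0 = 0 -> omega_rel v (v *m W).
Proof.
move=> h; split=> //; last by exists 0; rewrite mul0mx addr0.
by rewrite -mulmxA -W_chain mulmxA h mul0mx.
Qed.

(** Here the null-homotopy of omega^2 mod U enters: im omega lies in ker omega, which puts the
    letter -1 below the letter 1. *)
Lemma omega_rel_comp v w : omega_rel v w -> omega_rel w 0.
Proof.
case=> h1 h2 [u hu]; split; rewrite ?mul0mx //.
have [u' hu'] := W_sq_cycle h1; exists (- (u' + u *m W)).
by rewrite {1}hu mulmxDl hu' -(mulmxA u) W_chain mulmxA -mulmxDl mulNmx subrr.
Qed.

(** Differential letters follow the filtration by [torsion_below 1], [torsion_below 2], ..., Z, K,
    ..., [divisible_diff 2], [divisible_diff 1]. A parameter z thus has the rank of 1/z, with the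
    empty word at 0: the order is -1, -2, ..., 2, 1. *)
Lemma letters_coarse l l' : ok_letter l -> ok_letter l' -> l.1 = l'.1 -> l <> l' ->
  (forall x y, letter_rel l x y -> letter_rel l' 0 y) \/
  (forall x y, letter_rel l' x y -> letter_rel l 0 y).
Proof.
wlog hlt : l l' / l.2 < l'.2.
  move=> hw ol ol' ht hne; case: (ltgtP l.2 l'.2) => h.
  - exact: hw.
  - have [||h1|h1] := hw l' l h ol' ol; [by []|by move=> e; apply: hne|by right|by left].
  - by case: hne; case: l l' ht h {ol ol' hw} => [t z] [t' z'] /= -> ->.
case: l l' hlt => [t z] [t' z'] /= hlt ol ol' e _; subst t'.
move: ol ol'; rewrite /ok_letter /letter_rel /=; case: t => oz oz'.
  have [-> ->] : z = -1 /\ z' = 1 by lia.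
  left=> x y [/(_ isT) h _]; split=> // _; exact: omega_rel_comp h.
have [hz|hz] := ltP z 0; have [hz'|hz'] := ltP z' 0; try lia.
- right=> x y [/(_ isT) [_ h _] _]; split=> hz0; last by lia.
  by apply: diff_rel0l; apply: torsion_below_le h; move: hlt hz hz' oz oz'; clear; lia.
- left=> x y [/(_ isT) [_ h _] _]; split=> hz0; first by lia.
  by apply/diff_rel0r/cycles_divisible/torsion_cycles; apply: torsion_belowW h.
- right=> x y [_ h]; have [|h1 _ _] := h; first by lia.
  split=> hz0; first by lia.
  by apply: diff_rel0r; apply: divisible_diff_le h1; move: hlt hz hz'; clear; lia.
Qed.

Lemma letters_coarse0 l : ok_letter l -> l.1 = false ->
  (forall x y, letter_rel l x y -> torsion_mod y) \/
  (forall y, cycles_mod y -> letter_rel l 0 y).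
Proof.
case: l => [t z] /= ol e; subst t; move: ol; rewrite /ok_letter /letter_rel /= => ol.
have [hz|hz] := ltP z 0.
  by left=> x y [/(_ isT) [_ h _] _]; apply: torsion_belowW h.
right=> y h; split=> hz0; first by lia.
by apply/diff_rel0r/cycles_divisible.
Qed.

Lemma letter_rel_range l x y : ok_letter l -> letter_rel l x y -> y *m N0 = 0.
Proof.
case: l => t z; rewrite /ok_letter /letter_rel /= => ol [h1 h2].
have {ol}[hz|hz] : z < 0 \/ 0 < z by case: t ol {h1 h2}; lia.
  move: (h1 hz); case: t {h1 h2} => -[] // _ h _; apply/divisible_diff1P.
  by apply/cycles_divisible/torsion_cycles; apply: torsion_belowW h.
move: (h2 hz); case: t {h1 h2} => -[] // h _ _; apply/divisible_diff1P.
by apply: divisible_diff_le h; lia.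
Qed.

(** Boundaries mod U are in the indeterminacy of every letter; together with [letter_rel_range] this
    makes the letters relations on the homology of C/U. *)
Lemma letter_rel_torsion1 l y : ok_letter l -> torsion_below 1 y -> letter_rel l 0 y.
Proof.
case: l => t z; rewrite /ok_letter /letter_rel /= => ol hy.
case: t ol => ol; split=> hz.
- exact: omega_rel0l.
- exact: omega_rel0r.
- by apply: diff_rel0l; apply: torsion_below_le hy; lia.
- by apply/diff_rel0r/cycles_divisible/torsion_cycles; apply: torsion_belowW hy.
Qed.

Local Notation Img := (img letter_rel).

Lemma img_range w y : valid_word w -> Img cycles_mod w y -> y *m N0 = 0.
Proof.
case: w => [_ [x [hx <-]]|l w /valid_cons[ol _ _] /img_cons[z [_ h]]].
  by apply/divisible_diff1P/cycles_divisible.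
exact: letter_rel_range ol h.
Qed.

Lemma img_torsion w y : valid_word w -> torsion_below 1 y -> Img torsion_mod w y.
Proof.
case: w => [_ h|l w /valid_cons[ol _ _] h].
  by exists y; split=> //; apply: torsion_belowW h.
apply/img_cons; exists 0; split; last exact: letter_rel_torsion1.
by have [] := img_sub letter_rel_lin w torsion_mod_sub.
Qed.

(** If im omega meets K_w outside Z_w, the letter 1 prolongs w. If not, any vector of K_w outside
    Z_w that omega kills stops the word: were it in Z_w + im omega, its omega part would be of the
    first kind. If there is none, omega kills nothing of K_w outside Z_w, and the letter -1 prolongs
    w. *)
Lemma letters_extend_even w : valid_word w -> live letter_rel torsion_mod cycles_mod w ->
  (exists t, [/\ Img cycles_mod w t, letter_rel (true, -1) t 0 &
     forall s y, letter_rel (true, -1) s y -> ~ Img torsion_mod w (t - y)]) \/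
  exists l, [/\ ok_letter l, l.1 = true & live letter_rel torsion_mod cycles_mod (l :: w)].
Proof.
move=> vw [t0 [ht0 hnt0]].
have Asub := img_sub letter_rel_lin w torsion_mod_sub.
have Bsub := img_sub letter_rel_lin w cycles_mod_sub.
have AB y : Img torsion_mod w y -> Img cycles_mod w y.
  by apply: img_mono => x; exact: torsion_cycles.
have [hplus|hplus] := EM (exists t s,
    [/\ Img cycles_mod w t, ~ Img torsion_mod w t & omega_rel s t]).
  case: hplus => t [s [h1 h2 h3]]; right; exists (true, 1); split=> //.
  exists s; split; first by apply/img_cons; exists t; split=> //; split.
  move=> /img_cons[a [ha [_ /(_ isT) hs]]]; apply: h2.
  rewrite -[t](subrK a); apply: sub_closedD => //; apply: img_torsion => //.
  by apply: omega_rel_0l; rewrite -(subrr s); apply: omega_rel_lin.2.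
have [[t [h1 h2 h3]]|hker] :=
    EM (exists t, [/\ Img cycles_mod w t, ~ Img torsion_mod w t & omega_rel t 0]).
  left; exists t; split=> // s y [/(_ isT) hs _] hA.
  apply: hplus; exists y, s; split=> //.
    by rewrite -[y](subKr t); apply: Bsub.2 => //; apply: AB.
  by move=> hy; apply: h2; rewrite -(subrK y t); apply: sub_closedD.
right; exists (true, -1); split=> //; exists (t0 *m W).
have hc := img_range vw ht0.
split; first by apply/img_cons; exists t0; split=> //; split=> // _; exact: omega_rel_ex.
move=> /img_cons[a [ha [/(_ isT) h _]]]; apply: hker; exists (t0 - a); split.
- by apply: Bsub.2 => //; apply: AB.
- by move=> h'; apply: hnt0; rewrite -(subrK a t0); apply: sub_closedD.
- by rewrite -(subrr (t0 *m W)); apply: omega_rel_lin.2 => //; exact: omega_rel_ex.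
Qed.

(** If both alternatives fail, K_w is shown to lie in Z_w on ever larger members of the filtration
    behind [letters_coarse]: the letters b > 0 settle the torsion part, the failing first
    alternative settles K, and the letters b < 0 lead on to [divisible_diff 1], which contains
    K_w. *)
Lemma letters_extend_odd w : valid_word w -> live letter_rel torsion_mod cycles_mod w ->
  (exists t, [/\ Img cycles_mod w t, cycles_mod t &
     forall z, torsion_mod z -> ~ Img torsion_mod w (t - z)]) \/
  exists l, [/\ ok_letter l, l.1 = false & live letter_rel torsion_mod cycles_mod (l :: w)].
Proof.
move=> vw [t0 [ht0 hnt0]].
have Asub := img_sub letter_rel_lin w torsion_mod_sub.
have Bsub := img_sub letter_rel_lin w cycles_mod_sub.
have AB y : Img torsion_mod w y -> Img cycles_mod w y.
  by apply: img_mono => x; exact: torsion_cycles.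
apply: contrapT => /not_orP[htow hext].
have tors b t : Img cycles_mod w t -> torsion_below b.+1 t -> Img torsion_mod w t.
  elim: b t => [|b IH] t ht hb; first exact: img_torsion.
  apply: contrapT => hn; apply: hext; exists (false, b.+1%:Z); split=> //.
  have [s hs] := diff_rel_ex_src hb; exists s.
  split; first by apply/img_cons; exists t; split=> //; split.
  move=> /img_cons[a [ha [_ /(_ isT) h]]]; apply: hn.
  rewrite -(subrK a t); apply: sub_closedD => //; apply: IH.
    by apply: Bsub.2 => //; apply: AB.
  by apply: diff_rel_0l; rewrite -(subrr s); apply: (diff_rel_lin _).2.
have [bt hbt] := torsion_large.
have cyc t : Img cycles_mod w t -> cycles_mod t -> Img torsion_mod w t.
  move=> ht hc; apply: contrapT => hn; apply: htow; exists t; split=> // z hz hA; apply: hn.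
  rewrite -(subrK z t); apply: sub_closedD => //; apply: (tors bt).
    by rewrite -(subKr t z); apply: Bsub.2 => //; apply: AB.
  by apply: torsion_below_le (hbt z hz).
have [bd hbd] := divisible_large.
(* Induction on b lowers the exponent from bd + 1, where divisibility already means being a cycle,
   to 1. *)
have div b t : (b <= bd)%N -> Img cycles_mod w t -> divisible_diff (bd - b).+1 t ->
    Img torsion_mod w t.
  elim: b t => [|b IH] t hb ht hd.
    by apply: cyc => //; apply: hbd; apply: divisible_diff_le hd; lia.
  have [hle|hle] := leqP bd b; first by lia.
  have hn := subnSK hle; apply: contrapT => hnt; apply: hext.
  exists (false, - (bd - b)%N%:Z); split=> //; first by rewrite /ok_letter /=; lia.
  have [s hs] := diff_rel_ex_tgt hd; rewrite hn in hs; exists s.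
  split.
    apply/img_cons; exists t; split=> //; split=> /= h; last by lia.
    by rewrite abszN absz_nat.
  move=> /img_cons[a [ha [h _]]]; apply: hnt.
  have {}h : diff_rel (bd - b) a s by move: h; rewrite /= abszN absz_nat; apply; lia.
  rewrite -(subrK a t); apply: sub_closedD => //; apply: IH; first by lia.
    by apply: Bsub.2 => //; apply: AB.
  by apply: diff_rel_0r; rewrite -(subrr s); apply: (diff_rel_lin _).2.
apply: hnt0; apply: (div bd) => //; rewrite subnn.
by apply/divisible_diff1P; apply: img_range ht0.
Qed.

End EdgeRelations.

(** * Duality and homogeneity *)

Lemma F2mx_oppr m n (A : 'M['F_2]_(m, n)) : - A = A.
Proof.
by apply/matrixP => i j; rewrite mxE; case: (A i j) => [[|[|c]] hc] //; apply: val_inj.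
Qed.

Lemma F2_scaled (V : lmodType 'F_2) (A : V -> Prop) (c : 'F_2) x :
  sub_closed A -> A x -> A (c *: x).
Proof.
move=> hA hx; have [->|/F2_neq0 ->] := eqVneq c 0; last by rewrite scale1r.
by rewrite scale0r; apply: hA.1.
Qed.

(** The space is finite, so a matrix [M] can list all vectors of A as rows; its row space is A, and
    some column of the cokernel matrix detects u. *)
Lemma F2_separation r (A : 'rV['F_2]_r -> Prop) u : sub_closed A -> ~ A u ->
  exists phi : 'cV['F_2]_r, (forall v, A v -> v *m phi = 0) /\ u *m phi = 1%:M.
Proof.
move=> hA hu.
pose M : 'M['F_2]_(#|{: 'rV['F_2]_r}|, r) :=
  \matrix_(i < _) (if `[< A (enum_val i) >] then enum_val i else 0).
have subM v : A v -> (v <= M)%MS.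
  move=> hv; apply: (submx_trans _ (row_sub (enum_rank v) M)).
  by rewrite rowK enum_rankK asboolT.
have memM v : (v <= M)%MS -> A v.
  case/submxP => D ->; rewrite mulmx_sum_row.
  elim/big_ind: _ => [|x y hx hy|i _]; [exact: hA.1|exact: sub_closedD|].
  apply: F2_scaled => //; rewrite rowK; case: ifP => [/asboolP //|_]; exact: hA.1.
have [c hc] : exists c : 'M_r, forall v : 'rV_r, (v <= M)%MS = (v *m c == 0).
  by exists (cokermx M) => v; rewrite submxE.
have [j hj] : exists j, (u *m c) 0 j != 0.
  apply: contrapT => hn; apply: hu; apply: memM; rewrite hc; apply/eqP/rowP => j.
  by rewrite [RHS]mxE; apply/eqP/negPn/negP => h; apply: hn; exists j.
exists (col j c); split=> [v' /subM|].
  by rewrite hc colE mulmxA => /eqP ->; rewrite mul0mx.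
apply/matrixP => a b; rewrite !ord1 colE mulmxA -colE !mxE.
by move: hj; rewrite mxE => /F2_neq0.
Qed.

(** * Adjoint relations and walking back with functionals *)

Section DualChains.
Variable r : nat.
Local Notation V := 'rV['F_2]_r.
Local Notation V' := 'cV['F_2]_r.

(** The adjoint of R: psi is a pullback of phi along R. *)
Definition dual_rel (R : V -> V -> Prop) (psi phi : V') : Prop :=
  forall v w, R v w -> v *m psi = w *m phi.

Lemma dual_rel_ex (R : V -> V -> Prop) (A : V -> Prop) (phi : V') :
  linear_rel R -> sub_closed A -> (forall v w, A v -> R v w -> w *m phi = 0) ->
  exists psi, (forall v, A v -> v *m psi = 0) /\ dual_rel R psi phi.
Proof.
move=> hR hA hphi.
(* G is the graph, modulo A, of the partial functional taking v to the value of phi on w. It misses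
   (0, 1) because phi kills R(A), and a functional separating (0, 1) from G restricts to psi. *)
pose G (x : 'rV['F_2]_(r + 1)) := exists a v w,
  [/\ A a, R v w & x = row_mx (a + v) (w *m phi)].
have hG : sub_closed G.
  split.
    exists 0, 0, 0; rewrite mul0mx addr0 row_mx0.
    by split=> //; [apply: hA.1|apply: hR.1].
  move=> _ _ [a [v [w [h1 h2 ->]]]] [a' [v' [w' [h1' h2' ->]]]].
  exists (a - a'), (v - v'), (w - w'); split; [exact: hA.2|exact: hR.2|].
  by rewrite mulmxBl opp_row_mx add_row_mx opprD addrACA.
have [|Phi [hP1 hP2]] := @F2_separation _ G (row_mx 0 1%:M) hG.
  case=> a [v [w [h1 h2 /eq_row_mx[h3 h4]]]].
  have h5 : A v.
    have -> : v = - a by apply/eqP; rewrite -addr_eq0 addrC -h3.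
    exact: sub_closedN.
  have := hphi v w h5 h2; rewrite -h4 => /matrixP/(_ 0 0).
  by rewrite !mxE.
move: hP1 hP2; rewrite -(vsubmxK Phi); set P1 := usubmx _; set P2 := dsubmx _.
rewrite mul_row_col mul0mx add0r mul1mx => hP1 hP2.
exists P1; split=> [v hv|v w hvw].
  have /hP1 : G (row_mx v 0) by exists v, 0, 0; rewrite addr0 mul0mx; split=> //; apply: hR.1.
  by rewrite mul_row_col mul0mx addr0.
have /hP1 : G (row_mx v (w *m phi)) by exists 0, v, w; rewrite add0r; split=> //; apply: hA.1.
rewrite mul_row_col hP2 mulmx1 => /eqP; rewrite addr_eq0 F2mx_oppr => /eqP //.
Qed.

Variable rel : letter -> V -> V -> Prop.
Hypothesis rel_lin : forall l, linear_rel (rel l).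

Lemma dual_chain_ex (X : V -> Prop) w (phi : V') : sub_closed X ->
  (forall v, img rel X w v -> v *m phi = 0) ->
  exists psi, (forall v, X v -> v *m psi = 0) /\
    chain (fun l => dual_rel (rel l)) w psi phi.
Proof.
move=> hX; elim: w phi => [|l w IH] phi h.
  by exists phi; split=> // v hv; apply: h; exists v.
have [|phi' [h1 h2]] :=
    @dual_rel_ex (rel l) (img rel X w) phi (rel_lin l) (img_sub rel_lin w hX).
  by move=> v v' h1 h2; apply: h; apply/img_cons; exists v.
have [psi [h3 h4]] := IH _ h1.
by exists psi; split=> //; exists phi'.
Qed.

(** This constancy transfers the value 1 of phi on t to the tower end of the word. *)
Lemma dual_chain_pairing w x y (psi phi : V') : chain rel w x y ->
  chain (fun l => dual_rel (rel l)) w psi phi -> x *m psi = y *m phi.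
Proof.
elim: w y phi => [|l w IH] y phi /=; first by move=> -> ->.
by case=> z [h1 h2] [z' [h1' h2']]; rewrite (IH _ _ h1 h1'); apply: h2'.
Qed.

End DualChains.

(** * Adjoint relations as relations of the transposed complex *)

Section Transposition.
Variables (r : nat) (edge : 'I_r -> 'I_r -> nat -> bool) (W : 'M['F_2]_r).
Hypothesis E : edge_system edge.
Local Notation edge' := (fun j i => edge i j).
Local Notation N0 := (unit_edges edge).

Lemma unit_edges_tr : unit_edges edge' = N0^T.
Proof. by apply/matrixP => i j; rewrite !mxE. Qed.

(** The three conditions come from testing the adjoint on the pairs (0, e_j), (e_i, 0) and (e_i,
    e_j). *)
Lemma diff_rel_dual b psi phi :
  dual_rel (diff_rel edge b) psi phi -> diff_rel edge' b phi^T psi^T.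
Proof.
move=> h.
have coord (c : 'cV['F_2]_r) i : ((delta_mx 0 i : 'rV_r) *m c) 0 0 = c i 0.
  by rewrite -rowE mxE.
split=> [j i k hij hk|i|j i hij]; rewrite !mxE.
- have : diff_rel edge b 0 (delta_mx 0 j).
    apply: (diff_rel0l E) => l; rewrite mxE eqxx /=.
    by have [->|] := eqVneq l j; [exists i, k|rewrite eqxx].
  by move/h/matrixP/(_ 0 0); rewrite coord mul0mx mxE.
- move=> hi; apply: contrapT => hn; case/eqP: hi.
  have : diff_rel edge b (delta_mx 0 i) 0.
    apply: (diff_rel0r) => l j k hlj hk; rewrite mxE eqxx /=.
    by have [e|//] := eqVneq l i; case: hn; exists j, k; rewrite -e.
  by move/h/matrixP/(_ 0 0); rewrite coord mul0mx mxE.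
have : diff_rel edge b (delta_mx 0 i) (delta_mx 0 j).
  split=> [l m k hlm hk|l|l m hlm]; rewrite !mxE !eqxx /=.
  - have [e|//] := eqVneq l i; subst l; move: hk.
    by rewrite (edge_row E hij hlm).2 ltnn.
  - by have [->|] := eqVneq l j; [exists i, b|rewrite eqxx].
  have [e|ne] := eqVneq m j; first by subst m; rewrite (edge_col E hij hlm).1 eqxx.
  by have [e|//] := eqVneq l i; subst l; move: ne; rewrite (edge_row E hij hlm).1 eqxx.
by move/h/matrixP/(_ 0 0); rewrite !coord.
Qed.

Hypothesis W_chain : N0 *m W = W *m N0.

(** Since boundaries are related to 0, phi kills them and is a cycle of the transpose; psi - W phi
    vanishes on all cycles mod U, so it is a boundary of the transpose. *)
Lemma omega_rel_dual psi phi :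
  dual_rel (omega_rel edge W) psi phi -> omega_rel edge' W^T phi^T psi^T.
Proof.
move=> h.
have hphi : N0 *m phi = 0.
  apply/row_matrixP => i; rewrite row_mul row0.
  have : omega_rel edge W 0 (row i N0).
    apply: omega_rel0l => //; apply/torsion_below1P => //.
    by exists (delta_mx 0 i); rewrite rowE.
  by move/h; rewrite mul0mx.
have hpsi : N0 *m psi = 0.
  apply/row_matrixP => i; rewrite row_mul row0.
  have : omega_rel edge W (row i N0) (row i N0 *m W).
    by apply: omega_rel_ex => //; rewrite -row_mul (unit_edges_sq E) row0.
  move/h ->; rewrite -row_mul W_chain -row_mul -mulmxA hphi mulmx0; exact: row0.
split; rewrite ?unit_edges_tr -?trmx_mul ?hphi ?hpsi ?trmx0 //.
have /(torsion_below1P (edge_system_tr E))[u hu] : torsion_below edge' 1 (psi - W *m phi)^T.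
  move=> i hi; apply: contrapT => hn; case/eqP: hi.
  have : omega_rel edge W (delta_mx 0 i) (delta_mx 0 i *m W).
    apply: omega_rel_ex => //; apply/divisible_diff1P => // l j k hlj hk; rewrite mxE eqxx /=.
    by have [e|//] := eqVneq l i; case: hn; exists j, k; rewrite -e.
  move/h; rewrite -mulmxA => /eqP; rewrite -subr_eq0 -mulmxBr -rowE => /eqP/matrixP/(_ 0 0).
  by rewrite !mxE.
by exists u; rewrite -unit_edges_tr -hu linearB /= trmx_mul addrC subrK.
Qed.

Lemma letter_rel_dual l psi phi :
  dual_rel (letter_rel edge W l) psi phi ->
  ok_letter l -> letter_rel edge' W^T (opp_letter l) psi^T phi^T.
Proof.
move=> h ol; rewrite /letter_rel /= oppr_lt0 oppr_gt0 abszN.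
have ll (R : 'rV['F_2]_r -> 'rV['F_2]_r -> Prop) :
   (forall v w, (l.2 < 0 -> R v w) /\ (0 < l.2 -> R w v) -> v *m psi = w *m phi) ->
   (0 < l.2 -> dual_rel R phi psi) /\ (l.2 < 0 -> dual_rel R psi phi).
  move=> h'; split=> hl v w hR; [apply/esym|]; apply: h'; split=> // hl'.
    by move: (lt_trans hl hl'); rewrite ltxx.
  by move: (lt_trans hl hl'); rewrite ltxx.
move: h; rewrite /dual_rel /letter_rel.
by case: l.1 => /ll[h1 h2]; split=> hl;
  [exact/omega_rel_dual/h1|exact/omega_rel_dual/h2
  |exact/diff_rel_dual/h1|exact/diff_rel_dual/h2].
Qed.

End Transposition.

(** The difference gr T_{i+1} - gr T_i in a standard complex. *)
Definition letter_shift (l : letter) : int :=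
  if l.1 then 0 else Num.sg l.2 - 2 * l.2.

Section Homogeneous.
Variables (r : nat) (edge : 'I_r -> 'I_r -> nat -> bool) (W : 'M['F_2]_r).
Variable g : 'I_r -> int.
Hypothesis E : edge_system edge.
Hypothesis edge_degree : forall i j k, edge i j k -> g j - 2 * k%:Z = g i - 1.
Hypothesis W_degree : forall i j, W i j != 0 -> g i = g j.

(** The search for a word ignores gradings. As all relations are homogeneous, a graded chain is
    recovered afterwards by projecting each vector to the degree of its T_i. *)
Definition hcomp d (v : 'rV['F_2]_r) : 'rV['F_2]_r :=
  \row_i (if g i == d then v 0 i else 0).

Lemma hcomp0 d : hcomp d 0 = 0.
Proof. by apply/rowP => i; rewrite !mxE if_same. Qed.

Lemma hcompD d v w : hcomp d (v + w) = hcomp d v + hcomp d w.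
Proof. by apply/rowP => i; rewrite !mxE; case: ifP; rewrite ?addr0. Qed.

Lemma hcompM d d' (A : 'M['F_2]_r) v : (forall i j, A i j != 0 -> g i + d' = g j + d) ->
  hcomp d v *m A = hcomp d' (v *m A).
Proof.
move=> h; apply/rowP => j; rewrite !mxE; case: ifP => [/eqP e|ne].
  apply: eq_bigr => i _; rewrite mxE; have [->|/h hA] := eqVneq (A i j) 0.
    by rewrite !mulr0.
  by have -> : g i == d by lia.
apply: big1 => i _; rewrite mxE; have [->|/h hA] := eqVneq (A i j) 0.
  by rewrite mulr0.
have -> : g i == d = false by lia.
exact: mul0r.
Qed.

Lemma unit_edges_degree i j : unit_edges edge i j != 0 -> g j = g i - 1.
Proof.
by rewrite mxE; case: (boolP (edge i j 0)) => [/edge_degree|_]; [lia|rewrite eqxx].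
Qed.

Lemma hcomp_omega_rel d v w : omega_rel edge W v w ->
  omega_rel edge W (hcomp d v) (hcomp d w).
Proof.
have hN c (x : 'rV_r) : hcomp c x *m unit_edges edge = hcomp (c - 1) (x *m unit_edges edge).
  by apply: hcompM => i j /unit_edges_degree; lia.
case=> h1 h2 [u h3]; split; rewrite ?hN ?h1 ?h2 ?hcomp0 //.
exists (hcomp (d + 1) u); rewrite hN h3 hcompD addrK; congr (_ + _).
by apply/esym/hcompM => i j /W_degree ->.
Qed.

Lemma hcomp_diff_rel b d v w : diff_rel edge b v w ->
  diff_rel edge b (hcomp d v) (hcomp (d + 2 * b%:Z - 1) w).
Proof.
case=> h1 h2 h3; split=> [i j k hij hk|j|i j hij]; rewrite ?mxE.
- by rewrite (h1 _ _ _ hij hk) if_same.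
- by case: ifP => [_|_]; [exact: h2|rewrite eqxx].
- by rewrite (h3 _ _ hij); have := edge_degree hij => hd; congr (if _ then _ else _); lia.
Qed.

Lemma hcomp_letter_rel l d v w : ok_letter l -> letter_rel edge W l v w ->
  letter_rel edge W l (hcomp d v) (hcomp (d + letter_shift l) w).
Proof.
case: l => t z; rewrite /ok_letter /letter_rel /letter_shift /= => ol [h1 h2].
case: t ol h1 h2 => ol h1 h2.
  by rewrite addr0; split=> h; apply: hcomp_omega_rel; auto.
split=> h.
  have -> : d + (Num.sg z - 2 * z) = d + 2 * `|z|%N%:Z - 1 by rewrite ltr0_sg //; lia.
  by apply: hcomp_diff_rel; auto.
have := hcomp_diff_rel (d + (Num.sg z - 2 * z)) (h2 h).
by have -> : d + (Num.sg z - 2 * z) + 2 * `|z|%N%:Z - 1 = d by rewrite gtr0_sg //; lia.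
Qed.

End Homogeneous.

(* t i is the reduction mod U of the image of T_i under a local map from the
   standard complex with parameters L. *)
Definition string_rep r (edge : 'I_r -> 'I_r -> nat -> bool) (W : 'M['F_2]_r)
    (o : 'I_r) n (L : nat -> letter) (t : nat -> 'rV['F_2]_r) : Prop :=
  [/\ cycles_mod edge (t 0%N), t 0%N 0 o = 1,
      forall i, (i < n.*2)%N -> letter_rel edge W (L i) (t i) (t i.+1)
    & omega_rel edge W (t n.*2) 0].

Definition word_degree (L : nat -> letter) i : int := \sum_(k < i) letter_shift (L k).

Lemma string_rep_homogeneous r (edge : 'I_r -> 'I_r -> nat -> bool)
    (W : 'M_r) (g : 'I_r -> int) o n L t :
  edge_system edge -> (forall i j k, edge i j k -> g j - 2 * k%:Z = g i - 1) ->
  (forall i j, W i j != 0 -> g i = g j) -> g o = 0 ->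
  (forall i, (i < n.*2)%N -> ok_letter (L i)) ->
  string_rep edge W o n L t -> exists t', string_rep edge W o n L t' /\
    forall i j, t' i 0 j != 0 -> g j = word_degree L i.
Proof.
move=> E gE gW go hL [h1 h2 h3 h4].
exists (fun i => hcomp g (word_degree L i) (t i)); split.
  split=> [i j k hij||i hi|].
  - by rewrite mxE (h1 _ _ _ hij) if_same.
  - by rewrite mxE go /word_degree big_ord0 eqxx.
  - rewrite [word_degree L i.+1]big_ord_recr.
    by apply: hcomp_letter_rel => //; [exact: hL|exact: h3].
  by rewrite -(hcomp0 g (word_degree L n.*2)); apply: hcomp_omega_rel.
by move=> i j; rewrite mxE; have [->|_] := eqVneq (g j) (word_degree L i); rewrite ?eqxx.
Qed.

(** The tower is the one basis vector [o] on no edge. A single word serves both strings: the vector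
    t is walked back in the complex, the functional phi in the transposed one, where every letter
    changes sign. *)
Lemma string_exists r (edge : 'I_r -> 'I_r -> nat -> bool) (W : 'M['F_2]_r) (o : 'I_r) :
  edge_system edge -> unit_edges edge *m W = W *m unit_edges edge ->
  (exists H, W *m W = H *m unit_edges edge + unit_edges edge *m H) ->
  (forall j k, ~~ edge o j k) -> (forall j k, ~~ edge j o k) ->
  (forall i, (forall j k, ~~ edge i j k) -> (forall j k, ~~ edge j i k) -> i = o) ->
  exists n L t t', [/\ forall i, (i < n.*2)%N -> ok_letter (L i) /\ (L i).1 = ~~ odd i,
    string_rep edge W o n L t &
    string_rep (fun j i => edge i j) W^T o n (opp_letter \o L) t'].
Proof.
move=> E WN W2 o1 o2 ouniq.
set K := cycles_mod edge; set Z := torsion_mod edge.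
have lin := letter_rel_lin edge W.
have KZ x : K x -> x 0 o = 0 -> Z x.
  move=> hK ho j hj; apply: contrapT => hn.
  have jo : j = o.
    apply: ouniq => l k; apply/negP => hl; last by apply: hn; exists l, k.
    by move: hj; rewrite (hK _ _ _ hl) eqxx.
  by move: hj; rewrite jo ho eqxx.
have Ko : K (delta_mx 0 o).
  move=> i j k hij; rewrite mxE eqxx /=; have [e|//] := eqVneq i o.
  by move: (o1 j k); rewrite -e hij.
have Zo x : Z x -> x 0 o = 0.
  move=> hZ; apply/eqP/negPn/negP => /hZ[i [k hk]].
  by move: (o2 i k); rewrite hk.
have tower x y : K x -> ~ Z x -> K y -> ~ Z y -> Z (x - y).
  move=> hx nx hy ny; apply: (KZ); first exact: (cycles_mod_sub edge).2.
  rewrite !mxE; have -> : x 0 o = 1 by apply: F2_neq0; apply/eqP => /(KZ _ hx).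
  have -> : y 0 o = 1 by apply: F2_neq0; apply/eqP => /(KZ _ hy).
  exact: subrr.
have KnZ : exists x, K x /\ ~ Z x.
  by exists (delta_mx 0 o); split=> // /Zo /eqP; rewrite mxE !eqxx oner_eq0.
have [w [t [vw ow ht ht0 hterm]]] := @live_word_ends _ (letter_rel edge W) lin
  (letter_rel_opp edge W) Z K (torsion_mod_sub edge)
  (letters_coarse E WN W2) (@letters_coarse0 _ edge W)
  (fun w vw _ => letters_extend_even E WN vw) (fun w vw _ => letters_extend_odd E WN vw)
  tower KnZ _ id (fun x y e => e).
have Asub := img_sub lin w (torsion_mod_sub edge).
have omega0 := omega_rel_lin edge W.
have [||phi [phiA phit]] := @F2_separation _
    (fun x => exists a s y,
       [/\ img (letter_rel edge W) Z w a, omega_rel edge W s y & x = a + y]) t.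
- split; first by exists 0, 0, 0; rewrite addr0; split=> //; [exact: Asub.1|exact: omega0.1].
  move=> _ _ [a [s [y [h1 h2 ->]]]] [a' [s' [y' [h1' h2' ->]]]].
  exists (a - a'), (s - s'), (y - y'); rewrite opprD addrACA; split=> //.
    exact: Asub.2.
  exact: omega0.2.
- case=> a [s [y [h1 h2 h3]]]; apply: (hterm s y); first by split.
  by rewrite h3 addrK.
have phiZ v : img (letter_rel edge W) Z w v -> v *m phi = 0.
  by move=> hv; apply: phiA; exists v, 0, 0; rewrite addr0; split=> //; exact: omega0.1.
(* Vanishing on im omega is the end condition of the dual string: the transposed omega kills phi. *)
have phiW : dual_rel (omega_rel edge W) 0 phi.
  move=> s y hs; rewrite mulmx0; apply/esym/phiA.
  by exists 0, s, y; rewrite add0r; split=> //; exact: Asub.1.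
have [psi [psiZ hpsi]] := dual_chain_ex lin (torsion_mod_sub edge) phiZ.
have [x [Kx hx]] := ht.
have x1 : x 0 o = 1.
  apply: F2_neq0; apply/eqP => /(KZ _ Kx) hZ; apply: (hterm 0 0).
    by split=> // _; exact: omega0.1.
  by rewrite subr0; exists x.
(* The start x differs from e_o by an element of Z, which psi kills, and psi(x) = phi(t) = 1. *)
have psi1 : psi o 0 = 1.
  have /psiZ : Z (delta_mx 0 o - x).
    apply: (KZ); first exact: (cycles_mod_sub edge).2.
    by rewrite !mxE x1 !eqxx subrr.
  rewrite mulmxBl (dual_chain_pairing hx hpsi) phit -rowE => /eqP.
  rewrite subr_eq0 => /eqP/matrixP/(_ 0 0).
  by rewrite !mxE.
have [T [T0 Tn hT]] := chain_nth hx.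
have [T' [T0' Tn' hT']] := chain_nth hpsi.
have wE : (size w)./2.*2 = size w by rewrite -[RHS]odd_double_half (negbTE ow).
exists (size w)./2, (fun i => nth letter0 w (size w - i.+1)), T, (fun i => (T' i)^T).
have hok i : (i < (size w)./2.*2)%N -> ok_letter (nth letter0 w (size w - i.+1)) /\
    (nth letter0 w (size w - i.+1)).1 = ~~ odd i.
  rewrite wE => hi; have [|h1 h2] := vw (size w - i.+1)%N; first by lia.
  by split=> //; rewrite h2 subKn.
split=> //; split; rewrite ?wE ?T0 ?Tn ?T0' ?Tn' //.
- by case: ht0 => + _; apply.
- move=> j i k hij; rewrite mxE.
  have /psiZ : Z (delta_mx 0 j).
    by move=> l; rewrite mxE eqxx /=; have [->|] := eqVneq l j; [exists i, k|rewrite eqxx].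
  by rewrite -rowE => /matrixP/(_ 0 0); rewrite !mxE.
- by rewrite mxE.
- move=> i hi; apply: letter_rel_dual => //; first exact: hT'.
  by have [] := hok i; rewrite ?wE.
- by rewrite -trmx0; apply: omega_rel_dual.
Qed.

(** * Lifting to F[U] *)

Lemma polyXn_inj (R : nzRingType) j k : 'X^j = 'X^k :> {poly R} -> j = k.
Proof. by move/(congr1 (fun p : {poly R} => size p)); rewrite !size_polyXn => -[]. Qed.

Section EdgesOfMatrix.
Variables (r : nat) (g : 'I_r -> int) (N : 'M[FU]_r).
Hypothesis N_graded : graded_mx g g (-1) N.
Hypothesis N_matching : matching N.
Hypothesis N_sq : N *m N = 0.

Definition edge_of (i j : 'I_r) (k : nat) : bool := N i j == 'X^k.

Lemma edge_of_neq0 i j k : edge_of i j k -> N i j != 0.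
Proof. by move/eqP ->; rewrite monic_neq0 ?monicXn. Qed.

Lemma edge_of_ex i j : N i j != 0 -> edge_of i j (size (N i j)).-1.
Proof. by move=> h; apply/eqP/(graded_mx_monomial N_graded). Qed.

Lemma edge_of_size i j k : edge_of i j k -> (size (N i j)).-1 = k.
Proof. by move/eqP ->; rewrite size_polyXn. Qed.

Lemma edge_of_degree i j k : edge_of i j k -> g j - 2 * k%:Z = g i - 1.
Proof. by move/eqP => h; apply: N_graded; rewrite h coefXn eqxx oner_neq0. Qed.

Lemma edge_system_of : edge_system edge_of.
Proof.
split.
- move=> i j k j' k' h h'; have e := (N_matching (edge_of_neq0 h)).1 _ (edge_of_neq0 h').
  by subst j'; split=> //; rewrite -(edge_of_size h) -(edge_of_size h').
- move=> i j k i' k' h h'; have e := (N_matching (edge_of_neq0 h)).2 _ (edge_of_neq0 h').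
  by subst i'; split=> //; rewrite -(edge_of_size h) -(edge_of_size h').
- move=> i j k l m h1 h2; have /matrixP/(_ i l) := N_sq; rewrite !mxE.
  rewrite (bigD1 j) //= big1 ?addr0 => [|p hp].
    rewrite (eqP h1) (eqP h2) -exprD => /eqP.
    by rewrite expf_eq0 polyX_eq0 andbF.
  apply/eqP; rewrite mulf_eq0; apply/orP; left; apply/negPn/negP => hip.
  by move: hp; rewrite ((N_matching (edge_of_neq0 h1)).1 _ hip) eqxx.
exists (\max_(p : 'I_r * 'I_r) size (N p.1 p.2))%N => i j k h.
apply: leq_trans (leq_bigmax (i, j)) => /=.
by rewrite (eqP h) size_polyXn.
Qed.

Lemma redU_unit_edges : redU N = unit_edges edge_of.
Proof.
apply/matrixP => i j; rewrite !mxE /=.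
have [h0|h] := eqVneq (N i j) 0.
  by rewrite /edge_of h0 coef0 eq_sym expr0 oner_eq0.
have /eqP h' := edge_of_ex h; rewrite /edge_of h' coefXn eq_sym.
congr ((_ : bool)%:R); apply/eqP/eqP => [->//|]; exact: polyXn_inj.
Qed.

(** On an edge from i to j of length s < b, take x_i = U^(b-s) w_j and y_j = w_j, possible because
    v_i = 0; if s >= b, take x_i = v_i and y_j = U^(s-b) v_i. Off the edges, x is v at i and y is
    0. *)
Lemma diff_rel_lift b v w d : diff_rel edge_of b v w ->
  (forall j, v 0 j != 0 -> g j = d) -> (forall j, w 0 j != 0 -> g j = d + 2 * b%:Z - 1) ->
  exists x y : 'rV[FU]_r, [/\ x *m N = 'X^b *: y, redU x = v, redU y = w,
    graded_mx (fun=> d) g 0 x & graded_mx (fun=> d + 2 * b%:Z - 1) g 0 y].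
Proof.
move=> [hv hw hvw] dv dw.
pose sz i j := (size (N i j)).-1.
have E := edge_system_of.
exists (\row_i if [pick j | (N i j != 0) && (sz i j < b)%N] is Some j
               then (w 0 j)%:P * 'X^(b - sz i j) else (v 0 i)%:P).
exists (\row_j if [pick i | N i j != 0] is Some i then
               if (sz i j < b)%N then (w 0 j)%:P else (v 0 i)%:P * 'X^(sz i j - b) else 0).
split.
- apply/rowP => j; rewrite !mxE; case: pickP => [i hi|h0]; last first.
    rewrite mulr0; apply: big1 => i _; move/negbFE/eqP: (h0 i) => ->; exact: mulr0.
  rewrite (bigD1 i) //= big1 ?addr0 => [|l hl]; last first.
    have [->|hlj] := eqVneq (N l j) 0; first by rewrite mulr0.
    by move: hl; rewrite ((N_matching hi).2 _ hlj) eqxx.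
  have /eqP eN := edge_of_ex hi; rewrite -/(sz i j) in eN.
  rewrite mxE; case: pickP => [j' /andP[hj' hs]|h0].
    have e := (N_matching hi).1 _ hj'; subst j'.
    rewrite hs eN -mulrA -exprD subnK ?(ltnW hs) //.
    exact: mulrC.
  have := h0 j; rewrite hi /= => hs; rewrite hs {1}eN [RHS]mulrC -mulrA -exprD subnK //.
  by rewrite leqNgt hs.
- apply/rowP => i; rewrite !mxE /=; case: pickP => [j /andP[hj hs]|_].
    rewrite (hv _ _ _ (edge_of_ex hj) hs) coefMXn ifT //; first by rewrite subn_gt0.
  by rewrite coefC.
- apply/rowP => j; rewrite !mxE /=; case: pickP => [i hi|h0].
    have eN := edge_of_ex hi; rewrite -/(sz i j) in eN.
    case: ltngtP => hs; first by rewrite coefC.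
      rewrite coefMXn subn_gt0 hs; apply/esym/eqP/negPn/negP => /hw[i' [k [hk hkb]]].
      by have [_ e] := edge_col E eN hk; move: hkb; rewrite e ltnS leqNgt hs.
    by rewrite hs subnn expr0 mulr1 coefC; apply/esym/hvw; rewrite -hs.
  rewrite coef0; apply/esym/eqP/negPn/negP => /hw[i [k [hk _]]].
  by move: (h0 i); rewrite (edge_of_neq0 hk).
- move=> a i k; rewrite mxE; case: pickP => [j /andP[hj hs]|_].
    rewrite coefMXn; case: ltnP => hk; first by rewrite eqxx.
    rewrite coefC; case: (_ =P 0%N) => hk'; last by rewrite /= ?eqxx.
    by move/dw; have := edge_of_degree (edge_of_ex hj); rewrite -/(sz i j); lia.
  by rewrite coefC; case: (_ =P 0%N) => hk; [move/dv; lia|rewrite /= ?eqxx].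
move=> a j k; rewrite mxE; case: pickP => [i hi|_]; last by rewrite coef0 eqxx.
have := edge_of_degree (edge_of_ex hi); rewrite -/(sz i j).
case: ifP => hs.
  by rewrite coefC; case: (_ =P 0%N) => hk; [move=> _ /dw; lia|rewrite /= ?eqxx].
rewrite coefMXn; case: ltnP => hk; first by rewrite eqxx.
rewrite coefC; case: (_ =P 0%N) => hk'; last by rewrite /= ?eqxx.
by move=> h1 /dv; lia.
Qed.

End EdgesOfMatrix.

Lemma edge_of_tr r (N : 'M[FU]_r) : edge_of N^T = fun j i => edge_of N i j.
Proof. by apply/funext => i; apply/funext => j; apply/funext => k; rewrite /edge_of mxE. Qed.

(** * Rows and duals of the standard matrices *)

Section StandardRows.
Variables (n : nat) (a b : 'I_n -> int) (r : nat) (F : 'M[FU]_(n.*2.+1, r)).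

Lemma std_index (P : 'I_n.*2.+1 -> Prop) :
  P (stdT n 0) -> (forall k : 'I_n, P (stdT n k.*2.+1) /\ P (stdT n k.*2.+2)) ->
  forall i, P i.
Proof.
move=> h0 h i; rewrite -[i]inord_val -/(stdT n i).
case: i => [[|i] hi] //=.
have hk : (i./2 < n)%N by lia.
have [h1 h2] := h (Ordinal hk).
have [ho|ho] := boolP (odd i).
  by have -> : i = (i./2).*2.+1 by lia.
by have -> : i = (i./2).*2 by lia.
Qed.

Lemma stdT_eqE i j : (i <= n.*2)%N -> (j <= n.*2)%N -> (stdT n i == stdT n j) = (i == j).
Proof. by move=> hi hj; rewrite -val_eqE /= !inordK. Qed.

Lemma row_delta_mul i (p q : 'I_n.*2.+1) :
  row i (delta_mx p q *m F) = if i == p then row q F else 0.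
Proof.
rewrite row_mul; case: (eqVneq i p) => [->|hip].
  by rewrite !rowE mul_delta_mx.
by rewrite rowE mul_delta_mx_0 // mul0mx.
Qed.

Lemma row_std_diff0 : row (stdT n 0) (std_diff_mx b *m F) = 0.
Proof.
rewrite mulmx_suml linear_sum big1 // => k _ /=.
rewrite -scalemxAl linearZ /=; case: ifP => _; rewrite row_delta_mul stdT_eqE //=;
  by rewrite ?scaler0 //; have := ltn_ord k; lia.
Qed.

Lemma row_std_diff1 (k : 'I_n) : row (stdT n k.*2.+1) (std_diff_mx b *m F) =
  if b k < 0 then 'X^`|b k| *: row (stdT n k.*2.+2) F else 0.
Proof.
have hk := ltn_ord k; rewrite mulmx_suml linear_sum (bigD1 k) //= big1 => [|l hl].
  rewrite addr0 -scalemxAl linearZ /=; case: ifP => _; rewrite row_delta_mul stdT_eqE; try lia.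
    by rewrite eqxx.
  by rewrite ifF ?scaler0 //; lia.
have hl' := ltn_ord l; have hlk : l != k :> nat by [].
by rewrite -scalemxAl linearZ /=; case: ifP => _; rewrite row_delta_mul stdT_eqE; try lia;
  rewrite ifF ?scaler0 //; lia.
Qed.

Lemma row_std_diff2 (k : 'I_n) : row (stdT n k.*2.+2) (std_diff_mx b *m F) =
  if b k < 0 then 0 else 'X^`|b k| *: row (stdT n k.*2.+1) F.
Proof.
have hk := ltn_ord k; rewrite mulmx_suml linear_sum (bigD1 k) //= big1 => [|l hl].
  rewrite addr0 -scalemxAl linearZ /=; case: ifP => _; rewrite row_delta_mul stdT_eqE; try lia.
    by rewrite ifF ?scaler0 //; lia.
  by rewrite eqxx.
have hl' := ltn_ord l; have hlk : l != k :> nat by [].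
by rewrite -scalemxAl linearZ /=; case: ifP => _; rewrite row_delta_mul stdT_eqE; try lia;
  rewrite ifF ?scaler0 //; lia.
Qed.

Lemma row_std_omega0 (k : 'I_n) : row (stdT n k.*2) (std_omega_mx a *m F) =
  if a k == -1 then row (stdT n k.*2.+1) F else 0.
Proof.
have hk := ltn_ord k; rewrite mulmx_suml linear_sum (bigD1 k) //= big1 => [|l hl].
  rewrite addr0; case: ifP => _; rewrite row_delta_mul stdT_eqE; try lia.
    by rewrite eqxx.
  by rewrite ifF //; lia.
have hl' := ltn_ord l; have hlk : l != k :> nat by [].
by case: ifP => _; rewrite row_delta_mul stdT_eqE; try lia; rewrite ifF //; lia.
Qed.

Lemma row_std_omega1 (k : 'I_n) : row (stdT n k.*2.+1) (std_omega_mx a *m F) =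
  if a k == -1 then 0 else row (stdT n k.*2) F.
Proof.
have hk := ltn_ord k; rewrite mulmx_suml linear_sum (bigD1 k) //= big1 => [|l hl].
  rewrite addr0; case: ifP => _; rewrite row_delta_mul stdT_eqE; try lia.
    by rewrite ifF //; lia.
  by rewrite eqxx.
have hl' := ltn_ord l; have hlk : l != k :> nat by [].
by case: ifP => _; rewrite row_delta_mul stdT_eqE; try lia; rewrite ifF //; lia.
Qed.

Lemma row_std_omega_last : row (stdT n n.*2) (std_omega_mx a *m F) = 0.
Proof.
rewrite mulmx_suml linear_sum big1 // => l _; have hl := ltn_ord l.
by rewrite /=; case: ifP => _; rewrite row_delta_mul stdT_eqE; try lia; rewrite ifF //; lia.
Qed.

End StandardRows.

(** With [std_omega_mx_tr]: the dual of a standard complex is the standard complex of the negated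
    parameters. So [string_realization] can serve both directions. *)
Lemma std_diff_mx_tr n (b : 'I_n -> int) : (forall k, b k != 0) ->
  std_diff_mx (fun k => - b k) = (std_diff_mx b)^T.
Proof.
move=> hb; rewrite linear_sum; apply: eq_bigr => k _ /=; rewrite linearZ /= abszN oppr_lt0.
by case: (ltgtP (b k) 0) (hb k) => h hk /=; rewrite ?trmx_delta //; move: hk; rewrite ?h ?eqxx.
Qed.

Lemma std_omega_mx_tr n (a : 'I_n -> int) : (forall k, a k = -1 \/ a k = 1) ->
  std_omega_mx (fun k => - a k) = (std_omega_mx a)^T.
Proof.
move=> ha; rewrite linear_sum; apply: eq_bigr => k _ /=.
by case: (ha k) => ->; rewrite ?trmx_delta.
Qed.

Lemma gdeg_std n (b : 'I_n -> int) (L : nat -> letter) :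
  (forall i, (i < n.*2)%N -> (L i).1 = ~~ odd i) ->
  (forall k : 'I_n, b k = (L k.*2.+1).2) ->
  forall i, (i <= n.*2)%N -> gdeg (stdT n i : 'I_(grank (std_module b))) = word_degree L i.
Proof.
move=> hL hb; elim=> [|i IH] hi.
  by rewrite /word_degree big_ord0 /= big_pred0 // => k; rewrite inordK.
rewrite /word_degree big_ord_recr -/(word_degree L i) -IH; last exact: ltnW.
rewrite /= !inordK ?ltnS // ?(ltnW hi) //.
rewrite /letter_shift /= hL //; have [oi|oi] := boolP (odd i) => /=.
  have hk : (i./2 < n)%N by lia.
  rewrite (bigD1 (Ordinal hk)) /=; last by lia.
  rewrite addrC; congr (_ + _); last first.
    by rewrite hb /=; have -> : (i./2.*2.+1 = i)%N by lia.
  by apply: eq_bigl => l; rewrite -val_eqE /=; lia.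
by rewrite addr0; apply: eq_bigl => l; lia.
Qed.

Lemma F2mx_double m n (A : 'M['F_2]_(m, n)) : A + A = 0.
Proof. by rewrite -{2}[A]F2mx_oppr subrr. Qed.

Lemma redU_polyC m n (A : 'M['F_2]_(m, n)) : redU (map_mx polyC A) = A.
Proof. by apply/matrixP => i j; rewrite !mxE /= coefC. Qed.

Lemma std_index_omega n (P : 'I_n.*2.+1 -> Prop) :
  (forall k : 'I_n, P (stdT n k.*2) /\ P (stdT n k.*2.+1)) -> P (stdT n n.*2) ->
  forall i, P i.
Proof.
move=> h hn; apply: std_index => [|k].
  by case: n P h hn => [|n] P h hn //; exact: (h ord0).1.
split; first exact: (h k).2.
have [hk|hk] := ltnP k.+1 n; first exact: (h (Ordinal hk)).1.
by have -> : k.*2.+2 = n.*2 by have := ltn_ord k; lia.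
Qed.

Section Realization.
Variables (r : nat) (g : 'I_r -> int) (N W : 'M[FU]_r) (o : 'I_r).
Hypothesis N_graded : graded_mx g g (-1) N.
Hypothesis N_matching : matching N.
Hypothesis N_sq : N *m N = 0.
Local Notation N0 := (unit_edges (edge_of N)).
Local Notation W0 := (redU W).
Hypothesis W_chain : N0 *m W0 = W0 *m N0.
Hypothesis W_sq : exists H, W0 *m W0 = H *m N0 + N0 *m H.

Lemma omega_rel_defect v w : omega_rel (edge_of N) W0 v w ->
  torsion_below (edge_of N) 1 (w + v *m W0).
Proof.
case=> _ _ [u ->]; apply/torsion_below1P; first exact: edge_system_of.
by exists u; rewrite addrAC F2mx_double add0r.
Qed.

Variables (n : nat) (a b : 'I_n -> int) (L : nat -> letter) (t : nat -> 'rV['F_2]_r).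
Hypothesis a_sign : forall k, a k = -1 \/ a k = 1.
Hypothesis b_neq0 : forall k, b k != 0.
Hypothesis aE : forall k : 'I_n, L k.*2 = (true, a k).
Hypothesis bE : forall k : 'I_n, L k.*2.+1 = (false, b k).
Hypothesis t_rep : string_rep (edge_of N) W0 o n L t.
Hypothesis t_degree : forall i j, t i 0 j != 0 -> g j = word_degree L i.

(** The pairs (T_{2k+1}, T_{2k+2}) are disjoint, so their lifts can be chosen independently. *)
Lemma lifted_pairs : exists p : nat -> 'rV[FU]_r * 'rV[FU]_r, forall k : 'I_n,
  [/\ if b k < 0 then (p k).1 *m N = 'X^`|b k| *: (p k).2
      else (p k).2 *m N = 'X^`|b k| *: (p k).1,
     redU (p k).1 = t k.*2.+1, redU (p k).2 = t k.*2.+2,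
     graded_mx (fun=> word_degree L k.*2.+1) g 0 (p k).1
   & graded_mx (fun=> word_degree L k.*2.+2) g 0 (p k).2].
Proof.
suff /choice[p hp] : forall k : nat, exists p : 'rV[FU]_r * 'rV[FU]_r, forall hk : (k < n)%N,
  let z := b (Ordinal hk) in
  [/\ if z < 0 then p.1 *m N = 'X^`|z| *: p.2 else p.2 *m N = 'X^`|z| *: p.1,
     redU p.1 = t k.*2.+1, redU p.2 = t k.*2.+2,
     graded_mx (fun=> word_degree L k.*2.+1) g 0 p.1
   & graded_mx (fun=> word_degree L k.*2.+2) g 0 p.2].
  exists p => k; have := hp k (ltn_ord k); rewrite /=.
  by have -> : Ordinal (ltn_ord k) = k by apply: val_inj.
move=> k; have [hk|hk] := EM (k < n)%N; last by exists (0, 0) => hk'; case: hk.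
set k' := Ordinal hk; have [_ _ ht _] := t_rep.
have hd : word_degree L k.*2.+2 = word_degree L k.*2.+1 + (Num.sg (b k') - 2 * b k').
  rewrite {1}/word_degree big_ord_recr -/(word_degree L _) /= (bE k') //.
have [h1 h2] : letter_rel (edge_of N) W0 (false, b k') (t k.*2.+1) (t k.*2.+2).
  by rewrite -(bE k'); apply: ht => /=; lia.
have [hb|hb] := ltP (b k') 0.
  have hd' : word_degree L k.*2.+2 = word_degree L k.*2.+1 + 2 * `|b k'|%N%:Z - 1.
    by rewrite hd ltr0_sg //; lia.
  have [|x [y [h3 h4 h5 h6 h7]]] :=
      diff_rel_lift N_graded N_matching N_sq (h1 hb) (t_degree (i := _)).
    by move=> j /t_degree; rewrite hd'.
  exists (x, y) => hk'; have -> : Ordinal hk' = k' by apply: val_inj.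
  by rewrite /= hb hd'.
have hb' : 0 < b k' by rewrite lt_def b_neq0.
have hd' : word_degree L k.*2.+1 = word_degree L k.*2.+2 + 2 * `|b k'|%N%:Z - 1.
  by rewrite hd gtr0_sg //; lia.
have [|x [y [h3 h4 h5 h6 h7]]] :=
    diff_rel_lift N_graded N_matching N_sq (h2 hb') (t_degree (i := _)).
  by move=> j /t_degree; rewrite hd'.
exists (y, x) => hk'; have -> : Ordinal hk' = k' by apply: val_inj.
by rewrite /= ltNge hb /= hd'.
Qed.

(** In the last clause the failure of F to commute with omega consists, mod U, of boundaries, so the
    projection N0^T N0 reproduces it and the sum cancels in characteristic 2. This failure times
    N0^T is the homotopy used later. *)
Lemma string_realization : exists F : 'M[FU]_(n.*2.+1, r),
  [/\ F *m N = std_diff_mx b *m F,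
      graded_mx (@gdeg (std_module b)) g 0 F,
      redU F ord0 o = 1
    & redU ((std_omega_mx a *m F + F *m W) *m (1%:M + map_mx polyC N0^T *m N)) = 0].
Proof.
have E := edge_system_of N_matching N_sq.
have [p hp] := lifted_pairs; have [t0 to ht tn] := t_rep.
pose T i := if i is 0%N then map_mx polyC (t 0%N)
            else if odd i then (p i./2).1 else (p i./2.-1).2.
have T1 k : T k.*2.+1 = (p k).1 by rewrite /T /= odd_double uphalf_double.
have T2 k : T k.*2.+2 = (p k).2 by rewrite /T /= negbK odd_double doubleK.
pose F : 'M[FU]_(n.*2.+1, r) := \matrix_(i < n.*2.+1) T i.
have rowF i : (i <= n.*2)%N -> row (stdT n i) F = T i.
  by move=> hi; rewrite rowK inordK.
have k1 (k : 'I_n) : (k.*2.+1 <= n.*2)%N by have := ltn_ord k; lia.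
have k2 (k : 'I_n) : (k.*2.+2 <= n.*2)%N by have := ltn_ord k; lia.
have redT i : (i <= n.*2)%N -> redU (row (stdT n i) F) = t i.
  move=> hi; rewrite rowF //; case: i hi => [_|i hi]; first exact: redU_polyC.
  have hk : (i./2 < n)%N by lia.
  have [_ h1 h2 _ _] := hp (Ordinal hk).
  have [oi|oi] := boolP (odd i).
    have -> : i = (i./2).*2.+1 by lia.
    by rewrite T2.
  have -> : i = (i./2).*2 by lia.
  by rewrite T1.
have L1 i : (i < n.*2)%N -> (L i).1 = ~~ odd i.
  move=> hi; have hk : (i./2 < n)%N by lia.
  have [oi|oi] := boolP (odd i).
    have e : i = (Ordinal hk).*2.+1 by rewrite /=; lia.
    by rewrite [in LHS]e bE.
  have e : i = (Ordinal hk).*2 by rewrite /=; lia.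
  by rewrite [in LHS]e aE.
exists F; split.
- apply/row_matrixP; apply: std_index => [|k].
    rewrite row_std_diff0 row_mul rowF //=; apply/rowP => j; rewrite !mxE.
    apply: big1 => i _; rewrite mxE; have [->|h] := eqVneq (N i j) 0; first exact: mulr0.
    by rewrite (t0 _ _ _ (edge_of_ex N_graded h)) polyC0 mul0r.
  have [hpk _ _ _ _] := hp k.
  rewrite row_std_diff1 row_std_diff2 !row_mul !rowF // T1 T2.
  (* The target of the edge is a cycle, because U^|b| times it is a boundary. *)
  case: ifP hpk => _ hpk; split=> //; apply: (@scaleXn_eq0 _ _ `|b k|);
    by rewrite scalemxAl -hpk -mulmxA N_sq mulmx0.
- move=> i j m; rewrite mxE.
  have hi : (i <= n.*2)%N by rewrite -ltnS.
  have -> : gdeg (i : 'I_(grank (std_module b))) = word_degree L i.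
    rewrite -(gdeg_std (b := b) (n := n)) //; last by move=> k; rewrite bE.
    by rewrite /stdT inord_val.
  case: (i : nat) hi => [|l] hl /=.
    rewrite mxE coefC; case: (m =P 0%N) => [->|_]; last by rewrite eqxx.
    by move/t_degree; lia.
  have hk : (l./2 < n)%N by lia.
  have [_ _ _ h1 h2] := hp (Ordinal hk).
  have [ol|ol] /= := boolP (odd l).
    have -> : (uphalf l).-1 = l./2 by lia.
    by have {2}-> : l = (l./2).*2.+1 by [lia]; move/h2.
  have -> : uphalf l = l./2 by lia.
  by have {2}-> : l = (l./2).*2 by [lia]; move/h1.
- have -> : ord0 = stdT n 0 by apply: val_inj; rewrite /= inordK.
  by rewrite -to -redT // !mxE.
rewrite map_mxM; have -> : redU (1%:M + map_mx polyC N0^T *m N) = 1%:M + N0^T *m N0.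
  by rewrite map_mxD map_mx1 map_mxM redU_polyC (redU_unit_edges N_graded).
apply/row_matrixP => i; rewrite row_mul row0 mulmxDr mulmx1 mulmxA.
suff /(torsion_below1_proj E) -> : torsion_below (edge_of N) 1
    (row i (redU (std_omega_mx a *m F + F *m W))) by exact: F2mx_double.
have rowG m : (m <= n.*2)%N -> row (stdT n m) (redU (std_omega_mx a *m F + F *m W)) =
    redU (row (stdT n m) (std_omega_mx a *m F)) + t m *m W0.
  move=> hm; rewrite -map_row.
  have -> : row (stdT n m) (std_omega_mx a *m F + F *m W) =
      row (stdT n m) (std_omega_mx a *m F) + row (stdT n m) (F *m W) by exact: linearD.
  by rewrite map_mxD (row_mul _ F) map_mxM redT.
move: i; apply: std_index_omega => [k|]; last first.
  by rewrite rowG // row_std_omega_last map_mx0; apply: omega_rel_defect.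
have hk := ltn_ord k.
rewrite !rowG // ?row_std_omega0 ?row_std_omega1; try lia.
have [h1 h2] : letter_rel (edge_of N) W0 (true, a k) (t k.*2) (t k.*2.+1).
  by rewrite -aE; apply: ht; lia.
(* At the source of the omega-arrow the relation itself applies; at its target the standard omega is
   0, and [omega_rel_comp] gives the same up to boundaries. *)
case: (a_sign k) h1 h2 => -> h1 h2;
  [rewrite eqxx|rewrite (_ : (1 == -1 :> int) = false) //]; rewrite map_mx0 redT; try lia.
  have {}h1 := h1 isT; split; first exact: omega_rel_defect.
  by apply: omega_rel_defect; apply: (omega_rel_comp W_chain W_sq h1).
have {}h2 := h2 isT; split; last exact: omega_rel_defect.
by apply: omega_rel_defect; apply: (omega_rel_comp W_chain W_sq h2).
Qed.

End Realization.

(** * The tower in homology *)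

Lemma homology_class_eq0 (C : complex) (z : Defs.cycle C) :
  homology_class C z = 0 <-> exists y, diff C y = \val z.
Proof.
rewrite -(linear0 (homology_class C)); split.
  by move/quotmod_classP/asboolP; rewrite subr0.
by move=> h; apply/quotmod_classP/asboolP; rewrite subr0.
Qed.

Lemma loc_frac_ex (M : lmodType FU) (x : loc M) : exists m k, x = loc_frac m k.
Proof. by elim/loc_frac_ind: x => m k; exists m, k. Qed.

Lemma homology_class_surj (C : complex) (h : homology C) :
  exists z, h = homology_class C z.
Proof. by exists (repr (h : quotmod (@is_boundary C))); rewrite [RHS]quotmod_classK. Qed.

(* e is the coordinate along the F[U]-tower of H_*(C) generated by z. *)
Definition tower (C : complex) (e : C -> FU) (z : C) : Prop :=
  [/\ forall c x y, e (c *: x + y) = c * e x + e y,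
      forall x, e (diff C x) = 0, diff C z = 0, e z = 1
    & exists k, forall x, diff C x = 0 -> e x = 0 -> exists y, diff C y = 'X^k *: x].

Lemma polyXnM_eq0 (p : FU) k : 'X^k * p = 0 -> p = 0.
Proof. by move/eqP; rewrite mulf_eq0 expf_eq0 polyX_eq0 andbF => /eqP. Qed.

(** Up to U-torsion every cycle is its tower coordinate times the tower generator, and f preserves
    this coordinate. *)
Lemma loc_map_bijective (C D : complex) (f : chain_map C D) eC zC eD zD :
  @tower C eC zC -> @tower D eD zD -> eD (f zC) = 1 ->
  bijective (loc_map (homology_map f)).
Proof.
move=> [eC_lin eC_diff zC_cycle eC1 [k hk]] [eD_lin eD_diff _ _ [l hl]] ef.
have eD0 : eD 0 = 0 by rewrite -(linear0 (diff D)) eD_diff.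
have eDZ c x : eD (c *: x) = c * eD x by rewrite -[c *: x]addr0 eD_lin eD0 addr0.
have eC0 : eC 0 = 0 by rewrite -(linear0 (diff C)) eC_diff.
have eCB c x y : eC (y - c *: x) = eC y - c * eC x.
  by rewrite addrC -scaleNr eC_lin mulNr addrC.
have eDB c x y : eD (y - c *: x) = eD y - c * eD x.
  by rewrite addrC -scaleNr eD_lin mulNr addrC.
(* x - e(x) z is a cycle of coordinate 0, so a U-power multiple of it is a boundary, and so is its
   image under f. *)
have efE x : diff C x = 0 -> eD (f x) = eC x.
  move=> hx; have [||y hy] := hk (x - eC x *: zC).
  - by rewrite linearB linearZ /= hx zC_cycle scaler0 subr0.
  - by rewrite eCB eC1 mulr1 subrr.
  have := congr1 (fun v => eD (f v)) hy.
  rewrite /= chain_comm eD_diff linearZ /= eDZ linearB linearZ /= eDB ef mulr1.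
  by move/esym/polyXnM_eq0/eqP; rewrite subr_eq0 => /eqP.
have ker x : loc_map (homology_map f) x = 0 -> x = 0.
  elim/loc_frac_ind: x => h m; rewrite loc_mapE => /loc_frac_eq0[j].
  have [z ->] := homology_class_surj h.
  rewrite /= homology_mapE -linearZ /= => /homology_class_eq0[y /= hy].
  have hz : diff C (\val z) = 0 by apply/eqP; exact: (valP z).
  have [|y' hy'] := hk (\val z) hz.
    by rewrite -efE //; apply: (@polyXnM_eq0 _ j); rewrite -eDZ -hy eD_diff.
  apply/loc_frac_eq0; exists k; rewrite -linearZ; apply/homology_class_eq0.
  by exists y'.
have inj : injective (loc_map (homology_map f)) by apply: raddf_inj.
have surj y : exists x, loc_map (homology_map f) x = y.
  elim/loc_frac_ind: y => h m; have [w ->] := homology_class_surj h.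
  have hzC : is_cycle zC by apply/eqP.
  pose z : Defs.cycle C := Sub zC hzC.
  exists (loc_frac (eD (\val w) *: homology_class C z) m); rewrite loc_mapE linearZ /=.
  have hw : diff D (\val w) = 0 by apply/eqP; exact: (valP w).
  have [||y hy] := hl (\val w - eD (\val w) *: f zC).
  - by rewrite linearB linearZ /= hw -chain_comm zC_cycle linear0 scaler0 subr0.
  - by rewrite eDB ef mulr1 subrr.
  apply/loc_fracP; exists l; apply/esym/eqP; rewrite homology_mapE -subr_eq0 -scalerBr.
  rewrite -linearZ -linearB -linearZ; apply/eqP/homology_class_eq0.
  by exists ('X^m *: y); rewrite linearZ /= hy scalerA -exprD addnC.
have [inv hinv] := choice surj.
by exists inv => // x; apply: inj; rewrite hinv.
Qed.

Lemma lin1_mxE m n (f : {linear 'rV[FU]_m -> 'rV[FU]_n}) (x : 'rV_m) : x *m lin1_mx f = f x.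
Proof. exact: mul_rV_lin1. Qed.

Lemma in_imU_redU (M N : graded_free) (A : 'M[FU]_(grank M, grank N)) :
  (@in_imU M N (fun x => (x : 'rV_(grank M)) *m A)) <-> redU A = 0.
Proof.
split=> [h|h x].
  apply/matrixP => i j; have [y] := h (delta_mx 0 i : 'rV_(grank M)).
  rewrite /= -rowE => /matrixP/(_ 0 j); rewrite !mxE /= => ->.
  by rewrite coefXM.
exists ((x : 'rV_(grank M)) *m map_mx (drop_poly 1) A).
rewrite [RHS]scalemxAr; congr (_ *m _); apply/matrixP => i j; rewrite !mxE.
rewrite -{1}(@drop_polyK 1 (A i j)) // => -[|m] // _.
by move/matrixP/(_ i j): h; rewrite !mxE.
Qed.

(** * Homology read off from the Smith form *)

Section SmithComplex.
Variables (C : complex).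
Local Notation r := (grank C).
Local Notation g := (@gdeg C).
Local Notation D := (lin1_mx (diff C : {linear 'rV[FU]_r -> 'rV[FU]_r})).
Variables (P Q : 'M[FU]_r).
Hypothesis P_graded : graded_mx g g 0 P.
Hypothesis Q_graded : graded_mx g g 0 Q.
Hypothesis PQ : P *m Q = 1%:M.
Hypothesis QP : Q *m P = 1%:M.
Let N := P *m D *m Q.
Hypothesis N_matching : matching N.

Lemma complex_diffE (x : C) : diff C x = (x : 'rV_r) *m D.
Proof. by rewrite lin1_mxE. Qed.

Lemma complex_mx_sq : D *m D = 0.
Proof.
apply/row_matrixP => i; rewrite row_mul row0 rowE lin1_mxE.
by rewrite -[_ *m D]complex_diffE diff_diff.
Qed.

Lemma smith_graded : graded_mx g g (-1) N.
Proof.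
have gD : graded_mx g g (-1) D := of_degree_graded (@diff_degree C).
by apply: (graded_mxM (graded_mxM P_graded gD erefl) Q_graded); lia.
Qed.

Lemma smith_sq : N *m N = 0.
Proof.
by rewrite /N !mulmxA -(mulmxA (P *m D)) QP mulmx1 -(mulmxA P) complex_mx_sq mulmx0 mul0mx.
Qed.

Lemma smith_rowE : P *m D = N *m P.
Proof. by rewrite /N -!mulmxA QP mulmx1. Qed.

Lemma smith_colE : D *m Q = Q *m N.
Proof. by rewrite /N !mulmxA QP mul1mx. Qed.

Definition free_index (i : 'I_r) : Prop := forall j, N i j = 0 /\ N j i = 0.

Let coord (i : 'I_r) (x : C) : FU := ((x : 'rV_r) *m Q) 0 i.

(** In Smith coordinates such a cycle is supported on targets of edges, and U^b makes each of these
    a boundary once b exceeds all edge lengths. *)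
Lemma smith_torsion : exists k, forall x : C, diff C x = 0 ->
  (forall i, free_index i -> coord i x = 0) -> exists y, diff C y = 'X^k *: x.
Proof.
have E := edge_system_of N_matching smith_sq.
have [b hb] := edge_bound E; exists b => x hx h0.
pose y := (x : 'rV_r) *m Q.
have yN : y *m N = 0.
  by rewrite -mulmxA -smith_colE mulmxA -complex_diffE hx mul0mx.
pose u : 'rV[FU]_r := \row_i (if [pick j | N i j != 0] is Some j
  then y 0 j * 'X^(b - (size (N i j)).-1) else 0).
have uN : u *m N = 'X^b *: y.
  apply/rowP => j; rewrite mxE [RHS]mxE.
  have [[i hi]|hn] := EM (exists i, N i j != 0).
    rewrite (bigD1 i) //= big1 ?addr0 => [|l hl]; last first.
      have [->|hlj] := eqVneq (N l j) 0; first by rewrite mulr0.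
      by move: hl; rewrite ((N_matching hi).2 _ hlj) eqxx.
    rewrite mxE; case: pickP => [j' hj'|/(_ j)]; last by rewrite hi.
    have -> := (N_matching hi).1 _ hj'.
    have he := edge_of_ex smith_graded hi.
    rewrite {2}(eqP he) -mulrA -exprD subnK; first exact: mulrC.
    exact: ltnW (hb _ _ _ he).
  have col0 i : N i j = 0 by apply/eqP/negPn/negP => h; apply: hn; exists i.
  rewrite big1 => [|i _]; last by rewrite col0 mulr0.
  suff -> : y 0 j = 0 by rewrite mulr0.
  have [[l hl]|hnl] := EM (exists l, N j l != 0); last first.
    apply: h0 => l; split=> //; apply/eqP/negPn/negP => h; apply: hnl; by exists l.
  move/rowP/(_ l): yN; rewrite mxE (bigD1 j) //= big1 ?addr0 => [|m hm]; last first.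
    have [->|hml] := eqVneq (N m l) 0; first by rewrite mulr0.
    by move: hm; rewrite ((N_matching hl).2 _ hml) eqxx.
  by rewrite [RHS]mxE => /eqP; rewrite mulf_eq0 (negbTE hl) orbF => /eqP.
exists (u *m P : C); rewrite complex_diffE -mulmxA smith_rowE mulmxA uN.
by rewrite -scalemxAl /y -mulmxA QP mulmx1.
Qed.

Lemma free_coord_diff i x : free_index i -> coord i (diff C x) = 0.
Proof.
move=> hi; rewrite /coord complex_diffE -mulmxA smith_colE mulmxA mxE.
by apply: big1 => j _; rewrite (hi j).2 mulr0.
Qed.

Lemma free_row_cycle i : free_index i -> diff C (row i P : C) = 0.
Proof.
move=> hi; rewrite complex_diffE -row_mul smith_rowE row_mul.
by have -> : row i N = 0; [apply/rowP => j; rewrite mxE [RHS]mxE (hi j).1|rewrite mul0mx].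
Qed.

Lemma coord_row i j : coord i (row j P : C) = (j == i)%:R.
Proof. by rewrite /coord -row_mul PQ !mxE. Qed.

Lemma coord_lin i c (x y : C) : coord i (c *: x + y) = c * coord i x + coord i y.
Proof. by rewrite /coord mulmxDl -scalemxAl !mxE. Qed.

Lemma smith_tower o : free_index o -> (forall i, free_index i -> i = o) ->
  tower (coord o) (row o P : C).
Proof.
move=> ho uniq; have [k hk] := smith_torsion; split.
- exact: coord_lin.
- by move=> x; exact: free_coord_diff.
- exact: free_row_cycle.
- by rewrite coord_row eqxx.
- by exists k => x hx hx0; apply: hk => // i /uniq ->.
Qed.

End SmithComplex.

Section TowerIndex.
Variable C : almost_iota_complex.
Local Notation r := (grank C).
Local Notation g := (@gdeg C).
Local Notation D := (lin1_mx (diff C : {linear 'rV[FU]_r -> 'rV[FU]_r})).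
Variables (P Q : 'M[FU]_r).
Hypothesis P_graded : graded_mx g g 0 P.
Hypothesis Q_graded : graded_mx g g 0 Q.
Hypothesis PQ : P *m Q = 1%:M.
Hypothesis QP : Q *m P = 1%:M.
Hypothesis N_matching : matching (P *m D *m Q).
Local Notation free_index := (@free_index C P Q).

Let coord (i : 'I_r) (x : C) : FU := ((x : 'rV_r) *m Q) 0 i.

Let free_cycle i (hi : free_index i) : Defs.cycle C :=
  Sub (row i P : C) (introT eqP (free_row_cycle QP hi)).

Let cls := homology_class C.

Let coord_torsion i (hi : free_index i) j (z : Defs.cycle C) :
  'X^j *: cls z = 0 -> coord i (\val z) = 0.
Proof.
rewrite /cls -linearZ => /homology_class_eq0[y /(congr1 (coord i))].
have -> : coord i (diff C y) = 0 := free_coord_diff QP y hi.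
by rewrite /coord -scalemxAl mxE => /esym/polyXnM_eq0.
Qed.

(** Otherwise all homology would be U-torsion and its localization zero. *)
Lemma free_index_exists : exists o, free_index o.
Proof.
apply: contrapT => hn; have [phi [psi psiK phiK]] := loc_homology_iso C.
have [k hk] := smith_torsion P_graded Q_graded QP N_matching.
have h0 : psi (loc_frac (1 : FU^o) 0) = 0.
  elim/loc_frac_ind: (psi _) => h m; have [z ->] := homology_class_surj h.
  have [||y hy] := hk (\val z); first by apply/eqP; exact: (valP z).
    by move=> i hi; case: hn; exists i.
  by apply/loc_frac_eq0; exists k; rewrite -linearZ; apply/homology_class_eq0; exists y.
have := phiK (loc_frac (1 : FU^o) 0); rewrite h0 linear0 => /esym/loc_frac_eq0[j].
by move/(@polyXnM_eq0 1 j)/eqP; rewrite oner_eq0.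
Qed.

Lemma free_index_unique i j : free_index i -> free_index j -> i = j.
Proof.
move=> hi hj; apply/eqP/negPn/negP => hij.
have [phi [psi psiK phiK]] := loc_homology_iso C.
have [p [k hp]] := loc_frac_ex (phi (loc_frac (cls (free_cycle hi)) 0)).
have [q [l hq]] := loc_frac_ex (phi (loc_frac (cls (free_cycle hj)) 0)).
(* The two tower classes go to p / U^k and q / U^l; cross-multiplication gives a relation between
   them, and the coordinates at i and j force its coefficients to vanish. *)
pose A : FU := 'X^k * q; pose B : FU := 'X^l * p.
have /loc_fracP[m hm] : loc_frac (A *: cls (free_cycle hi)) 0 =
    loc_frac (B *: cls (free_cycle hj)) 0.
  apply: (can_inj psiK); rewrite -!loc_fracZ !linearZ /= hp hq !loc_fracZ.
  apply/loc_fracP; exists 0%N; rewrite /A /B !add0n.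
  change ('X^l * ('X^k * q * p) = 'X^k * ('X^l * p * q) :> FU).
  by rewrite !mulrA ['X^l * 'X^k]mulrC -!mulrA [q * p]mulrC.
pose z : Defs.cycle C := A *: free_cycle hi - B *: free_cycle hj.
have hz : 'X^m *: cls z = 0.
  have -> : cls z = A *: cls (free_cycle hi) - B *: cls (free_cycle hj).
    by rewrite /cls -!linearZ -linearB.
  by rewrite scalerBr; move: hm; rewrite !addn0 => ->; rewrite subrr.
have zE l' : coord l' (\val z) = A * (i == l')%:R - B * (j == l')%:R.
  by rewrite /coord /= mulmxBl -!scalemxAl -!row_mul PQ !mxE.
have A0 : A = 0.
  have := coord_torsion hi hz.
  by rewrite zE eqxx eq_sym (negbTE hij) mulr1 mulr0 subr0.
have hi0 : loc_frac (cls (free_cycle hi)) 0 = 0.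
  have B0 : B = 0.
    have := coord_torsion hj hz.
    by rewrite zE eqxx (negbTE hij) mulr1 mulr0 sub0r => /eqP; rewrite oppr_eq0 => /eqP.
  apply: (can_inj psiK); rewrite hp linear0; apply/loc_frac_eq0; exists 0%N.
  by rewrite (polyXnM_eq0 B0) scaler0.
move/loc_frac_eq0: hi0 => [m' /(coord_torsion hi)].
by rewrite /coord /= -row_mul PQ !mxE eqxx => /eqP; rewrite oner_eq0.
Qed.

(** The tower generator is nontorsion, so its degree is at most 0; a nontorsion class of degree 0
    has a term U^m e_o, so that degree is 2m >= 0. *)
Lemma free_index_degree o : free_index o -> g o = 0.
Proof.
move=> ho; have uniq i : free_index i -> i = o by move/free_index_unique; apply.
have [k hk] := smith_torsion P_graded Q_graded QP N_matching.
apply/eqP; rewrite eq_le; apply/andP; split.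
  apply: (@nontorsion_le0 C _ (cls (free_cycle ho))); last first.
    move=> m; apply/eqP => /(coord_torsion ho)/eqP.
    by rewrite /coord /= -row_mul PQ !mxE eqxx oner_eq0.
  exists (free_cycle ho) => // i m /=; rewrite mxE => /P_graded; lia.
have [h [z -> hz] hn] := nontorsion_0 C.
have h0 : coord o (\val z) != 0.
  apply/eqP => h0; have [||y hy] := hk (\val z); first by apply/eqP; exact: (valP z).
    by move=> i /uniq ->.
  by case/eqP: (hn k); rewrite -linearZ; apply/homology_class_eq0; exists y.
have hzQ := graded_mxM ((homogeneous_graded _ _).1 hz) Q_graded (esym (addr0 0)).
move: h0; rewrite -lead_coef_eq0 => /hzQ; lia.
Qed.

End TowerIndex.

(** * Local maps *)

Section StandardTower.
Variables (n : nat) (b : 'I_n -> int).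
Hypothesis b_neq0 : forall k, b k != 0.

Lemma std_diff_entry i j : std_diff_mx b i j != 0 -> exists k : 'I_n,
  (b k < 0 /\ i = stdT n k.*2.+1 /\ j = stdT n k.*2.+2) \/
  (0 <= b k /\ i = stdT n k.*2.+2 /\ j = stdT n k.*2.+1).
Proof.
rewrite /std_diff_mx summxE => /sum_neq0[k hk]; exists k; move: hk.
rewrite mxE; case: ltP => hb; rewrite mxE.
  case: (boolP (_ && _)) => [/andP[/eqP -> /eqP ->] _|_]; last by rewrite mulr0 eqxx.
  by left.
case: (boolP (_ && _)) => [/andP[/eqP -> /eqP ->] _|_]; last by rewrite mulr0 eqxx.
by right.
Qed.

Lemma stdT_inj i j : (i <= n.*2)%N -> (j <= n.*2)%N -> stdT n i = stdT n j -> i = j.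
Proof. by move=> hi hj /eqP; rewrite stdT_eqE // => /eqP. Qed.

Lemma std_diff_matching : matching (std_diff_mx b).
Proof.
move=> i j /std_diff_entry[k hk]; have hk' := ltn_ord k.
split=> [j'|i'] /std_diff_entry[l hl]; have hl' := ltn_ord l.
  case: hk hl => -[hb [-> ->]] [] [hc [/stdT_inj e ->]];
    have {}e : _ := e (ltac:(lia)) (ltac:(lia)); try lia;
    have kl : k = l by [apply: val_inj => /=; lia]; by rewrite kl.
case: hk hl => -[hb [-> ->]] [] [hc [-> /stdT_inj e]];
  have {}e : _ := e (ltac:(lia)) (ltac:(lia)); try lia;
  have kl : k = l by [apply: val_inj => /=; lia]; by rewrite kl.
Qed.

Lemma std_diff_neq0 (k : 'I_n) :
  if b k < 0 then std_diff_mx b (stdT n k.*2.+1) (stdT n k.*2.+2) != 0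
  else std_diff_mx b (stdT n k.*2.+2) (stdT n k.*2.+1) != 0.
Proof.
have := row_std_diff1 b 1%:M k; have := row_std_diff2 b 1%:M k; rewrite mulmx1.
by case: ifP => hb h1 h2;
  [move/rowP/(_ (stdT n k.*2.+2)): h2|move/rowP/(_ (stdT n k.*2.+1)): h1];
  rewrite !mxE eqxx mulr1 => ->; rewrite monic_neq0 ?monicXn.
Qed.

Lemma std_free (i : 'I_n.*2.+1) :
  (forall j, std_diff_mx b i j = 0 /\ std_diff_mx b j i = 0) <-> i = ord0.
Proof.
have T0 : stdT n 0 = ord0 by apply: val_inj; rewrite /= inordK.
split.
  move: i; apply: std_index => [//|k].
  have := std_diff_neq0 k; case: ifP => _ h; split=> hf;
    by move: h; rewrite ?(hf _).1 ?(hf _).2 eqxx.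
move=> -> j; rewrite -T0; split; apply/eqP/negPn/negP => /std_diff_entry[k hk];
  have hk' := ltn_ord k; case: hk => -[_ [h1 h2]];
  [move: h1|move: h1|move: h2|move: h2] => /stdT_inj h;
  by have := h (ltac:(lia)) (ltac:(lia)); lia.
Qed.

(** The standard differential is already in Smith form with T_0 as its only free index, so
    [smith_tower] applies with identity basis changes. *)
Lemma std_tower : @tower (std_chain_complex b_neq0)
  (fun x => (x : 'rV_(n.*2.+1)) 0 ord0) (delta_mx 0 ord0 : 'rV_(n.*2.+1)).
Proof.
pose S := std_chain_complex b_neq0.
have DE : lin1_mx (diff S : {linear 'rV_(grank S) -> 'rV_(grank S)}) = std_diff_mx b.
  by apply/row_matrixP => i; rewrite rowE lin1_mxE /= -rowE.
have := @smith_tower S 1%:M 1%:M (graded_mx1 _) (graded_mx1 _).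
rewrite mul1mx mulmx1 /free_index mul1mx mulmx1 DE.
move=> /(_ erefl erefl std_diff_matching ord0 ((std_free _).2 erefl)).
move=> /(_ (fun i => (std_free i).1)).
have -> : (fun x : S => ((x : 'rV_(grank S)) *m 1%:M) 0 ord0) =
    (fun x => (x : 'rV_(n.*2.+1)) 0 ord0) by apply/funext => x; rewrite mulmx1.
by rewrite row1.
Qed.

End StandardTower.

Lemma graded_mx_const m n (g : 'I_m -> int) (g' : 'I_n -> int) A i j :
  graded_mx g g' 0 A -> g i = g' j -> A i j = ((A i j)`_0)%:P.
Proof.
move=> hA hg; apply/polyP => -[|k]; rewrite coefC //=.
by apply/eqP/negPn/negP => /hA; lia.
Qed.

Lemma graded_mx_polyC m n (g : 'I_m -> int) (g' : 'I_n -> int) e (A : 'M['F_2]_(m, n)) :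
  (forall i j, A i j != 0 -> g' j = g i + e) -> graded_mx g g' e (map_mx polyC A).
Proof.
move=> h i j [|k]; rewrite mxE coefC /= ?eqxx // => /h; lia.
Qed.

Section LocalMaps.
Variables (C : almost_iota_complex) (n : nat) (a b : 'I_n -> int).
Hypothesis b_neq0 : forall k, b k != 0.
Local Notation S := (standard_complex a b_neq0).
Local Notation r := (grank C).
Local Notation g := (@gdeg C).
Local Notation D := (lin1_mx (diff C : {linear 'rV[FU]_r -> 'rV[FU]_r})).
Local Notation I := (lin1_mx (Defs.iota C : {linear 'rV[FU]_r -> 'rV[FU]_r})).
Variables (P Q : 'M[FU]_r) (o : 'I_r).
Hypothesis P_graded : graded_mx g g 0 P.
Hypothesis Q_graded : graded_mx g g 0 Q.
Hypothesis PQ : P *m Q = 1%:M.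
Hypothesis QP : Q *m P = 1%:M.
Local Notation N := (P *m D *m Q).
Local Notation W := (P *m (1%:M + I) *m Q).
Hypothesis N_matching : matching N.
Hypothesis o_free : @free_index C P Q o.
Local Notation gS := (@gdeg (std_module b)).
Local Notation DS := (std_diff_mx b).
Local Notation WS := (std_omega_mx a).
Let h : 'M[FU]_r := map_mx polyC (unit_edges (edge_of N))^T.

Lemma iota_graded : graded_mx g g 0 I.
Proof. exact: (of_degree_graded (@iota_degree C)). Qed.

Lemma omega_graded : graded_mx g g 0 W.
Proof.
have h1 : graded_mx g g 0 (1%:M + I) := graded_mxD (graded_mx1 g) iota_graded.
by apply: (graded_mxM (graded_mxM P_graded h1 erefl) Q_graded); lia.
Qed.

Lemma std_omega_graded : graded_mx gS gS 0 WS.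
Proof.
have hS := of_degree_graded (@std_iota_degree n a b b_neq0).
have -> : WS = 1%:M + lin1_mx (std_iota a b : {linear 'rV[FU]_(n.*2.+1) -> 'rV[FU]_(n.*2.+1)}).
  apply/row_matrixP => i; rewrite [in RHS]rowE mulmxDr lin1_mxE /= mulmx1 mulmxDr mulmx1.
  by rewrite addrA FUmx_double add0r -rowE.
by apply: graded_mxD hS; exact: graded_mx1.
Qed.

Lemma std_diff_redU : redU DS = 0.
Proof.
apply/matrixP => i j; rewrite !mxE /= summxE coef_sum; apply: big1 => k _.
rewrite mxE coefXnM; have : (0 < `|b k|)%N by rewrite absz_gt0.
by case: posnP.
Qed.

Lemma N_graded : graded_mx g g (-1) N.
Proof. exact: smith_graded. Qed.

Lemma homotopy_graded : graded_mx g g 1 h.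
Proof.
apply: graded_mx_polyC => i j; rewrite !mxE.
case: (boolP (edge_of N j i 0)) => [/(edge_of_degree N_graded)|_]; last by rewrite eqxx.
by lia.
Qed.

Lemma omega_rowE : P *m I = W *m P + P.
Proof.
by rewrite -[W *m P]mulmxA QP mulmx1 mulmxDr mulmx1 addrAC FUmx_double add0r.
Qed.

Lemma omega_colE : I *m Q = Q *m W + Q.
Proof.
by rewrite !mulmxA QP mul1mx mulmxDl mul1mx addrAC FUmx_double add0r.
Qed.

Lemma FUmx_cancel p q (A B B' : 'M[FU]_(p, q)) : A + B + (B' + A) = B + B'.
Proof. by rewrite [B' + A]addrC addrACA FUmx_double add0r. Qed.

(** The homotopy is the omega defect [G] followed by [h]. Of its two terms, the one containing the
    standard differential vanishes mod U because no b is zero; the other cancels the defect by the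
    last hypothesis. *)
Lemma local_from_standard (F : 'M[FU]_(n.*2.+1, r)) :
  (forall i, @free_index C P Q i -> i = o) ->
  F *m N = DS *m F -> graded_mx gS g 0 F -> redU F ord0 o = 1 ->
  redU ((WS *m F + F *m W) *m (1%:M + h *m N)) = 0 ->
  exists f : almost_iota_morphism S C, is_local f.
Proof.
move=> uniq FN gF F1 Fw.
have gFP : @of_degree S C 0 (mulmxr (F *m P)).
  apply: mulmxr_of_degree; apply: (graded_mxM gF P_graded); lia.
have FPD : DS *m (F *m P) = F *m P *m D by rewrite mulmxA -FN -!mulmxA QP mulmx1.
have comm (x : S) : (mulmxr (F *m P) (diff S x) : C) = diff C (mulmxr (F *m P) x).
  by rewrite (@complex_diffE C) /= -mulmxA FPD mulmxA.
pose f : chain_map S C := @ChainMap S C (mulmxr (F *m P)) gFP comm.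
pose G := WS *m F + F *m W.
have gG : graded_mx gS g 0 G.
  apply: graded_mxD; first by apply: (graded_mxM std_omega_graded gF); lia.
  by apply: (graded_mxM gF omega_graded); lia.
have hf : homotopic_modU (fun x => f (Defs.iota S x)) (fun x => Defs.iota C (f x)).
  exists (mulmxr (G *m h *m P)); split.
    apply: mulmxr_of_degree.
    by apply: (graded_mxM (graded_mxM gG homotopy_graded erefl) P_graded); lia.
  have hA : redU ((G *m (1%:M + h *m N) + DS *m G *m h) *m P) = 0.
    by rewrite map_mxM map_mxD Fw !map_mxM std_diff_redU !mul0mx addr0 mul0mx.
  have eG : (1%:M + WS) *m (F *m P) + F *m P *m I = G *m P.
    rewrite /G mulmxDl mul1mx -(mulmxA F P) omega_rowE mulmxDr [RHS]mulmxDl.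
    by rewrite FUmx_cancel -(mulmxA WS) -(mulmxA F).
  have key : (G *m (1%:M + h *m N) + DS *m G *m h) *m P =
      (1%:M + WS) *m (F *m P) + F *m P *m I + DS *m (G *m h *m P) + G *m h *m P *m D.
    have -> : G *m h *m P *m D = G *m h *m N *m P.
      by rewrite -[RHS]mulmxA -(smith_rowE QP) mulmxA.
    by rewrite eG mulmxDl mulmxDr mulmx1 mulmxDl addrAC (mulmxA G) !(mulmxA DS).
  have := (@in_imU_redU S C _).2 hA; congr in_imU; apply/funext => x.
  rewrite key [LHS]mulmxDr ![in LHS](mulmxDr x) !(mulmxA x).
  by rewrite (@complex_diffE C) -[Defs.iota C _]lin1_mxE /= !(mulmxA x).
exists (@AlmostIotaMorphism S C f hf).
apply: (@loc_map_bijective _ _ f _ _ _ _ (std_tower b_neq0)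
  (smith_tower P_graded Q_graded PQ QP N_matching o_free uniq)).
(* T_0 and the tower generator both have degree 0, so this entry is constant and equals its
   reduction. *)
have F1' : F ord0 o = 1.
  rewrite (graded_mx_const gF) ?(free_index_degree P_graded Q_graded PQ QP N_matching o_free).
    by move: F1; rewrite mxE /= => ->.
  by rewrite /= big_pred0.
by rewrite /= -(mulmxA _ (F *m P)) -(mulmxA F) PQ mulmx1 -rowE mxE.
Qed.

(** Mirror image of [local_from_standard]: now [h] is applied before the defect. *)
Lemma local_to_standard (F : 'M[FU]_(r, n.*2.+1)) :
  (forall i, @free_index C P Q i -> i = o) ->
  N *m F = F *m DS -> graded_mx g gS 0 F -> redU F o ord0 = 1 ->
  redU ((1%:M + N *m h) *m (W *m F + F *m WS)) = 0 ->
  exists f : almost_iota_morphism C S, is_local f.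
Proof.
move=> uniq FN gF F1 Fw.
have gQF : @of_degree C S 0 (mulmxr (Q *m F)).
  apply: mulmxr_of_degree; apply: (graded_mxM Q_graded gF); lia.
have DQF : D *m (Q *m F) = Q *m F *m DS.
  by rewrite mulmxA (smith_colE QP) -(mulmxA Q) FN mulmxA.
have comm (x : C) : (mulmxr (Q *m F) (diff C x) : S) = diff S (mulmxr (Q *m F) x).
  by rewrite (@complex_diffE C) /= -mulmxA DQF mulmxA.
pose f : chain_map C S := @ChainMap C S (mulmxr (Q *m F)) gQF comm.
pose G := W *m F + F *m WS.
have gG : graded_mx g gS 0 G.
  apply: graded_mxD; first by apply: (graded_mxM omega_graded gF); lia.
  by apply: (graded_mxM gF std_omega_graded); lia.
have hf : homotopic_modU (fun x => f (Defs.iota C x)) (fun x => Defs.iota S (f x)).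
  exists (mulmxr (Q *m h *m G)); split.
    apply: mulmxr_of_degree.
    by apply: (graded_mxM (graded_mxM Q_graded homotopy_graded erefl) gG); lia.
  have hA : redU (Q *m ((1%:M + N *m h) *m G) + Q *m h *m G *m DS) = 0.
    by rewrite map_mxD map_mxM Fw mulmx0 map_mxM std_diff_redU mulmx0 addr0.
  have eG : I *m (Q *m F) + Q *m F *m (1%:M + WS) = Q *m G.
    rewrite /G (mulmxA I) omega_colE (mulmxDl (Q *m W)) (mulmxDr (Q *m F)) mulmx1.
    by rewrite -addrA [X in _ + X = _]addrA FUmx_double add0r [RHS]mulmxDr !mulmxA.
  have key : Q *m ((1%:M + N *m h) *m G) + Q *m h *m G *m DS =
      I *m (Q *m F) + Q *m F *m (1%:M + WS) + D *m (Q *m h *m G) + Q *m h *m G *m DS.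
    have -> : D *m (Q *m h *m G) = Q *m (N *m h *m G).
      by rewrite -(mulmxA Q h) (mulmxA D) (smith_colE QP) -(mulmxA N) -(mulmxA Q).
    by rewrite eG (mulmxDl 1%:M) mul1mx (mulmxDr Q).
  have := (@in_imU_redU C S _).2 hA; congr in_imU; apply/funext => x.
  rewrite key [LHS]mulmxDr ![in LHS](mulmxDr x) !(mulmxA x).
  by rewrite (@complex_diffE C) -[Defs.iota C _]lin1_mxE /= !(mulmxA x).
exists (@AlmostIotaMorphism C S f hf).
apply: (@loc_map_bijective _ _ f _ _ _ _
  (smith_tower P_graded Q_graded PQ QP N_matching o_free uniq) (std_tower b_neq0)).
have F1' : F o ord0 = 1.
  rewrite (graded_mx_const gF) ?(free_index_degree P_graded Q_graded PQ QP N_matching o_free).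
    by move: F1; rewrite mxE /= => ->.
  by rewrite /= big_pred0.
by rewrite /= -row_mul mulmxA PQ mul1mx mxE.
Qed.

End LocalMaps.

Lemma matching_tr r (N : 'M[FU]_r) : matching N -> matching N^T.
Proof.
move=> h i j; rewrite mxE => /h[h1 h2]; split=> m; rewrite mxE; [exact: h2|exact: h1].
Qed.

Section IotaModU.
Variables (C : almost_iota_complex).
Local Notation r := (grank C).
Local Notation D := (lin1_mx (diff C : {linear 'rV[FU]_r -> 'rV[FU]_r})).
Local Notation I := (lin1_mx (Defs.iota C : {linear 'rV[FU]_r -> 'rV[FU]_r})).
Variables (P Q : 'M[FU]_r).
Hypothesis QP : Q *m P = 1%:M.
Local Notation N := (P *m D *m Q).
Local Notation W := (P *m (1%:M + I) *m Q).

Lemma conj_mul (A B : 'M[FU]_r) : P *m A *m Q *m (P *m B *m Q) = P *m (A *m B) *m Q.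
Proof. by rewrite !mulmxA -(mulmxA (P *m A)) QP mulmx1. Qed.

Lemma eq_redU m n (A B : 'M[FU]_(m, n)) : redU (A + B) = 0 -> redU A = redU B.
Proof. by rewrite map_mxD => /eqP; rewrite addr_eq0 F2mx_oppr => /eqP. Qed.

Lemma omega_chain_modU : redU N *m redU W = redU W *m redU N.
Proof.
have h : redU (D *m I + I *m D) = 0.
  apply/(@in_imU_redU C C) => x; have [y hy] := @iota_comm C x; exists y.
  by rewrite -hy mulmxDr !mulmxA !lin1_mxE.
rewrite -!map_mxM !conj_mul; apply: eq_redU.
rewrite -mulmxDl -mulmxDr.
have -> : D *m (1%:M + I) + (1%:M + I) *m D = D *m I + I *m D.
  by rewrite mulmxDr mulmxDl mulmx1 mul1mx addrACA FUmx_double add0r.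
by rewrite !map_mxM h mulmx0 mul0mx.
Qed.

(** In characteristic 2, (1 + iota)^2 = 1 + iota^2, so the homotopy given for iota^2 works for
    omega^2. *)
Lemma omega_sq_modU : exists H, redU W *m redU W = H *m redU N + redU N *m H.
Proof.
have [H [_ hH]] := @iota_iota C.
pose M := lin1_mx (H : {linear 'rV[FU]_r -> 'rV[FU]_r}).
have h : redU (I *m I + 1%:M + D *m M + M *m D) = 0.
  apply/(@in_imU_redU C C) => x; have [y hy] := hH x; exists y.
  by rewrite -hy !mulmxDr mulmx1 !mulmxA !lin1_mxE.
exists (redU (P *m M *m Q)); rewrite -!map_mxM !conj_mul -map_mxD.
rewrite -mulmxDl -mulmxDr; apply: eq_redU; rewrite -mulmxDl -mulmxDr.
have -> : (1%:M + I) *m (1%:M + I) + (M *m D + D *m M) = I *m I + 1%:M + D *m M + M *m D.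
  rewrite mulmxDl mul1mx mulmxDr mulmx1 addrA -(addrA 1%:M) (addrA I) FUmx_double add0r.
  by rewrite [1%:M + _]addrC -!addrA [M *m D + _]addrC.
by rewrite !map_mxM h mulmx0 mul0mx.
Qed.

End IotaModU.

Theorem theorem6p2 (C : almost_iota_complex) :
  exists (n : nat) (a b : 'I_n -> int) (b_neq0 : forall k, b k != 0),
    (forall k, a k = -1 \/ a k = 1) /\
    locally_equivalent C (standard_complex a b_neq0).
Proof.
pose g := @gdeg C.
pose D := lin1_mx (diff C : {linear 'rV[FU]_(grank C) -> 'rV[FU]_(grank C)}).
pose I := lin1_mx (Defs.iota C : {linear 'rV[FU]_(grank C) -> 'rV[FU]_(grank C)}).
have gD : graded_mx g g (-1) D := of_degree_graded (@diff_degree C).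
have [P [Q [gP gQ PQ QP mN]]] := graded_smith_form gD (complex_mx_sq C).
pose N := P *m D *m Q; pose W := P *m (1%:M + I) *m Q.
have gN : graded_mx g g (-1) N := smith_graded gP gQ.
have N2 : N *m N = 0 := smith_sq QP.
have gW : graded_mx g g 0 W := omega_graded gP gQ.
have E := edge_system_of mN N2.
have [o ho] := free_index_exists gP gQ QP mN.
have uniq i : free_index P Q i -> i = o by move=> hi; exact: (free_index_unique PQ QP hi ho).
have o0 : g o = 0 := free_index_degree gP gQ PQ QP mN ho.
have redN := redU_unit_edges gN.
have Wc : unit_edges (edge_of N) *m redU W = redU W *m unit_edges (edge_of N).
  by rewrite -redN; exact: omega_chain_modU.
have W2 : exists H,
    redU W *m redU W = H *m unit_edges (edge_of N) + unit_edges (edge_of N) *m H.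
  by rewrite -redN; exact: omega_sq_modU.
have dW i j : redU W i j != 0 -> g i = g j by rewrite mxE => /gW; lia.
have [||| n [L [t [t' [hL ht ht']]]]] := string_exists (o := o) E Wc W2.
- by move=> j k; apply/negP => /edge_of_neq0; rewrite (ho j).1 eqxx.
- by move=> j k; apply/negP => /edge_of_neq0; rewrite (ho j).2 eqxx.
- move=> i h1 h2; apply: uniq => j; split; apply/eqP/negPn/negP => /(edge_of_ex gN) h.
    exact: (negP (h1 _ _) h).
  exact: (negP (h2 _ _) h).
have okL i : (i < n.*2)%N -> ok_letter (L i) by move=> /hL[].
have tagL i : (i < n.*2)%N -> (L i).1 = ~~ odd i by move=> /hL[].
pose a (k : 'I_n) := (L k.*2).2; pose b (k : 'I_n) := (L k.*2.+1).2.
have k0 (k : 'I_n) : (k.*2 < n.*2)%N by have := ltn_ord k; lia.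
have k1 (k : 'I_n) : (k.*2.+1 < n.*2)%N by have := ltn_ord k; lia.
have aE (k : 'I_n) : L k.*2 = (true, a k).
  by rewrite [LHS]surjective_pairing tagL ?odd_double.
have bE (k : 'I_n) : L k.*2.+1 = (false, b k).
  by rewrite [LHS]surjective_pairing tagL //= odd_double.
have a_sign (k : 'I_n) : a k = -1 \/ a k = 1.
  by have := okL _ (k0 k); rewrite aE /ok_letter /=; lia.
have b_neq0 (k : 'I_n) : b k != 0 by have := okL _ (k1 k); rewrite bE.
exists n, a, b, b_neq0; split=> //; split; last first.
  have [T [hT dT]] := string_rep_homogeneous E (edge_of_degree gN) dW o0 okL ht.
  have [F [FN gF F1 Fw]] := string_realization gN mN N2 Wc W2 a_sign b_neq0 aE bE hT dT.
  exact: (local_from_standard b_neq0 gP gQ PQ QP mN ho uniq FN gF F1 Fw).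
(* The map to the standard complex comes from the transposed data, with negated degrees and opposite
   letters; the resulting matrix F is transposed back. *)
pose L' i := opp_letter (L i).
have gN' : graded_mx (fun i => - g i) (fun i => - g i) (-1) N^T := graded_mx_tr gN.
have mN' := matching_tr mN.
have N2' : N^T *m N^T = 0 by rewrite -trmx_mul N2 trmx0.
have eN' : edge_of N^T = fun j i => edge_of N i j := edge_of_tr N.
have uN' : unit_edges (edge_of N^T) = (unit_edges (edge_of N))^T.
  by rewrite eN' unit_edges_tr.
have Wc' : unit_edges (edge_of N^T) *m redU W^T = redU W^T *m unit_edges (edge_of N^T).
  by rewrite uN' -map_trmx -!trmx_mul Wc.
have W2' : exists H, redU W^T *m redU W^T =
    H *m unit_edges (edge_of N^T) + unit_edges (edge_of N^T) *m H.
  have [H hH] := W2; exists H^T.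
  by rewrite uN' -map_trmx -!trmx_mul hH linearD /= addrC.
have dW' i j : redU W^T i j != 0 -> - g i = - g j by rewrite -map_trmx mxE => /dW ->.
have okL' i : (i < n.*2)%N -> ok_letter (L' i).
  by move=> /okL; rewrite /L' /ok_letter /=; case: (L i).1; lia.
have ht2 : string_rep (edge_of N^T) (redU W^T) o n L' t' by rewrite eN' -map_trmx.
have [|T [hT dT]] := string_rep_homogeneous (edge_system_of mN' N2')
  (edge_of_degree gN') dW' _ okL' ht2.
  by rewrite o0 oppr0.
pose a' k := - a k; pose b' k := - b k.
have aE' (k : 'I_n) : L' k.*2 = (true, a' k) by rewrite /L' aE.
have bE' (k : 'I_n) : L' k.*2.+1 = (false, b' k) by rewrite /L' bE.
have a_sign' (k : 'I_n) : a' k = -1 \/ a' k = 1 by rewrite /a'; have := a_sign k; lia.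
have b_neq0' (k : 'I_n) : b' k != 0 by rewrite oppr_eq0.
have [F [FN gF F1 Fw]] :=
  string_realization gN' mN' N2' Wc' W2' a_sign' b_neq0' aE' bE' hT dT.
apply: (@local_to_standard C n a b b_neq0 P Q o gP gQ PQ QP mN ho F^T uniq).
- by rewrite -[LHS]trmxK trmx_mul trmxK FN (std_diff_mx_tr b_neq0) trmx_mul trmxK.
- have degN j : @gdeg (std_module b') j = - @gdeg (std_module b) j.
    by rewrite /= -sumrN; apply: eq_bigr => l _; rewrite /b' sgrN; lia.
  by move=> i j k; rewrite mxE => /gF; rewrite degN -/(g i); lia.
- by rewrite -map_trmx mxE.
have trE : (1%:M + N *m map_mx polyC (unit_edges (edge_of N))^T) *m
    (W *m F^T + F^T *m std_omega_mx a) =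
    ((std_omega_mx a' *m F + F *m W^T) *m
     (1%:M + map_mx polyC (unit_edges (edge_of N^T))^T *m N^T))^T.
  have trD p q (A B : 'M[FU]_(p, q)) : (A + B)^T = A^T + B^T by exact: linearD.
  rewrite uN' trmxK trmx_mul !trD trmx1 (trmx_mul (map_mx _ _)) (trmx_mul F) !trmxK.
  by rewrite (trmx_mul (std_omega_mx a')) (std_omega_mx_tr a_sign) trmxK map_trmx
    [X in _ *m X = _]addrC.
by rewrite -/N -/W trE -map_trmx Fw trmx0.
Qed.
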